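(* Let $n_0=\max\{2.67\times 9^{17},\ 10.2\times 2^{(t-1)(l-1)+l-3}+2\}$. \begin{description} \item[(i)] If $t=1$, $l\ge 6$ and $n\ge \max\{n_0,\ \tfrac{625}{32}\lfloor \tfrac{l-3}{3}\rfloor^2+2\}$, then the extremal graph to $\mathrm{spex}_{\mathcal{P}}(n,P_{t\cdot l})$ is $K_2\vee H_{\mathcal{P}}(l-3-2\lfloor \tfrac{l-3}{3}\rfloor,\lfloor \tfrac{l-3}{3}\rfloor)$. \item[(ii)] If $t=2$, $l\ge 4$ and $n\ge \max\{n_0,\ \tfrac{625}{32}\lfloor \tfrac{2l-4}{3}\rfloor^2+2\}$, then the extremal graph to $\mathrm{spex}_{\mathcal{P}}(n,P_{t\cdot l})$ is $K_2\vee H_{\mathcal{P}}(2l-4-2\lfloor \tfrac{2l-4}{3}\rfloor,\lfloor \tfrac{2l-4}{3}\rfloor)$. \item[(iii)] If $t\ge 5$, $l\ge 3$ and $n\ge \max\{n_0,\ \tfrac{625}{32}\lfloor \tfrac{l-3}{2}\rfloor^2+2\}$, then the extremal graph to $\mathrm{spex}_{\mathcal{P}}(n,P_{t\cdot l})$ is $K_2\vee H_{\mathcal{P}}(tl-t-l,\,l-2)$. \end{description} Here ''the extremal graph to $\mathrm{spex}_{\mathcal{P}}(n,F)$ is $X$'' means that $X$ is an $n$-vertex $F$-free planar graph and every $n$-vertex $F$-free planar graph of maximum spectral radius is isomorphic to $X$.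
   Context: All graphs are finite and simple. The spectral radius of a graph is the largest eigenvalue of its adjacency matrix. A graph is $F$-free if it contains no subgraph isomorphic to $F$. $\mathrm{spex}_{\mathcal{P}}(n,F)$ denotes the maximum spectral radius over all $n$-vertex $F$-free planar graphs. $P_l$ denotes the path on $l$ vertices, $K_2$ a single edge, and $G_1\vee G_2$ the join (disjoint union plus all edges between $G_1$ and $G_2$). $P_{t\cdot l}$ denotes the starlike tree obtained from a central vertex $v$ and $t$ vertex-disjoint copies of $P_{l-1}$ by joining $v$ to one endpoint of each copy (so $P_{t\cdot l}$ has $t(l-1)+1$ vertices, $P_{1\cdot l}=P_l$, $P_{2\cdot l}=P_{2l-1}$). For positive integers $n,n_1,n_2$ with $n\ge n_1\ge n_2\ge 1$, $H_{\mathcal{P}}(n_1,n_2)$ (depending on $n$) is the disjoint union of paths on $n-2$ vertices defined by: $H_{\mathcal{P}}(n_1,n_2)=P_{n_1}\cup \frac{n-2-n_1}{n_2}P_{n_2}$ if $n_2\mid (n-2-n_1)$, and otherwise $H_{\mathcal{P}}(n_1,n_2)=P_{n_1}\cup \lfloor \frac{n-2-n_1}{n_2}\rfloor P_{n_2}\cup P_{\,n-2-n_1-\lfloor \frac{n-2-n_1}{n_2}\rfloor n_2}$, where $kP_m$ denotes $k$ vertex-disjoint copies of $P_m$. *)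

(* Defs.v *)
From HB Require Import structures.
From mathcomp Require Import all_boot all_order all_algebra.
From mathcomp Require Import all_classical all_reals.
From mathcomp Require Import topology normedtype.
From mathcomp Require Import Rstruct Rstruct_topology.
From Stdlib Require Rdefinitions.

Set Implicit Arguments.
Unset Strict Implicit.
Unset Printing Implicit Defensive.

Import Order.TTheory GRing.Theory Num.Theory.
Local Open Scope ring_scope.
Local Open Scope classical_set_scope.

Notation RR := Rdefinitions.R.

Definition simple_graph (n : nat) (e : rel 'I_n) : Prop :=
  symmetric e /\ irreflexive e.

Definition adjmx (n : nat) (e : rel 'I_n) : 'M[RR]_n :=
  \matrix_(i, j) (e i j)%:R.

(* spectral radius = largest eigenvalue of the adjacency matrix
   (the eigenvalues of a real symmetric matrix are real and finitely many,
    so the supremum of the set of real eigenvalues is its maximum). *)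
Definition spec_rad (n : nat) (e : rel 'I_n) : RR :=
  sup [set a : RR | eigenvalue (adjmx e) a].

Definition contains_sub (k n : nat) (eF : rel 'I_k) (e : rel 'I_n) : Prop :=
  exists f : 'I_k -> 'I_n, injective f /\ forall a b, eF a b -> e (f a) (f b).

Definition Ffree (k n : nat) (eF : rel 'I_k) (e : rel 'I_n) : Prop :=
  ~ contains_sub eF e.

Definition isomorphic (n : nat) (e1 e2 : rel 'I_n) : Prop :=
  exists f : 'I_n -> 'I_n, bijective f /\ forall a b, e1 a b = e2 (f a) (f b).

Definition planar (n : nat) (e : rel 'I_n) : Prop :=
  exists (p : 'I_n -> RR * RR) (arc : 'I_n -> 'I_n -> RR -> RR * RR),
    injective p /\
    (forall x y : 'I_n, (x < y)%N -> e x y ->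
       {within `[0, 1], continuous (arc x y)} /\
       {in `[0, 1] &, injective (arc x y)} /\
       arc x y 0 = p x /\ arc x y 1 = p y) /\
    (forall (x y z : 'I_n) (s : RR), (x < y)%N -> e x y -> 0 < s < 1 -> arc x y s <> p z) /\
    (forall (x y u v : 'I_n) (s s' : RR), (x < y)%N -> e x y -> (u < v)%N -> e u v ->
       (x, y) <> (u, v) -> 0 < s < 1 -> 0 < s' < 1 ->
       arc x y s <> arc u v s').

Local Open Scope nat_scope.

(* The starlike tree P_{t.l}: vertex 0 is the centre v; for i < t and
   j < l-1, vertex 1 + i*(l-1) + j is the j-th vertex of the i-th copy of
   P_{l-1}, whose vertex j = 0 is joined to v. *)
Definition star_nat (l : nat) (x y : nat) : bool :=
  let m := (l - 1)%N in
  [|| (x == 0%N) && (0 < y)%N && ((y - 1) %% m == 0%N),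
      (y == 0%N) && (0 < x)%N && ((x - 1) %% m == 0%N)
    | [&& (0 < x)%N, (0 < y)%N, ((x - 1) %/ m == (y - 1) %/ m) &
          (((x - 1) %% m).+1 == (y - 1) %% m) || (((y - 1) %% m).+1 == (x - 1) %% m)]].

Definition starlike (t l : nat) : rel 'I_(t * (l - 1)).+1 :=
  fun x y => star_nat l x y.

(* Disjoint union of paths with block sizes s, on vertices 0 .. sumn s - 1
   laid out consecutively: x ~ y iff they are consecutive and the larger one
   is not the first vertex of a block. *)
Definition block_starts (s : seq nat) : seq nat :=
  [seq \sum_(i < k) nth 0%N s i | k <- iota 0 (size s)].

Definition paths_adj (s : seq nat) (x y : nat) : bool :=
  [&& (x.+1 == y) || (y.+1 == x), (maxn x y < sumn s)%N &
      maxn x y \notin block_starts s].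

Definition HP_blocks (n n1 n2 : nat) : seq nat :=
  let q := ((n - 2 - n1) %/ n2)%N in
  if n2 %| (n - 2 - n1) then n1 :: nseq q n2
  else n1 :: nseq q n2 ++ [:: (n - 2 - n1 - q * n2)%N].

(* K_2 \/ H_P(n1,n2) on 'I_n: vertices n-2 and n-1 form the K_2,
   vertices 0 .. n-3 carry H_P(n1,n2). *)
Definition K2_join_HP (n n1 n2 : nat) : rel 'I_n :=
  fun x y => (x != y) &&
    [|| (n - 2 <= x)%N, (n - 2 <= y)%N | paths_adj (HP_blocks n n1 n2) x y].

Local Open Scope ring_scope.

Definition spex_extremal (k n : nat) (eF : rel 'I_k) (X : rel 'I_n) : Prop :=
  (simple_graph X /\ planar X /\ Ffree eF X) /\
  forall G : rel 'I_n, simple_graph G -> planar G -> Ffree eF G ->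
    (forall G' : rel 'I_n, simple_graph G' -> planar G' -> Ffree eF G' ->
        spec_rad G' <= spec_rad G) ->
    isomorphic G X.

Definition n0 (t l : nat) : RR :=
  Num.max (267 / 100 * 9 ^+ 17)
          (102 / 10 * 2 ^+ ((t - 1) * (l - 1) + l - 3)%N + 2).

Arguments starlike : clear implicits.
Arguments K2_join_HP : clear implicits.

(* Main.v *)
Require Import Defs.
From HB Require Import structures.
From mathcomp Require Import all_boot all_order all_algebra.
From mathcomp Require Import all_classical all_reals.
From mathcomp Require Import topology normedtype derive.
From mathcomp Require Import Rstruct Rstruct_topology.
From mathcomp Require Import fintype finset.
From mathcomp Require Import zify ring lra.
From Stdlib Require Btauto.
Import Order.TTheory GRing.Theory Num.Theory.
Import numFieldNormedType.Exports.

(* A planar graph has no K5 minor and no K33 subgraph: an odd number of crossings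
   of polygonal approximations of the arcs, counted in L-shaped pieces, would be
   forced. By Mader's argument a K5-minor-free graph on a set A has at most
   3|A| - 6 edges.

   Let G be extremal, with Perron vector x normalised to maximum 1 at u. Since
   rho(G)^2 >= 2(n - 2), the edge bound and K33-freeness force a second vertex v
   with x v close to 1, while all other entries are small. Keeping only the edges
   inside the common neighbourhood of u and v, and joining u and v to everything,
   does not decrease the Rayleigh quotient and keeps G free of P_{t.l}, because the
   common neighbourhood is huge. Hence G is the join of K2 with a linear forest.

   Write rho = q + 1/q. In the join of K2 with paths of orders s_1, s_2, ... the
   eigenvector is explicit on each path, and maximising rho amounts to minimising
   the sum of w(s_i), where w(k) = (1 + q)/(1 + q^(k+1)) - 1 is increasing and
   strictly concave. Concavity lets one lengthen long blocks at the expense of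
   short ones as long as the join stays P_{t.l}-free, which is a condition on the
   three longest blocks when t <= 2, and, up to a case that is far from optimal, on
   the sum of the floors of s_i/(l-1) when t >= 5. *)

(** * Edge bound for K5-minor-free graphs *)

(** Planarity is given by arbitrary continuous arcs, so neither faces nor Euler's formula are at
    hand. Arithmetic modulo 2 takes the place of the Jordan curve theorem: winding terms cancel in a
    sum over pairs of disjoint edges. Afterwards planarity acts only through the absence of K5
    minors and of K33; double wheels, which contain K5 minors, make the graph on the common
    neighbourhood acyclic.

    The bound rho(G)^2 >= 2(n - 2) comes from the claimed extremal join, which contains K_{2,n-2}.
    Call the two vertices of K2 heads. Block lists are compared at the single value q of the
    extremal graph: for every list and every q an explicit vector solves the equations at the path
    vertices, and the equation at the heads alone tells on which side of q + 1/q the radius lies. No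
    competitor's radius is computed. As q is small, a nonempty block costs q up to order q^2, so the
    number of blocks decides before their lengths do. All exchanges are strict, whence uniqueness of
    the sorted list of nonempty blocks. *)

Definition connected_in {T : finType} (e : rel T) (B : {set T}) : Prop :=
  (exists x, x \in B) /\
  forall x y, x \in B -> y \in B ->
    connect [rel a b | [&& e a b, a \in B & b \in B]] x y.

(** Branch sets are indexed by [nat], only the indices below 5 counting, so that the ten pairs can
    be enumerated by computation. *)
Definition K5_minor {T : finType} (e : rel T) (B : nat -> {set T}) : Prop :=
  [/\ forall i, (i < 5)%N -> connected_in e (B i),
      forall i j x, (i < j < 5)%N -> x \in B i -> x \notin B j &
      forall i j, (i < j < 5)%N -> exists x y, [/\ x \in B i, y \in B j & e x y]].

Lemma connected_in_path {T : finType} (e : rel T) (B : {set T}) x y :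
  connected_in e B -> x \in B -> y \in B ->
  exists p, [/\ path e x p, last x p = y & {subset p <= B}].
Proof.
move=> [_ conn] xB yB; have /connectP[p pp ->] := conn x y xB yB.
exists p; elim: p x {xB} pp => [|z p IH] x //= /andP[/and3P[exz _ zB] /IH[pp _ pB]].
rewrite exz pp; split=> // t; rewrite in_cons => /orP[/eqP ->|/pB //]; exact: zB.
Qed.

Definition nbrs {T : finType} (e : rel T) (A : {set T}) (a : T) : {set T} :=
  [set b in A | e a b].

(** For a simple graph this is twice the number of edges inside [A]; unordered pairs are never
    formed. *)
Definition deg_sum {T : finType} (e : rel T) (A : {set T}) : nat :=
  \sum_(a in A) #|nbrs e A a|.

Definition K5_minor_free {T : finType} (e : rel T) (A : {set T}) : Prop :=
  forall B : nat -> {set T}, (forall i, (i < 5)%N -> B i \subset A) -> ~ K5_minor e B.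

(** The merged vertex keeps the name [x]. As [y] cannot leave the type, it is removed from the
    vertex set: the contracted graph lives on [A :\ y]. *)
Definition contract {T : finType} (e : rel T) (x y : T) : rel T :=
  fun a b => (a != b) && [|| e a b, (a == x) && e y b | (b == x) && e y a].

Lemma contract_sym {T : finType} (e : rel T) x y : symmetric e -> symmetric (contract e x y).
Proof. by move=> sym a b; rewrite /contract eq_sym sym; congr (_ && _); rewrite orbCA orbC orbA orbC. Qed.

Lemma connected_in_set1 {T : finType} (e : rel T) x : connected_in e [set x].
Proof.
by split=> [|a b]; [exists x; rewrite inE | rewrite !inE => /eqP -> /eqP ->].
Qed.

Lemma connected_in_set2 {T : finType} (e : rel T) x y : symmetric e -> e x y ->
  connected_in e [set x; y].
Proof.
move=> sym exy; split=> [|a b]; first by exists x; rewrite !inE eqxx.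
by rewrite !inE => /orP[] /eqP -> /orP[] /eqP -> //; apply: connect1;
  rewrite /= !inE !eqxx ?orbT ?exy // sym exy.
Qed.

Lemma K5_pairs (P : nat -> nat -> Prop) :
  P 0 1 -> P 0 2 -> P 0 3 -> P 0 4 -> P 1 2 -> P 1 3 -> P 1 4 -> P 2 3 -> P 2 4 -> P 3 4 ->
  forall i j, (i < j < 5)%N -> P i j.
Proof.
by move=> ? ? ? ? ? ? ? ? ? ? [|[|[|[|[|i]]]]] [|[|[|[|[|j]]]]] //; rewrite !ltnS => /andP[].
Qed.

(** A minor of the contracted graph is pulled back by adding [y] to the branch set that contains
    [x], if there is one. *)
Lemma K5_minor_contract {T : finType} (e : rel T) (A : {set T}) x y :
  symmetric e -> x \in A -> y \in A -> x != y -> e x y ->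
  K5_minor_free e A -> K5_minor_free (contract e x y) (A :\ y).
Proof.
move=> sym xA yA xy exy free B BA [conn disj adj].
pose C i := if x \in B i then y |: B i else B i.
have BC i z : z \in B i -> z \in C i by rewrite /C; case: ifP; rewrite // !inE => _ ->; rewrite orbT.
have yB i : (i < 5)%N -> y \notin B i.
  by move=> i5; apply/negP => /(subsetP (BA i i5)); rewrite !inE eqxx.
have CB i z : (i < 5)%N -> z \in C i -> z \in B i \/ z = y /\ x \in B i.
  by move=> i5; rewrite /C; case: ifP => xB; [rewrite !inE => /orP[/eqP ->|->]; [right|left] | left].
apply: (free C).
  move=> i i5; apply/subsetP => z /(CB i z i5)[/(subsetP (BA i i5))|[-> _]] //.
  by rewrite !inE => /andP[].
split.
- move=> i i5; have [[z zB] cB] := conn i i5.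
  split; first by exists z; apply: BC.
  pose r := [rel a b | [&& e a b, a \in C i & b \in C i]].
  have rsym : symmetric r by move=> a b /=; rewrite sym andbCA andbC -andbA [X in _ && X]andbC.
  have csym := sym_connect_sym rsym.
  have yC : x \in B i -> y \in C i by rewrite /C => ->; rewrite !inE eqxx.
  have cxy : x \in B i -> connect r x y.
    by move=> xB; apply: connect1; rewrite /= exy (BC _ _ xB) yC.
  have cBC a b : a \in B i -> b \in B i -> connect r a b.
    move=> aB bB; apply: (connect_sub _ (cB a b aB bB)) => {aB bB} {}a {}b /= /and3P[].
    rewrite /contract => /andP[_ /or3P[eab|/andP[/eqP -> eyb]|/andP[/eqP -> eya]]] aB bB.
    + by apply: connect1; rewrite /= eab !BC.
    + by apply: connect_trans (cxy aB) _; apply: connect1; rewrite /= eyb yC // BC.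
    + rewrite csym; apply: connect_trans (cxy bB) _; apply: connect1.
      by rewrite /= eya yC // BC.
  move=> a b /(CB _ _ i5)[aB|[-> xB]] /(CB _ _ i5)[bB|[-> xB']].
  + exact: cBC.
  + by apply: connect_trans (cxy xB'); apply: cBC.
  + by rewrite csym; apply: connect_trans (cxy xB); apply: cBC.
  + by [].
- move=> i j z ij5 zC; have [i5 j5] : (i < 5)%N /\ (j < 5)%N by lia.
  apply/negP => /(CB _ _ j5) zC'; case/(CB _ _ i5): zC => [zB|[zy xB]]; case: zC' => [zB'|[zy' xB']].
  + by have := disj _ _ _ ij5 zB; rewrite zB'.
  + by have := yB _ i5; rewrite -zy' zB.
  + by have := yB _ j5; rewrite -zy zB'.
  + by have := disj _ _ _ ij5 xB; rewrite xB'.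
- move=> i j ij5; have [i5 j5] : (i < 5)%N /\ (j < 5)%N by lia.
  have [a [b [aB bB]]] := adj i j ij5.
  rewrite /contract => /andP[_ /or3P[eab|/andP[/eqP ax eyb]|/andP[/eqP bx eya]]].
  + by exists a, b; rewrite !BC.
  + exists y, b; rewrite (BC _ _ bB) eyb; split=> //.
    by rewrite /C -ax aB !inE eqxx.
  + exists a, y; rewrite (BC _ _ aB) sym eya; split=> //.
    by rewrite /C -bx bB !inE eqxx.
Qed.

(** Contraction loses the edge xy and one edge per common neighbour, each counted twice: once at the
    merged vertex ([merged]) and once at the common neighbours ([others]). *)
Lemma deg_sum_contract {T : finType} (e : rel T) (A : {set T}) x y :
  symmetric e -> irreflexive e -> x \in A -> y \in A -> x != y -> e x y ->
  (deg_sum e A <= deg_sum (contract e x y) (A :\ y) + 2 + 2 * #|nbrs e A x :&: nbrs e A y|)%N.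
Proof.
move=> sym irr xA yA xy exy.
have xA' : x \in A :\ y by rewrite !inE xy.
set c := #|_ :&: _|.
rewrite /deg_sum (big_setD1 y yA) (big_setD1 x xA') [in leqRHS](big_setD1 x xA') /=.
have others : (\sum_(a in A :\ y :\ x) #|nbrs e A a| <=
   \sum_(a in A :\ y :\ x) #|nbrs (contract e x y) (A :\ y) a| + c)%N.
  have -> : c = (\sum_(a in A :\ y :\ x) (e a x && e a y))%N.
    rewrite -big_mkcondr /= sum1dep_card /c; apply: eq_card => a; rewrite !inE.
    rewrite (sym a x) (sym a y).
    have [->|ax] := eqVneq a x; first by rewrite irr ?andbF.
    have [->|ay] := eqVneq a y; first by rewrite irr ?andbF.
    by case: (a \in A); case: (e a x); case: (e a y).
  rewrite -big_split /=; apply: leq_sum => a; rewrite !inE => /and3P[ax ay aA].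
  have [eay|neay] := boolP (e a y); last first.
    rewrite andbF addn0; apply: subset_leq_card; apply/subsetP => b; rewrite !inE => /andP[bA eab].
    rewrite bA andbT /contract eab /=; apply/and3P; split=> //.
      by apply: contraNneq neay => <-.
    by apply: contraTneq eab => ->; rewrite irr.
  have sub : nbrs e A a \subset y |: (nbrs (contract e x y) (A :\ y) a :\: (if e a x then set0 else [set x])).
    apply/subsetP => b; rewrite !inE => /andP[bA eab]; have [//|by_ /=] := eqVneq b y.
    rewrite bA /contract eab /= andbT.
    have -> : a != b by apply: contraTneq eab => ->; rewrite irr.
    rewrite !andbT; case: ifP => eax; rewrite !inE //.
    by apply: contraFneq eax => <-.
  have xn : x \in nbrs (contract e x y) (A :\ y) a.
    by rewrite !inE xy xA /contract ax /= eqxx (sym y a) eay !orbT.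
  apply: (leq_trans (subset_leq_card sub)); rewrite cardsU1.
  case: (e a x); rewrite ?setD0 /=; first by clear; lia.
  by have := cardsD1 x (nbrs (contract e x y) (A :\ y) a); rewrite xn; clear; lia.
have merged : (#|nbrs e A x| + #|nbrs e A y| <= #|nbrs (contract e x y) (A :\ y) x| + c + 2)%N.
  rewrite -cardsUI -/c.
  have sub : nbrs e A x :|: nbrs e A y \subset x |: (y |: nbrs (contract e x y) (A :\ y) x).
    apply/subsetP => b; rewrite !inE /contract eqxx => H.
    have [//|bx] := eqVneq b x; have [//|by_] /= := eqVneq b y.
    by move: H; case: (b \in A) => //=; case: (e x b) => //= ->.
  have := subset_leq_card sub; rewrite !cardsU1; lia.
lia.
Qed.

Lemma deg_sum_delete_edge {T : finType} (e : rel T) (A : {set T}) x y :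
  (deg_sum e A <= deg_sum (fun a b => e a b && ((a, b) != (x, y)) && ((a, b) != (y, x))) A + 2)%N.
Proof.
set e' := fun a b => _.
have H a : (#|nbrs e A a| <= #|nbrs e' A a| + ((a == x) + (a == y)))%N.
  have sub : nbrs e A a \subset nbrs e' A a :|:
     ((if a == x then [set y] else set0) :|: (if a == y then [set x] else set0)).
    apply/subsetP => b; rewrite !inE /e' !xpair_eqE => /andP[-> ->] /=.
    by case: (a == x); case: (a == y); rewrite ?inE; case: (b == x); case: (b == y).
  apply: (leq_trans (subset_leq_card sub)); apply: (leq_trans (leq_card_setU _ _)).
  rewrite leq_add2l; apply: (leq_trans (leq_card_setU _ _)).
  by apply: leq_add; case: ifP; rewrite ?cards1 ?cards0.
apply: (@leq_trans (\sum_(a in A) (#|nbrs e' A a| + ((a == x) + (a == y))))).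
  by apply: leq_sum => a _; apply: H.
rewrite big_split /= leq_add2l big_split /=.
have one z : (\sum_(i in A) (i == z) <= 1)%N.
  rewrite -big_mkcondr /= sum1dep_card -(cards1 z); apply: subset_leq_card.
  by apply/subsetP => b; rewrite !inE => /andP[_ ->].
by have := one x; have := one y; lia.
Qed.

(** The branch sets are v, a, q, c and {p, b}. Allowing p = b lets the same statement serve for a K5
    subgraph. *)
Lemma K5_minor_free_pair {T : finType} (e : rel T) (A : {set T}) v a p b q c :
  symmetric e -> irreflexive e -> K5_minor_free e A ->
  v \in A -> a \in A -> p \in A -> b \in A -> q \in A -> c \in A ->
  (p == b) || e p b -> e v b -> b != a -> b != q -> b != c ->
  e v a -> e v p -> e v q -> e v c -> e a p -> e a q -> e a c ->
  e p q || e b q -> e p c || e b c -> p != q -> p != c -> e q c -> False.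
Proof.
move=> sym irr free vA aA pA bA qA cA pb evb ba bq bc eva evp evq evc eap eaq eac epbq epbc pq pc eqc.
have ne x y : e x y -> x != y by apply: contraTneq => ->; rewrite irr.
pose B i := nth set0 [:: [set v]; [set a]; [set p; b]; [set q]; [set c]] i.
apply: (free B).
  by do 5?[case=> [_|]] => //; rewrite /B /=; apply/subsetP => x; rewrite !inE => H; move: H;
    do ?[case/orP]; move/eqP => ->.
split.
- case=> [_|[_|[_|[_|[_|//]]]]]; try exact: connected_in_set1.
  case/orP: pb => [/eqP pb|]; last exact: connected_in_set2.
  by rewrite /B /= pb setUid; apply: connected_in_set1.
- move=> i j x; move: i j.
  have dis (X Y : {set T}) : (forall y, y \in X -> y \notin Y) -> x \in X -> x \notin Y by apply.
  have ab : a != b by rewrite eq_sym.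
  apply: K5_pairs; rewrite /B /=; apply: dis => y; rewrite !inE ?negb_or;
    do ?[case/orP]; move/eqP => ->;
    rewrite ?(ne _ _ eva) ?(ne _ _ evp) ?(ne _ _ evb) ?(ne _ _ evq) ?(ne _ _ evc)
      ?(ne _ _ eap) ?(ne _ _ eaq) ?(ne _ _ eac) ?(ne _ _ eqc) ?ab ?bq ?bc ?pq ?pc //.
- apply: K5_pairs; rewrite /B /=.
  + by exists v, a; rewrite !inE !eqxx.
  + by exists v, p; rewrite !inE !eqxx.
  + by exists v, q; rewrite !inE !eqxx.
  + by exists v, c; rewrite !inE !eqxx.
  + by exists a, p; rewrite !inE !eqxx.
  + by exists a, q; rewrite !inE !eqxx.
  + by exists a, c; rewrite !inE !eqxx.
  + by case/orP: epbq => h; [exists p, q | exists b, q]; rewrite !inE !eqxx ?orbT.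
  + by case/orP: epbc => h; [exists p, c | exists b, c]; rewrite !inE !eqxx ?orbT.
  + by exists q, c; rewrite !inE !eqxx.
Qed.

(** Each vertex of N misses at most one other. If N is a clique, four of its vertices and v form a
    K5. Otherwise let p and q be nonadjacent; there are three more vertices, all adjacent to p and
    q, and one of them, a, is adjacent to the other two, b and c. Contracting pb gives a K5 on v, a,
    pb, q, c. *)
Lemma K5_minor_of_dense_link {T : finType} (e : rel T) (A N : {set T}) v :
  symmetric e -> irreflexive e -> K5_minor_free e A -> v \in A -> N \subset A ->
  (forall x, x \in N -> e v x) -> (3 < #|N| < 6)%N ->
  (forall x, x \in N -> (2 < #|nbrs e N x|)%N) -> False.
Proof.
move=> sym irr free vA NA evN /andP[N4 N5] deg.
have inA x : x \in N -> x \in A by move/(subsetP NA).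
have two x y z : x \in N -> y \in N -> z \in N -> x != y -> x != z -> y != z -> e x y || e x z.
  move=> xN yN zN xy xz yz; apply/negPn/negP; rewrite negb_or => /andP[nxy nxz].
  have sub : nbrs e N x \subset N :\ x :\ y :\ z.
    apply/subsetP => t; rewrite !inE => /andP[-> ext]; rewrite andbT; apply/and3P; split.
    - by apply: contraTneq ext => ->.
    - by apply: contraTneq ext => ->.
    - by apply: contraTneq ext => ->; rewrite irr.
  have := leq_trans (deg x xN) (subset_leq_card sub).
  have := cardsD1 z (N :\ x :\ y); have := cardsD1 y (N :\ x); have := cardsD1 x N.
  by rewrite !inE xN yN zN (eq_sym y) (eq_sym z x) (eq_sym z) xy xz yz /=; clear - N5; lia.
have [/forall_inP clique|] := boolP [forall p in N, forall q in N, (p != q) ==> e p q].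
  have adj p q : p \in N -> q \in N -> p != q -> e p q.
    by move=> pN qN pq; have /forall_inP/(_ q qN)/implyP := clique p pN; apply.
  have [d dN] : exists d, d \in N by apply/card_gt0P; lia.
  have /card_gt2P[a [b [c [[]]]]] : (2 < #|N :\ d|)%N by have := cardsD1 d N; rewrite dN; lia.
  rewrite !inE => /andP[ad aN] /andP[bd bN] /andP[cd cN] [ab bc ca].
  apply: (K5_minor_free_pair e A v a b b c d) => //; rewrite ?eqxx ?orbT //;
    try (by apply: inA); try (by apply: evN); rewrite ?adj // 1?eq_sym //.
rewrite negb_forall_in => /exists_inP[p pN]; rewrite negb_forall_in => /exists_inP[q qN].
rewrite negb_imply => /andP[pq npq].
have N3 : (2 < #|N :\ p :\ q|)%N.
  have sub : nbrs e N p \subset N :\ p :\ q.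
    apply/subsetP => t; rewrite !inE => /andP[-> ept]; rewrite andbT; apply/andP; split.
      by apply: contraTneq ept => ->.
    by apply: contraTneq ept => ->; rewrite irr.
  exact: leq_trans (deg p pN) (subset_leq_card sub).
have pqadj z : z \in N -> z != p -> z != q -> e p z && e q z.
  move=> zN zp zq; have := two p q z pN qN zN pq; rewrite (negbTE npq) /= => -> //.
  - have := two q p z qN pN zN; rewrite (sym q p) (negbTE npq) /= => -> //.
    + by rewrite eq_sym.
    + by rewrite eq_sym.
    + by rewrite eq_sym.
  - by rewrite eq_sym.
  - by rewrite eq_sym.
have centre a b c : a \in N -> b \in N -> c \in N -> a != p -> a != q -> b != p -> b != q ->
    c != p -> c != q -> a != b -> b != c -> c != a -> e a b -> e a c -> False.
  move=> aN bN cN ap aq bp bq cp cq ab bc ca eab eac.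
  have /andP[epa eqa] := pqadj a aN ap aq; have /andP[epb eqb] := pqadj b bN bp bq.
  have /andP[epc eqc] := pqadj c cN cp cq.
  apply: (K5_minor_free_pair e A v a p b q c) => //; try (by apply: inA); try (by apply: evN).
  - by rewrite epb orbT.
  - by rewrite eq_sym.
  - by rewrite sym.
  - by rewrite sym.
  - by rewrite (sym b) eqb orbT.
  - by rewrite epc.
  - by rewrite eq_sym.
case/card_gt2P: N3 => a [b [c [[]]]]; rewrite !inE => /and3P[aq ap aN] /and3P[bq bp bN] /and3P[cq cp cN].
move=> [ab bc ca].
have [eab|neab] := boolP (e a b); have [eac|neac] := boolP (e a c).
- exact: (centre a b c).
- have ebc : e b c.
    by have := two c a b cN aN bN ca; rewrite (sym c a) (negbTE neac) (sym c) /=; apply; rewrite // eq_sym.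
  by apply: (centre b a c) => //; rewrite 1?eq_sym // sym.
- have ebc : e b c by have := two b a c bN aN cN; rewrite (sym b a) (negbTE neab) /=; apply; rewrite // eq_sym.
  by apply: (centre c a b) => //; rewrite 1?eq_sym // sym.
- have := two a b c aN bN cN ab; rewrite (negbTE neab) (negbTE neac) /= => H.
  by have := H _ bc; rewrite eq_sym ca => /(_ isT).
Qed.

Lemma deg_sum_set0_vertex {T : finType} (e : rel T) (A : {set T}) v :
  symmetric e -> v \in A -> nbrs e A v = set0 -> (deg_sum e A <= deg_sum e (A :\ v))%N.
Proof.
move=> sym vA v0; rewrite /deg_sum (big_setD1 v vA) /= v0 cards0 add0n.
apply: leq_sum => a; rewrite !inE => /andP[av aA].
apply: subset_leq_card; apply/subsetP => b; rewrite !inE => /andP[bA eab]; rewrite bA eab !andbT.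
apply: contraTneq eab => ->; rewrite sym; apply/negP => eva.
by have : a \in nbrs e A v; [rewrite inE aA | rewrite v0 inE].
Qed.

Lemma K5_minor_freeS {T : finType} (e : rel T) (A A' : {set T}) :
  A' \subset A -> K5_minor_free e A -> K5_minor_free e A'.
Proof. by move=> A'A free B BA'; apply: free => i i5; apply: subset_trans (BA' i i5) A'A. Qed.

Lemma K5_minor_free_subrel {T : finType} (e e' : rel T) (A : {set T}) :
  subrel e' e -> K5_minor_free e A -> K5_minor_free e' A.
Proof.
move=> sub free B BA [conn disj adj]; apply: (free B BA); split=> //.
  move=> i i5; have [ne c] := conn i i5; split=> // x y xB yB.
  apply: connect_sub (c x y xB yB) => {x xB} {y yB} a b /= /and3P[/sub eab aB bB].
  by apply: connect1; rewrite /= eab aB bB.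
by move=> i j ij5; have [x [y [xB yB /sub exy]]] := adj i j ij5; exists x, y.
Qed.

(* Mader: in a minimal counterexample every edge lies in three triangles, and
   the neighbourhood of a vertex of degree at most five yields a K5 minor. *)
Lemma K5_minor_free_deg_sum {T : finType} (e : rel T) (A : {set T}) :
  symmetric e -> irreflexive e -> K5_minor_free e A -> (2 < #|A|)%N ->
  (deg_sum e A + 12 <= 6 * #|A|)%N.
Proof.
have [k] := ubnP #|A|; elim: k => // k IHk in e A *.
have [m] := ubnP (deg_sum e A); elim: m => // m IHm in e * => Hm Hk sym irr free A3.
rewrite leqNgt; apply/negP => dense.
have [A_eq3|A_ne3] := eqVneq #|A| 3.
  have : (deg_sum e A <= \sum_(a in A) 2)%N.
    apply: leq_sum => a aA.
    have sub : nbrs e A a \subset A :\ a.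
      apply/subsetP => b; rewrite !inE => /andP[-> eab]; rewrite andbT.
      by apply: contraTneq eab => ->; rewrite irr.
    by have := subset_leq_card sub; have := cardsD1 a A; rewrite aA A_eq3; lia.
  by rewrite sum_nat_const A_eq3; lia.
have A4 : (3 < #|A|)%N by rewrite ltn_neqAle eq_sym A_ne3.
(* Otherwise deleting any edge, which loses at most 2, still violates the bound, against the
   induction on [deg_sum]. Hence some vertex has degree at most five. *)
have sparse : (deg_sum e A < 6 * #|A|)%N.
  rewrite ltnNge; apply/negP => dense6.
  have [a aA] : exists2 a, a \in A & (0 < #|nbrs e A a|)%N.
    apply/exists_inP; rewrite -[X in is_true X]negbK negb_exists_in; apply/negP => /forall_inP H.
    have : deg_sum e A = 0 by apply: big1 => a /H; rewrite -leqNgt leqn0 => /eqP.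
    by lia.
  case/card_gt0P => b; rewrite inE => /andP[bA eab].
  have := deg_sum_delete_edge e A a b; set e' := fun a b => _ => del.
  have e'e : subrel e' e by move=> x y /andP[/andP[]].
  have lt : (deg_sum e' A < deg_sum e A)%N.
    rewrite /deg_sum (big_setD1 a aA) [in ltnRHS](big_setD1 a aA) /= -addSn; apply: leq_add.
      apply: proper_card; apply/properP; split.
        by apply/subsetP => x; rewrite !inE => /andP[-> /e'e].
      by exists b; rewrite !inE bA //= /e' eqxx !andbF.
    apply: leq_sum => x _; apply: subset_leq_card.
    by apply/subsetP => y; rewrite !inE => /andP[-> /e'e].
  have sym' : symmetric e'.
    by move=> x y; rewrite /e' sym !xpair_eqE -!andbA; congr (_ && _); rewrite andbC (andbC (x == b)) (andbC (x == a)).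
  have irr' : irreflexive e' by move=> x; rewrite /e' irr.
  have := IHm e' (leq_trans lt Hm) Hk sym' irr' (K5_minor_free_subrel _ _ _ e'e free) A3.
  by lia.
have [v vA v5] : exists2 v, v \in A & (#|nbrs e A v| < 6)%N.
  apply/exists_inP; rewrite -[X in is_true X]negbK negb_exists_in; apply/negP => /forall_inP H.
  have : (\sum_(a in A) 6 <= deg_sum e A)%N by apply: leq_sum => a /H; rewrite -leqNgt.
  by rewrite sum_nat_const; lia.
(* With at most two common neighbours the contraction loses at most 6, exactly what the bound loses
   with one vertex. *)
have triangles x y : x \in A -> y \in A -> e x y -> (2 < #|nbrs e A x :&: nbrs e A y|)%N.
  move=> xA yA exy; have xy : x != y by apply: contraTneq exy => ->; rewrite irr.
  have := deg_sum_contract e A x y sym irr xA yA xy exy.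
  have Ay := cardsD1 y A; rewrite yA in Ay.
  set c := #|_ :&: _| => le; rewrite ltnNge; apply/negP => c2.
  have symc := contract_sym e x y sym.
  have irrc : irreflexive (contract e x y) by move=> a; rewrite /contract eqxx.
  have freec := K5_minor_contract e A x y sym xA yA xy exy free.
  by have := IHk _ (A :\ y) ltac:(lia) symc irrc freec; lia.
have [v0|] := eqVneq (nbrs e A v) set0.
  have := deg_sum_set0_vertex e A v sym vA v0.
  have Av := cardsD1 v A; rewrite vA in Av.
  by have := IHk e (A :\ v) ltac:(lia) sym irr (K5_minor_freeS _ _ _ (subsetDl _ _) free); lia.
case/set0Pn => x xN.
have vN y : y \in nbrs e A v -> (2 < #|nbrs e (nbrs e A v) y|)%N.
  rewrite inE => /andP[yA evy].
  apply: leq_trans (triangles v y vA yA evy) _; apply: subset_leq_card.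
  by apply/subsetP => z; rewrite !inE => /andP[/andP[-> ->] /andP[_ ->]].
apply: (K5_minor_of_dense_link e A (nbrs e A v) v) => //.
- by apply/subsetP => y; rewrite inE => /andP[].
- by move=> y; rewrite inE => /andP[].
- rewrite v5 andbT.
  have := vN x xN.
  have sub : nbrs e (nbrs e A v) x \subset nbrs e A v :\ x.
    apply/subsetP => y; rewrite !inE => /andP[/andP[-> ->] exy]; rewrite !andbT.
    by apply: contraTneq exy => ->; rewrite irr.
  by have := subset_leq_card sub; have := cardsD1 x (nbrs e A v); rewrite xN; lia.
Qed.

(** * Planar graphs *)

Lemma addb_xorb (a b : bool) : a (+) b = xorb a b.
Proof. by case: a b => [] []. Qed.

Ltac bool_ring := rewrite ?addb_xorb; Btauto.btauto.

(* [elbow_cross X Y p q r s] is the parity of the number of crossings of the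
   two L-shaped paths p -> (q.x, p.y) -> q and r -> (s.x, r.y) -> s, where
   [X a b] and [Y a b] compare the coordinates of a with those of b.  The
   identities below hold for arbitrary relations X and Y. *)
Definition elbow_cross {T S : Type} (X Y : T -> S -> bool) (p q : T) (r s : S) : bool :=
  ((X q r (+) X q s) && (Y p r (+) Y q r))
    (+) ((X p s (+) X q s) && (Y p r (+) Y p s)).

(* The parity of the crossings of the L-shaped path from p to q with the
   vertical ray issued from v. *)
Definition elbow_ray {T S : Type} (X Y : T -> S -> bool) (p q : T) (v : S) : bool :=
  (X p v (+) X q v) && Y p v.

Fixpoint chain_cross {T S : Type} (X Y : T -> S -> bool) (p : T) (l : seq T) (r s : S) : bool :=
  if l is q :: l' then elbow_cross X Y p q r s (+) chain_cross X Y q l' r s else false.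

Fixpoint chain_ray {T S : Type} (X Y : T -> S -> bool) (p : T) (l : seq T) (v : S) : bool :=
  if l is q :: l' then elbow_ray X Y p q v (+) chain_ray X Y q l' v else false.

Fixpoint chains_cross {T S : Type} (X Y : T -> S -> bool) (p : T) (l : seq T)
    (r : S) (m : seq S) : bool :=
  if m is s :: m' then chain_cross X Y p l r s (+) chains_cross X Y p l s m' else false.

(* The parity of the winding number around v of the closed curve formed by the
   chain and the L-shaped path between its end points. *)
Definition chain_wind {T S : Type} (X Y : T -> S -> bool) (p : T) (l : seq T) (v : S) : bool :=
  chain_ray X Y p l v (+) elbow_ray X Y p (last p l) v.

(** For the order [<=] this is the strict order. The two agree when there is no tie, which is why
    vertices are later put in generic position. *)
Definition flip_rel {T S : Type} (X : T -> S -> bool) (a : S) (b : T) : bool := ~~ X b a.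

Lemma elbow_cross_flip {T S : Type} (X Y : T -> S -> bool) (p q : T) (r s : S) :
  elbow_cross X Y p q r s = elbow_cross (flip_rel X) (flip_rel Y) r s p q.
Proof.
rewrite /elbow_cross /flip_rel.
by case: (X q r) (X q s) (Y p r) (Y q r) (X p s) (Y p s) => [] [] [] [] [] [].
Qed.

(** The crossing parity of one elbow with r -> s is the difference of its ray parities at r and s,
    up to a difference of values of [phi], which telescopes along the chain. The single elbow
    joining the two ends of the chain eliminates [phi]. *)
Lemma chain_crossE {T S : Type} (X Y : T -> S -> bool) (p : T) (l : seq T) (r s : S) :
  chain_cross X Y p l r s =
    elbow_cross X Y p (last p l) r s (+) (chain_wind X Y p l r (+) chain_wind X Y p l s).
Proof.
pose phi a := (X a r (+) X a s) && Y a r.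
have elbow a b : elbow_cross X Y a b r s =
    (elbow_ray X Y a b r (+) elbow_ray X Y a b s) (+) (phi a (+) phi b).
  rewrite /elbow_cross /elbow_ray /phi.
  by case: (X a r) (X a s) (X b r) (X b s) (Y a r) (Y a s) (Y b r) => [] [] [] [] [] [] [].
have -> : chain_cross X Y p l r s =
    (chain_ray X Y p l r (+) chain_ray X Y p l s) (+) (phi p (+) phi (last p l)).
  elim: l p => [|q l IH] p /=; first by rewrite addbb.
  by rewrite IH elbow; bool_ring.
by rewrite elbow /chain_wind; bool_ring.
Qed.

(** The discrete substitute for the Jordan curve theorem: replacing both chains by single elbows
    with the same ends changes the crossing parity only by windings around the four end points. *)
Lemma chains_crossE {T S : Type} (X Y : T -> S -> bool) (p : T) (l : seq T) (r : S) (m : seq S) :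
  chains_cross X Y p l r m =
    elbow_cross X Y p (last p l) r (last r m)
    (+) ((chain_wind X Y p l r (+) chain_wind X Y p l (last r m))
    (+) (chain_wind (flip_rel X) (flip_rel Y) r m p
         (+) chain_wind (flip_rel X) (flip_rel Y) r m (last p l))).
Proof.
have -> : chains_cross X Y p l r m =
    chain_cross (flip_rel X) (flip_rel Y) r m p (last p l)
    (+) (chain_wind X Y p l r (+) chain_wind X Y p l (last r m)).
  elim: m r => [|s m IH] r /=; first by rewrite addbb.
  by rewrite IH chain_crossE -elbow_cross_flip; bool_ring.
by rewrite chain_crossE -elbow_cross_flip; bool_ring.
Qed.

Lemma chain_wind_eq {T S : eqType} (X Y X' Y' : T -> S -> bool) p l v :
  {in p :: l, forall a, X a v = X' a v /\ Y a v = Y' a v} ->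
  chain_wind X Y p l v = chain_wind X' Y' p l v.
Proof.
move=> XY; rewrite /chain_wind; congr (_ (+) _); last first.
  have [Xp Yp] := XY p (mem_head _ _); have [Xl _] := XY _ (mem_last p l).
  by rewrite /elbow_ray Xp Yp Xl.
elim: l p XY => [|q l IH] p //= XY.
rewrite (IH q) => [|a al]; last by apply: XY; rewrite inE al orbT.
have [|Xq Yq] := XY q _; first by rewrite !inE eqxx orbT.
have [Xp Yp] := XY p (mem_head _ _).
by rewrite /elbow_ray Xp Yp Xq.
Qed.

(** Two steps whose bounding boxes are separated in one coordinate have all four comparisons in that
    coordinate equal, and then both halves of [elbow_cross] vanish. *)
Lemma chains_cross_far {T S : eqType} (X Y : T -> S -> bool) (p : T) (l : seq T) (r : S) (m : seq S) :
  (forall a b c d, (a, b) \in zip (p :: l) l -> (c, d) \in zip (r :: m) m ->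
     (exists t, [/\ X a c = t, X a d = t, X b c = t & X b d = t]) \/
     (exists t, [/\ Y a c = t, Y a d = t, Y b c = t & Y b d = t])) ->
  chains_cross X Y p l r m = false.
Proof.
move=> far.
elim: m r far => [|s m IHm] r //= far.
rewrite IHm => [|a b c d ab cd]; last by apply: far => //; rewrite inE cd orbT.
rewrite addbF.
have {IHm} : forall a b, (a, b) \in zip (p :: l) l ->
     (exists t, [/\ X a r = t, X a s = t, X b r = t & X b s = t]) \/
     (exists t, [/\ Y a r = t, Y a s = t, Y b r = t & Y b s = t]).
  by move=> a b ab; apply: far; rewrite ?inE ?eqxx.
elim: l p {far} => [|q l IHl] p //= far.
rewrite IHl => [|a b ab]; last by apply: far; rewrite inE ab orbT.
rewrite addbF /elbow_cross.
by case: (far p q (mem_head _ _)) => /= -[t [e1 e2 e3 e4]]; rewrite ?e1 ?e2 ?e3 ?e4 addbb ?andbF //= addbb.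
Qed.

(** The fifteen equations, one per pair of disjoint edges, are added modulo 2. A term w i j k occurs
    in exactly two of them, one for each remaining vertex l in the edge kl, and cancels. The elbow
    crossings add up to 1 identically, whatever the antisymmetric relations X and Y are. *)
Lemma K5_odd_crossing (X Y : nat -> nat -> bool) (w : nat -> nat -> nat -> bool) :
  (forall i j, (i < j < 5)%N -> X j i = ~~ X i j) ->
  (forall i j, (i < j < 5)%N -> Y j i = ~~ Y i j) ->
  ~ (forall i j k l, (i < j < 5)%N -> (k < l < 5)%N -> (i < k)%N -> j != k -> j != l ->
     elbow_cross X Y i j k l = (w i j k (+) w i j l) (+) (w k l i (+) w k l j)).
Proof.
move=> aX aY H.
have := H 0 1 2 3 isT isT isT isT isT. have := H 0 1 2 4 isT isT isT isT isT.
have := H 0 1 3 4 isT isT isT isT isT.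
have := H 0 2 1 3 isT isT isT isT isT. have := H 0 2 1 4 isT isT isT isT isT.
have := H 0 2 3 4 isT isT isT isT isT.
have := H 0 3 1 2 isT isT isT isT isT. have := H 0 3 1 4 isT isT isT isT isT.
have := H 0 3 2 4 isT isT isT isT isT.
have := H 0 4 1 2 isT isT isT isT isT. have := H 0 4 1 3 isT isT isT isT isT.
have := H 0 4 2 3 isT isT isT isT isT.
have := H 1 2 3 4 isT isT isT isT isT. have := H 1 3 2 4 isT isT isT isT isT.
have := H 1 4 2 3 isT isT isT isT isT.
rewrite /elbow_cross => {H}.
rewrite ?(aX 0 1 isT) ?(aX 0 2 isT) ?(aX 0 3 isT) ?(aX 0 4 isT) ?(aX 1 2 isT) ?(aX 1 3 isT)
 ?(aX 1 4 isT) ?(aX 2 3 isT) ?(aX 2 4 isT) ?(aX 3 4 isT).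
rewrite ?(aY 0 1 isT) ?(aY 0 2 isT) ?(aY 0 3 isT) ?(aY 0 4 isT) ?(aY 1 2 isT) ?(aY 1 3 isT)
 ?(aY 1 4 isT) ?(aY 2 3 isT) ?(aY 2 4 isT) ?(aY 3 4 isT).
move=> e1 e2 e3 e4 e5 e6 e7 e8 e9 e10 e11 e12 e13 e14 e15.
have e : forall a b c d : bool, a = b -> c = d -> a (+) c = b (+) d by move=> ? ? ? ? -> ->.
have := e _ _ _ _ e1 (e _ _ _ _ e2 (e _ _ _ _ e3 (e _ _ _ _ e4 (e _ _ _ _ e5
 (e _ _ _ _ e6 (e _ _ _ _ e7 (e _ _ _ _ e8 (e _ _ _ _ e9 (e _ _ _ _ e10
 (e _ _ _ _ e11 (e _ _ _ _ e12 (e _ _ _ _ e13 (e _ _ _ _ e14 e15))))))))))))).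
move=> {aX aY e e1 e2 e3 e4 e5 e6 e7 e8 e9 e10 e11 e12 e13 e14 e15} H.
suff: true = false by [].
match type of H with ?a = ?b => have Ha : a = true; [clear H| have Hb : b = false; [clear H Ha|by rewrite -Ha -Hb]] end.
- by bool_ring.
- by bool_ring.
Qed.

(** As for K5, with eighteen pairs: a vertex off an edge lies on exactly two edges disjoint from it,
    so the winding terms cancel again. *)
Lemma K33_odd_crossing (X Y : nat -> nat -> bool) (w : nat -> nat -> nat -> bool) :
  (forall i j, (i < j < 6)%N -> X j i = ~~ X i j) ->
  (forall i j, (i < j < 6)%N -> Y j i = ~~ Y i j) ->
  ~ (forall i j k l, (i < 3 <= j)%N -> (j < 6)%N -> (k < 3 <= l)%N -> (l < 6)%N -> (i < k)%N -> j != l ->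
     elbow_cross X Y i j k l = (w i j k (+) w i j l) (+) (w k l i (+) w k l j)).
Proof.
move=> aX aY H.
have := H 0 3 1 4 isT isT isT isT isT isT. have := H 0 3 1 5 isT isT isT isT isT isT.
have := H 0 4 1 3 isT isT isT isT isT isT. have := H 0 4 1 5 isT isT isT isT isT isT.
have := H 0 5 1 3 isT isT isT isT isT isT. have := H 0 5 1 4 isT isT isT isT isT isT.
have := H 0 3 2 4 isT isT isT isT isT isT. have := H 0 3 2 5 isT isT isT isT isT isT.
have := H 0 4 2 3 isT isT isT isT isT isT. have := H 0 4 2 5 isT isT isT isT isT isT.
have := H 0 5 2 3 isT isT isT isT isT isT. have := H 0 5 2 4 isT isT isT isT isT isT.
have := H 1 3 2 4 isT isT isT isT isT isT. have := H 1 3 2 5 isT isT isT isT isT isT.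
have := H 1 4 2 3 isT isT isT isT isT isT. have := H 1 4 2 5 isT isT isT isT isT isT.
have := H 1 5 2 3 isT isT isT isT isT isT. have := H 1 5 2 4 isT isT isT isT isT isT.
rewrite /elbow_cross => {H}.
rewrite ?(aX 0 1 isT) ?(aX 0 2 isT) ?(aX 0 3 isT) ?(aX 0 4 isT) ?(aX 0 5 isT) ?(aX 1 2 isT) ?(aX 1 3 isT)
 ?(aX 1 4 isT) ?(aX 1 5 isT) ?(aX 2 3 isT) ?(aX 2 4 isT) ?(aX 2 5 isT) ?(aX 3 4 isT) ?(aX 3 5 isT) ?(aX 4 5 isT).
rewrite ?(aY 0 1 isT) ?(aY 0 2 isT) ?(aY 0 3 isT) ?(aY 0 4 isT) ?(aY 0 5 isT) ?(aY 1 2 isT) ?(aY 1 3 isT)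
 ?(aY 1 4 isT) ?(aY 1 5 isT) ?(aY 2 3 isT) ?(aY 2 4 isT) ?(aY 2 5 isT) ?(aY 3 4 isT) ?(aY 3 5 isT) ?(aY 4 5 isT).
move=> e1 e2 e3 e4 e5 e6 e7 e8 e9 e10 e11 e12 e13 e14 e15 e16 e17 e18.
have e : forall a b c d : bool, a = b -> c = d -> a (+) c = b (+) d by move=> ? ? ? ? -> ->.
have := e _ _ _ _ e1 (e _ _ _ _ e2 (e _ _ _ _ e3 (e _ _ _ _ e4 (e _ _ _ _ e5
 (e _ _ _ _ e6 (e _ _ _ _ e7 (e _ _ _ _ e8 (e _ _ _ _ e9 (e _ _ _ _ e10
 (e _ _ _ _ e11 (e _ _ _ _ e12 (e _ _ _ _ e13 (e _ _ _ _ e14 (e _ _ _ _ e15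
 (e _ _ _ _ e16 (e _ _ _ _ e17 e18)))))))))))))))).
move=> {aX aY e e1 e2 e3 e4 e5 e6 e7 e8 e9 e10 e11 e12 e13 e14 e15 e16 e17 e18} H.
suff: true = false by [].
match type of H with ?a = ?b => have Ha : a = true; [clear H| have Hb : b = false; [clear H Ha|by rewrite -Ha -Hb]] end.
- by bool_ring.
- by bool_ring.
Qed.

(** * Compactness and uniform separation of arcs *)

Local Open Scope ring_scope.

(** Compactness of the interval as a near-covering property, the radius r tending to 0 from the
    right being the parameter. Uniform continuity and the separation of disjoint arcs both follow
    from it. *)
Lemma unit_interval_covering (Q : RR -> RR -> Prop) :
  (forall x, 0 <= x <= 1 -> exists2 d : RR, 0 < d &
     forall y r, `|x - y| < d -> 0 < r < d -> 0 <= y <= 1 -> Q r y) ->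
  exists2 r : RR, 0 < r & forall y, 0 <= y <= 1 -> Q r y.
Proof.
move=> loc.
have /compact_near_coveringP cov : compact `[(0:RR), 1]%classic by exact: segment_compact.
have {}cov := cov _ (at_right (0:RR)) (fun r y => 0 <= y <= 1 -> Q r y) _.
have {}cov := cov (ltac:(exact: _)).
have [|e /= e0 He] := cov.
  move=> x; rewrite /= in_itv /= => x01.
  have [d d0 H] := loc x x01.
  near=> y r => /= y01; apply: H => //.
    by near: y; apply: nbhsx_ballx.
  have r0 : 0 < r by near: r; apply: nbhs_right_gt.
  have rd : r < d by near: r; apply: nbhs_right_lt.
  by rewrite r0 rd.
exists (e / 2) => [|y y01]; first by rewrite divr_gt0.
apply: (He (e / 2)) => //=; last by rewrite divr_gt0.
by rewrite sub0r normrN gtr0_norm ?divr_gt0 // gtr_pMr // invf_lt1 // ltr1n.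
Unshelve. all: by end_near. Qed.

Definition continuous01 (f : RR -> RR) : Prop :=
  forall x, 0 <= x <= 1 -> forall eps, 0 < eps -> exists2 d, 0 < d &
    forall y, 0 <= y <= 1 -> `|x - y| < d -> `|f x - f y| < eps.

Lemma within_continuous01 (f : RR -> RR * RR) :
  ({within `[0, 1], continuous f})%classic ->
  continuous01 (fun s => (f s).1) /\ continuous01 (fun s => (f s).2).
Proof.
move=> /subspace_continuousP cf.
suff H x : 0 <= x <= 1 -> forall eps : RR, 0 < eps -> exists2 d : RR, 0 < d &
    forall y, 0 <= y <= 1 -> `|x - y| < d -> ball (f x) eps (f y).
  by split=> x x01 eps eps0; have [d d0 Hd] := H x x01 eps eps0; exists d => // y y01 xy;
    have [] := Hd y y01 xy.
move=> x01 eps eps0.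
have /cf/(_ (ball (f x) eps) (nbhsx_ballx _ _ eps0)) : `[0, 1]%classic x by rewrite /= in_itv.
rewrite /= /within /= => -[d /= d0 Hd].
by exists d => // y y01 xy; apply: Hd => //=; rewrite in_itv.
Qed.

Lemma continuous01_uniform (f : RR -> RR) : continuous01 f ->
  forall eps, 0 < eps -> exists2 d, 0 < d &
    forall x y, 0 <= x <= 1 -> 0 <= y <= 1 -> `|x - y| < d -> `|f x - f y| < eps.
Proof.
move=> cf eps eps0.
have [|r r0 Hr] := unit_interval_covering
  (fun r x => forall y, 0 <= y <= 1 -> `|x - y| < r -> `|f x - f y| < eps).
  move=> x x01; have e2 : 0 < eps / 2 by rewrite divr_gt0.
  have [d d0 Hd] := cf x x01 _ e2.
  exists (d / 2) => [|y r xy r0 y01 z z01 yz]; first by rewrite divr_gt0.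
  have xy' := Hd y y01; have xz' := Hd z z01.
  have {}xy' := xy' ltac:(lra).
  have xz : `|x - z| < d.
    apply: (le_lt_trans (ler_distD y _ _)); lra.
  have {}xz' := xz' xz.
  apply: (le_lt_trans (ler_distD (f x) _ _)).
  by rewrite (distrC (f y)); lra.
by exists r => // x y x01 y01; apply: Hr.
Qed.

(** Two applications of the covering principle, in t for fixed s0 and then in s. At each pair of
    parameters the curves differ in some coordinate by c > 0, and moving each by less than c / 4
    leaves a gap of c / 2. *)
Lemma continuous01_separated (f1 f2 g1 g2 : RR -> RR) :
  continuous01 f1 -> continuous01 f2 -> continuous01 g1 -> continuous01 g2 ->
  (forall s t, 0 <= s <= 1 -> 0 <= t <= 1 -> (f1 s, f2 s) <> (g1 t, g2 t)) ->
  exists2 d, 0 < d & forall s t, 0 <= s <= 1 -> 0 <= t <= 1 ->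
    d <= `|f1 s - g1 t| \/ d <= `|f2 s - g2 t|.
Proof.
move=> cf1 cf2 cg1 cg2 fg.
have close (f g : RR -> RR) s0 t0 : continuous01 f -> continuous01 g ->
    0 <= s0 <= 1 -> 0 <= t0 <= 1 -> f s0 <> g t0 ->
    exists2 d, 0 < d & forall t r, `|t0 - t| < d -> 0 < r < d -> 0 <= t <= 1 ->
      forall s, `|s0 - s| < r -> 0 <= s <= 1 -> r <= `|f s - g t|.
  move=> cf cg s01 t01 ne.
  have c0 : 0 < `|f s0 - g t0| by rewrite normr_gt0 subr_eq0; apply/eqP.
  set c := `|f s0 - g t0| in c0.
  have c4 : 0 < c / 4 by rewrite divr_gt0.
  have [d1 d10 H1] := cf s0 s01 _ c4; have [d2 d20 H2] := cg t0 t01 _ c4.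
  exists (Num.min (c / 4) (Num.min d1 d2)) => [|t r].
    by rewrite !lt_min c4 d10 d20.
  rewrite !lt_min => /and3P[t1 t2 t3] /andP[r0 /and3P[r1 r2 r3]] t01' s ss s01'.
  have a := H1 s s01' (lt_trans ss r2); have b := H2 t t01' t3.
  have : c <= `|f s0 - f s| + (`|f s - g t| + `|g t - g t0|).
    apply: (le_trans (ler_distD (f s) _ _)); rewrite lerD2l; exact: ler_distD.
  by rewrite (distrC (g t)); lra.
have [|r r0 Hr] := unit_interval_covering
  (fun r s => forall t, 0 <= t <= 1 -> r <= `|f1 s - g1 t| \/ r <= `|f2 s - g2 t|).
  move=> s0 s01.
  have [|r r0 Hr] := unit_interval_covering (fun r t => forall s, `|s0 - s| < r -> 0 <= s <= 1 ->
       r <= `|f1 s - g1 t| \/ r <= `|f2 s - g2 t|).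
    move=> t0 t01.
    have [e1|/eqP ne1] := eqVneq (f1 s0) (g1 t0).
      have ne2 : f2 s0 <> g2 t0 by move=> e2; apply: (fg s0 t0 s01 t01); rewrite e1 e2.
      have [d d0 Hd] := close f2 g2 s0 t0 cf2 cg2 s01 t01 ne2.
      by exists d => // t r tt rd t01' s ss s01'; right; apply: (Hd t r).
    have [d d0 Hd] := close f1 g1 s0 t0 cf1 cg1 s01 t01 ne1.
    by exists d => // t r tt rd t01' s ss s01'; left; apply: (Hd t r).
  exists r => // s r' ss r'r s01' t t01.
  have r'r2 : r' <= r by case/andP: r'r => _ /ltW.
  by case: (Hr t t01 s ss s01') => h; [left|right]; apply: (le_trans r'r2).
by exists r => // s t s01 t01; apply: Hr.
Qed.

Lemma finite_uniform (T : finType) (P : T -> RR -> Prop) :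
  (forall t r r', P t r -> 0 < r' <= r -> P t r') ->
  (forall t, exists2 d, 0 < d & P t d) -> exists2 d : RR, 0 < d & forall t, P t d.
Proof.
move=> mono ex.
suff [d d0 Hd] : exists2 d : RR, 0 < d & forall t, t \in enum T -> P t d.
  by exists d => // t; apply: Hd; rewrite mem_enum.
elim: (enum T) => [|t s [d d0 Hd]]; first by exists 1.
have [d' d'0 Hd'] := ex t.
exists (Num.min d d') => [|u]; first by rewrite lt_min d0.
rewrite inE => /orP[/eqP ->|us].
  by apply: mono Hd' _; rewrite lt_min d0 d'0 ge_min lexx orbT.
by apply: mono (Hd u us) _; rewrite lt_min d0 d'0 ge_min lexx.
Qed.

Lemma small_notin (s : seq RR) : exists2 d : RR, 0 < d & forall x, 0 < x < d -> x \notin s.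
Proof.
elim: s => [|y s [d d0 Hd]]; first by exists 1.
have [y0|y0] := ltP 0 y.
  exists (Num.min d y) => [|x]; first by rewrite lt_min d0.
  rewrite lt_min inE => /and3P[x0 xd xy]; rewrite negb_or (Hd x) ?x0 // andbT.
  by rewrite lt_eqF.
exists d => // x /andP[x0 xd]; rewrite inE negb_or Hd ?x0 // andbT gt_eqF //.
exact: le_lt_trans x0.
Qed.

(** * From a planar drawing to polygonal chains *)

Definition disjoint_pairs {n : nat} (a b c d : 'I_n) : bool :=
  [&& a != c, a != d, b != c & b != d].

(** [planar] supplies one arc per pair x < y; the reversed parametrisation serves the other
    direction. Disjointness now includes the end points, as compactness needs closed arcs. *)
Lemma planar_arcs (n : nat) (e : rel 'I_n) : simple_graph e -> planar e ->
  exists (p : 'I_n -> RR * RR) (A : 'I_n -> 'I_n -> RR -> RR * RR),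
  (forall a b, e a b -> [/\ A a b 0 = p a, A a b 1 = p b,
     continuous01 (fun s => (A a b s).1) & continuous01 (fun s => (A a b s).2)]) /\
  (forall a b c d s t, e a b -> e c d -> disjoint_pairs a b c d ->
     0 <= s <= 1 -> 0 <= t <= 1 -> A a b s <> A c d t).
Proof.
move=> [sym irr] [p [arc [pinj [arcs [avoid cross]]]]].
have arcE (x y : 'I_n) s : (x < y)%N -> e x y -> 0 <= s <= 1 ->
    [\/ arc x y s = p x, arc x y s = p y | 0 < s < 1].
  move=> xy exy /andP[s0 s1]; have [_ [_ [a0 a1]]] := arcs x y xy exy.
  have [->|sn0] := eqVneq s 0; first by constructor 1.
  have [->|sn1] := eqVneq s 1; first by constructor 2.
  by constructor 3; rewrite !lt_neqAle eq_sym sn0 s0 sn1 s1.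
have disj (x y u v : 'I_n) s t : (x < y)%N -> e x y -> (u < v)%N -> e u v ->
    disjoint_pairs x y u v -> 0 <= s <= 1 -> 0 <= t <= 1 -> arc x y s <> arc u v t.
  move=> xy exy uv euv /and4P[xu xv yu yv] s01 t01.
  have ne : (x, y) <> (u, v) by case => /eqP; rewrite (negbTE xu).
  have inj a b : a != b -> p a <> p b by move=> /eqP ab /pinj.
  case: (arcE x y s xy exy s01) (arcE u v t uv euv t01) => [->|->|s01'] [->|->|t01'];
    try by apply: inj.
  - by move=> /esym; apply: avoid.
  - by move=> /esym; apply: avoid.
  - exact: avoid.
  - exact: avoid.
  - exact: cross.
exists p, (fun (a b : 'I_n) s => if (a < b)%N then arc a b s else arc b a (1 - s)); split.
  move=> a b eab; have [ab|ba] := ltnP a b.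
    by have [/within_continuous01[c1 c2] [_ [a0 a1]]] := arcs a b ab eab.
  have {}ba : (b < a)%N.
    rewrite ltn_neqAle ba andbT; apply/eqP => /val_inj ba'.
    by move: eab; rewrite ba' irr.
  have eba : e b a by rewrite sym.
  have [/within_continuous01[c1 c2] [_ [a0 a1]]] := arcs b a ba eba.
  rewrite subr0 subrr; split=> //.
    move=> x x01 eps eps0; have x01' : 0 <= 1 - x <= 1 by lra.
    have [d d0 Hd] := c1 _ x01' eps eps0; exists d => // y y01 xy; apply: Hd; first by lra.
    by rewrite distrC; have -> : 1 - y - (1 - x) = x - y by ring.
  move=> x x01 eps eps0; have x01' : 0 <= 1 - x <= 1 by lra.
  have [d d0 Hd] := c2 _ x01' eps eps0; exists d => // y y01 xy; apply: Hd; first by lra.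
  by rewrite distrC; have -> : 1 - y - (1 - x) = x - y by ring.
move=> a b c d s t eab ecd D s01 t01.
have s01' : 0 <= 1 - s <= 1 by lra.
have t01' : 0 <= 1 - t <= 1 by lra.
have lt (x y : 'I_n) : e x y -> (y <= x)%N -> (y < x)%N.
  move=> exy yx; rewrite ltn_neqAle yx andbT; apply/eqP => /val_inj yx'.
  by move: exy; rewrite yx' irr.
have [ab|/(lt _ _ eab) ba] := ltnP a b; have [cd|/(lt _ _ ecd) dc] := ltnP c d.
- exact: disj.
- by apply: disj => //; [rewrite sym | case/and4P: D => *; apply/and4P].
- by apply: disj => //; [rewrite sym | case/and4P: D => *; apply/and4P].
- by apply: disj => //; [rewrite sym | rewrite sym | case/and4P: D => *; apply/and4P].
Qed.

Definition near_pt (r : RR) (a b : RR * RR) : bool :=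
  (`|a.1 - b.1| < r) && (`|a.2 - b.2| < r).

Lemma arc_chain (f : RR -> RR * RR) (r : RR) : 0 < r ->
  continuous01 (fun s => (f s).1) -> continuous01 (fun s => (f s).2) ->
  exists s : seq (RR * RR), [/\ path (near_pt r) (f 0) s, last (f 0) s = f 1 &
    forall q, q \in s -> exists2 x, 0 <= x <= 1 & q = f x].
Proof.
move=> r0 c1 c2.
have [d1 d10 H1] := continuous01_uniform _ c1 _ r0.
have [d2 d20 H2] := continuous01_uniform _ c2 _ r0.
have [N HN] : exists N : nat, (Num.min d1 d2)^-1 < N.+1%:R.
  exists (Num.truncn (Num.min d1 d2)^-1); exact: truncnS_gt.
have N0 : (0 : RR) < N.+1%:R by rewrite ltr0Sn.
have Nd : N.+1%:R^-1 < Num.min d1 d2.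
  by rewrite -[ltRHS]invrK ltf_pV2 // posrE invr_gt0 lt_min d10.
have in01 k : (k <= N.+1)%N -> 0 <= (k%:R / N.+1%:R : RR) <= 1.
  by move=> kN; rewrite divr_ge0 //= ler_pdivrMr // mul1r ler_nat.
have f0 : f 0 = f (0%:R / N.+1%:R) by rewrite mul0r.
have f1 : f 1 = f (N.+1%:R / N.+1%:R) by rewrite divff // pnatr_eq0.
exists [seq f (k%:R / N.+1%:R) | k <- iota 1 N.+1]; split.
- rewrite f0.
  suff : forall m k, (k + m <= N.+1)%N ->
    path (near_pt r) (f (k%:R / N.+1%:R)) [seq f (j%:R / N.+1%:R) | j <- iota k.+1 m].
    by apply.
  elim=> [|m IH] k km //=; rewrite IH ?addSnnS // andbT.
  have a := in01 k ltac:(lia); have b := in01 k.+1 ltac:(lia).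
  have dk : `|(k%:R / N.+1%:R : RR) - k.+1%:R / N.+1%:R| = N.+1%:R^-1.
    have -> : (k%:R / N.+1%:R : RR) - k.+1%:R / N.+1%:R = - N.+1%:R^-1.
      by rewrite -natr1; field; rewrite natr1 pnatr_eq0.
    by rewrite normrN gtr0_norm // invr_gt0.
  move: Nd; rewrite lt_min => /andP[Nd1 Nd2].
  by rewrite /near_pt H1 ?H2 ?dk.
- have -> : iota 1 N.+1 = rcons (iota 1 N) N.+1 by rewrite -cats1 -[in LHS](addn1 N) iotaD add1n.
  by rewrite map_rcons last_rcons f1.
- move=> q /mapP[k]; rewrite mem_iota => /andP[_ kN] ->.
  by exists (k%:R / N.+1%:R) => //; apply: in01; lia.
Qed.

(** [on a b] is the arc of the edge ab, and r separates the arcs of disjoint edges, uniformly over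
    the finitely many pairs. The mesh r' of the chains is chosen only after r. *)
Lemma planar_walk_chains (n : nat) (e : rel 'I_n) : simple_graph e -> planar e ->
  exists (p : 'I_n -> RR * RR) (on : 'I_n -> 'I_n -> RR * RR -> Prop) (r : RR),
  [/\ 0 < r,
   forall a b c d x y, e a b -> e c d -> disjoint_pairs a b c d -> on a b x -> on c d y ->
     r <= `|x.1 - y.1| \/ r <= `|x.2 - y.2| &
   forall r' a w, 0 < r' -> path e a w -> w != [::] ->
     exists s : seq (RR * RR), [/\ path (near_pt r') (p a) s, last (p a) s = p (last a w) &
       forall q, q \in p a :: s -> exists c d, [/\ e c d, c \in a :: w, d \in a :: w & on c d q]]].
Proof.
move=> simple_e planar_e.
have [p [A [Ae Ad]]] := planar_arcs _ _ simple_e planar_e.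
pose on a b (q : RR * RR) := exists2 x, 0 <= x <= 1 & q = A a b x.
have [r r0 Hr] : exists2 r : RR, 0 < r & forall t : 'I_n * 'I_n * ('I_n * 'I_n),
    forall x y, e t.1.1 t.1.2 -> e t.2.1 t.2.2 -> disjoint_pairs t.1.1 t.1.2 t.2.1 t.2.2 ->
     on t.1.1 t.1.2 x -> on t.2.1 t.2.2 y -> r <= `|x.1 - y.1| \/ r <= `|x.2 - y.2|.
  apply: finite_uniform.
    move=> t r r' H /andP[r'0 r'r] x y e1 e2 D o1 o2.
    by case: (H x y e1 e2 D o1 o2) => h; [left|right]; apply: le_trans r'r h.
  move=> [[a b] [c d]] /=.
  have [eab|_] := boolP (e a b); last by exists 1.
  have [ecd|_] := boolP (e c d); last by exists 1.
  have [D|_] := boolP (disjoint_pairs a b c d); last by exists 1.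
  have [_ _ a1 a2] := Ae a b eab; have [_ _ c1 c2] := Ae c d ecd.
  have [|r r0 Hr] := continuous01_separated _ _ _ _ a1 a2 c1 c2.
    move=> s t s01 t01; rewrite -!surjective_pairing; exact: Ad.
  by exists r => // x y _ _ _ [s s01 ->] [t t01 ->]; apply: Hr.
exists p, on, r; split=> //.
  by move=> a b c d x y; apply: (Hr ((a, b), (c, d))).
move=> r' a w r'0; elim: w a => [//|b w IH] a /= /andP[eab pw] _.
have [A0 A1 c1 c2] := Ae a b eab.
have [s [ps ls on_s]] := arc_chain _ _ r'0 c1 c2.
have s_on q : q \in p a :: s -> on a b q.
  rewrite inE => /orP[/eqP ->|/on_s//]; first by exists 0; rewrite ?lexx ?ler01 ?A0.
have [w0|wn0] := eqVneq w [::].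
  exists s; rewrite w0 /= -A0 -A1; split=> // q qs.
  by exists a, b; rewrite !inE !eqxx orbT; split=> //; apply: s_on; rewrite -A0.
have [s' [ps' ls' on_s']] := IH b pw wn0.
exists (s ++ s'); split.
- by rewrite cat_path -A0 ps /= ls A1.
- by rewrite last_cat -A0 ls A1.
- move=> q; rewrite -cat_cons mem_cat => /orP[/s_on onq|qs'].
    by exists a, b; rewrite !inE !eqxx orbT.
  have [|c [d [ecd cw dw oncd]]] := on_s' q; first by rewrite inE qs' orbT.
  by exists c, d; rewrite !(in_cons a) cw dw !orbT.
Qed.

Lemma zip_path (T : eqType) (R : rel T) x l a b : path R x l -> (a, b) \in zip (x :: l) l ->
  [/\ R a b, a \in x :: l & b \in l].
Proof.
elim: l x => [|y l IH] x //= /andP[Rxy pl]; rewrite inE => /orP[/eqP[-> ->]|ab].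
  by rewrite !inE !eqxx.
have [Rab al bl] := IH y pl ab.
by split=> //; [rewrite al orbT | rewrite in_cons bl orbT].
Qed.

(** All of a, b lie within rho / 4 of q and all of c, d within rho / 4 of q', too little to reverse
    an order across a gap of rho. *)
Lemma separated_compare (rho a b c d q q' : RR) : 0 < rho -> rho <= `|q - q'| ->
  `|a - b| < rho / 8 -> `|c - d| < rho / 8 -> `|a - q| < rho / 8 -> `|c - q'| < rho / 8 ->
  [/\ (a <= c) = (a <= c), (a <= d) = (a <= c), (b <= c) = (a <= c) & (b <= d) = (a <= c)].
Proof.
rewrite !ltr_norml ler_normr => rho0 h /andP[h1 h2] /andP[h3 h4] /andP[h5 h6] /andP[h7 h8].
have [lt|lt] : a + rho / 2 < c \/ c + rho / 2 < a by case/orP: h => h; [right|left]; lra.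
  by have -> : a <= c; [lra|have -> : a <= d; [lra|have -> : b <= c; [lra|have -> : b <= d; [lra|]]]].
by rewrite !leNgt; have -> : c < a; [lra|have -> : d < a; [lra|have -> : c < b; [lra|have -> : d < b; [lra|]]]].
Qed.

Definition lex1 (a b : RR * RR) : bool := a.1 <= b.1.
Definition lex2 (a b : RR * RR) : bool := a.2 <= b.2.

(* Vertices are shifted by a small generic vector so that no comparison of
   coordinates between a vertex and a chain avoiding it is a tie. *)
Lemma planar_crossing_equations (n K : nat) (e : rel 'I_n) (r : nat -> 'I_n)
    (w : nat -> nat -> seq 'I_n) (Ed : nat -> nat -> bool) :
  simple_graph e -> planar e ->
  (forall i j, (i < j < K)%N -> Ed i j ->
     [/\ path e (r i) (w i j), last (r i) (w i j) = r j & w i j != [::]]) ->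
  (forall i j k l, (i < j < K)%N -> (k < l < K)%N -> Ed i j -> Ed k l ->
     i != k -> j != l -> j != k -> i != l ->
     forall x, x \in r i :: w i j -> x \notin r k :: w k l) ->
  exists (X Y : nat -> nat -> bool) (m : nat -> nat -> nat -> bool),
  [/\ forall i j, (i < j < K)%N -> X j i = ~~ X i j,
      forall i j, (i < j < K)%N -> Y j i = ~~ Y i j &
      forall i j k l, (i < j < K)%N -> (k < l < K)%N -> Ed i j -> Ed k l ->
        i != k -> j != l -> j != k -> i != l ->
        elbow_cross X Y i j k l = (m i j k (+) m i j l) (+) (m k l i (+) m k l j)].
Proof.
move=> simple_e planar_e walks disj.
have [p [on [rho [rho0 far chains]]]] := planar_walk_chains _ _ simple_e planar_e.
have rho8 : 0 < rho / 8 by rewrite divr_gt0.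
have [s0 Hs0] : exists s0 : nat -> nat -> seq (RR * RR), forall i j, (i < j < K)%N -> Ed i j ->
   [/\ path (near_pt (rho / 8)) (p (r i)) (s0 i j), last (p (r i)) (s0 i j) = p (r j) &
       forall q, q \in p (r i) :: s0 i j -> exists c d,
         [/\ e c d, c \in r i :: w i j, d \in r i :: w i j & on c d q]].
  have /choice[f Hf] : forall ij : nat * nat, exists s : seq (RR * RR),
     (ij.1 < ij.2 < K)%N -> Ed ij.1 ij.2 ->
   [/\ path (near_pt (rho / 8)) (p (r ij.1)) s, last (p (r ij.1)) s = p (r ij.2) &
       forall q, q \in p (r ij.1) :: s -> exists c d,
         [/\ e c d, c \in r ij.1 :: w ij.1 ij.2, d \in r ij.1 :: w ij.1 ij.2 & on c d q]].
    move=> [i j] /=; have [ijK|_] := boolP (i < j < K)%N; last by exists [::].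
    have [Eij|_] := boolP (Ed i j); last by exists [::].
    have [pw lw w0] := walks i j ijK Eij.
    by have [s Hs] := chains _ _ _ rho8 pw w0; exists s => _ _; rewrite -lw.
  by exists (fun i j => f (i, j)) => i j; apply: (Hf (i, j)).
pose pts := flatten [seq p (r ij.1) :: s0 ij.1 ij.2 | ij <- [seq (i, j) | i <- iota 0 K, j <- iota 0 K]]
  ++ [seq p (r i) | i <- iota 0 K].
(* The values of eta for which a shifted vertex ties with a chain point, or two shifted vertices
   tie, in one coordinate. Vertex k moves by (k + 1) eta, so each coincidence excludes a single
   value; the entries with i = k are 0 and harmless as eta > 0. *)
pose bad := [seq (q.1 - (p (r k)).1) / k.+1%:R | q <- pts, k <- iota 0 K]
         ++ [seq (q.2 - (p (r k)).2) / k.+1%:R | q <- pts, k <- iota 0 K]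
         ++ [seq ((p (r i)).1 - (p (r k)).1) / (k%:R - i%:R) | i <- iota 0 K, k <- iota 0 K]
         ++ [seq ((p (r i)).2 - (p (r k)).2) / (k%:R - i%:R) | i <- iota 0 K, k <- iota 0 K].
have [d d0 Hd] := small_notin bad.
have [eta [eta0 eta_small eta_bad]] : exists eta : RR, [/\ 0 < eta, K.+1%:R * eta < rho / 8 & eta \notin bad].
  exists (Num.min (rho / 8 / K.+2%:R) (d / 2)); split.
  - by rewrite lt_min !divr_gt0.
  - rewrite -lter_pdivlMl ?ltr0Sn //.
    apply: (le_lt_trans (_ : _ <= rho / 8 / K.+2%:R)); first by rewrite ge_min lexx.
    by rewrite mulrC ltr_pM2r // ltf_pV2 ?posrE ?ltr0Sn // ltr_nat.
  - apply: Hd; rewrite lt_min !divr_gt0 //= gt_min.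
    by apply/orP; right; rewrite ltr_pdivrMr // mulr_natr mulr2n ltrDl.
pose v k : RR * RR := ((p (r k)).1 + k.+1%:R * eta, (p (r k)).2 + k.+1%:R * eta).
have v_near k : (k < K)%N -> near_pt (rho / 8) (v k) (p (r k)) && near_pt (rho / 8) (p (r k)) (v k).
  move=> kK; suff h : `|k.+1%:R * eta| < rho / 8.
    by rewrite /near_pt /v /= !opprD !addrA !subrr !add0r !normrN !(addrC _ (_ * eta)) !addrK h.
  rewrite ger0_norm ?mulr_ge0 ?(ltW eta0) //.
  by apply: le_lt_trans eta_small; rewrite ler_pM2r // ler_nat; lia.
have generic q k : q \in pts -> (k < K)%N -> q.1 <> (v k).1 /\ q.2 <> (v k).2.
  move=> qp kK; have k1 : (k.+1%:R : RR) != 0 by rewrite pnatr_eq0.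
  have kI : k \in iota 0 K by rewrite mem_iota.
  split=> [E1|E2].
    have /negP := eta_bad; apply; rewrite /bad !mem_cat.
    apply/orP; left; apply/allpairsP; exists (q, k); split=> //=.
    by rewrite E1 /v /= addrAC subrr add0r mulrAC divff // mul1r.
  have /negP := eta_bad; apply; rewrite /bad !mem_cat.
  apply/orP; right; apply/orP; left; apply/allpairsP; exists (q, k); split=> //=.
  by rewrite E2 /v /= addrAC subrr add0r mulrAC divff // mul1r.
have vgeneric i k : (i < K)%N -> (k < K)%N -> i != k -> (v i).1 <> (v k).1 /\ (v i).2 <> (v k).2.
  move=> iK kK ik.
  have ki : (k%:R - i%:R : RR) != 0 by rewrite subr_eq0 eqr_nat eq_sym.
  have kI : k \in iota 0 K by rewrite mem_iota.
  have iI : i \in iota 0 K by rewrite mem_iota.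
  rewrite /v /=; split=> E.
    have /negP := eta_bad; apply; rewrite /bad !mem_cat.
    do 2 (apply/orP; right); apply/orP; left; apply/allpairsP; exists (i, k); split=> //=.
    have -> : (p (r i)).1 - (p (r k)).1 = (k%:R - i%:R) * eta.
      by move: E; rewrite -!natr1 !mulrDl !mul1r => E; lra.
    by rewrite mulrAC divff // mul1r.
  have /negP := eta_bad; apply; rewrite /bad !mem_cat.
  do 3 (apply/orP; right); apply/allpairsP; exists (i, k); split=> //=.
  have -> : (p (r i)).2 - (p (r k)).2 = (k%:R - i%:R) * eta.
    by move: E; rewrite -!natr1 !mulrDl !mul1r => E; lra.
  by rewrite mulrAC divff // mul1r.
have flip (x y : RR) : x <> y -> (y <= x) = ~~ (x <= y).
  by move=> /eqP xy; rewrite -ltNge lt_neqAle eq_sym xy.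
(* The chain from [v i] to [v j]: unshifted inside, with one short step added at either end. *)
pose g i j := p (r i) :: rcons (s0 i j) (v j).
have lastg i j : last (v i) (g i j) = v j by rewrite /= last_rcons.
have g_on i j : (i < j < K)%N -> Ed i j -> path (near_pt (rho / 8)) (v i) (g i j) /\
   forall q, q \in v i :: g i j -> exists c d q',
      [/\ near_pt (rho / 8) q q', e c d, c \in r i :: w i j, d \in r i :: w i j & on c d q'].
  move=> ijK Eij; have [ps ls on_s] := Hs0 i j ijK Eij.
  case/andP: (ijK) => ij jK; have iK := ltn_trans ij jK.
  have /andP[vi1 vi2] := v_near i iK; have /andP[vj1 vj2] := v_near j jK.
  split; first by rewrite /= vi1 rcons_path ps ls vj2.
  have q_on q : q \in p (r i) :: s0 i j -> exists c d q',
      [/\ near_pt (rho / 8) q q', e c d, c \in r i :: w i j, d \in r i :: w i j & on c d q'].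
    move=> /on_s[c [d' [ecd cw dw o]]]; exists c, d', q; split=> //.
    by rewrite /near_pt !subrr normr0 rho8.
  move=> q; rewrite /g -rcons_cons inE mem_rcons inE => /or3P[/eqP ->|/eqP ->|]; last exact: q_on.
    have [c [d' [ecd cw dw o]]] := on_s _ (mem_head _ _).
    by exists c, d', (p (r i)).
  have [c [d' [ecd cw dw o]]] := on_s (p (r j)) ltac:(by rewrite -ls mem_last).
  by exists c, d', (p (r j)).
exists (fun i j => lex1 (v i) (v j)), (fun i j => lex2 (v i) (v j)),
  (fun i j k => chain_wind lex1 lex2 (v i) (g i j) (v k)).
split.
- move=> i j ijK; rewrite /lex1; apply: flip; by case/andP: ijK => ij jK; apply: (proj1 (vgeneric i j (ltn_trans ij jK) jK _)); rewrite neq_ltn ij.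
- move=> i j ijK; rewrite /lex2; apply: flip; by case/andP: ijK => ij jK; apply: (proj2 (vgeneric i j (ltn_trans ij jK) jK _)); rewrite neq_ltn ij.
move=> i j k l ijK klK Eij Ekl ik jl jk il.
have [gp gon] := g_on i j ijK Eij; have [gp' gon'] := g_on k l klK Ekl.
(* Vertex-disjoint walks run along arcs at distance at least rho, so no step of one chain crosses a
   step of the other; [chains_crossE] then becomes the wanted equation. *)
have : chains_cross lex1 lex2 (v i) (g i j) (v k) (g k l) = false.
  apply: chains_cross_far => a b c d' /(zip_path _ _ _ _ _ _ gp)[/andP[ab1 ab2] ai _].
  move=> /(zip_path _ _ _ _ _ _ gp')[/andP[cd1 cd2] ck _].
  have [x [y [q [/andP[aq1 aq2] exy xw yw oq]]]] := gon a ai.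
  have [x' [y' [q' [/andP[cq1 cq2] exy' xw' yw' oq']]]] := gon' c ck.
  have D := disj i j k l ijK klK Eij Ekl ik jl jk il.
  have xyD : disjoint_pairs x y x' y'.
    have ne u u' : u \in r i :: w i j -> u' \in r k :: w k l -> u != u'.
      by move=> /D uw u'w; apply: contraNneq uw => ->.
    by apply/and4P; split; apply: ne.
  rewrite /lex1 /lex2.
  case: (far x y x' y' q q' exy exy' xyD oq oq') => h; [left|right].
    by exists (a.1 <= c.1); apply: (separated_compare rho _ _ _ _ _ _ rho0 h).
  by exists (a.2 <= c.2); apply: (separated_compare rho _ _ _ _ _ _ rho0 h).
rewrite chains_crossE !lastg => E.
have -> : elbow_cross (fun i j => lex1 (v i) (v j)) (fun i j => lex2 (v i) (v j)) i j k l =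
   elbow_cross lex1 lex2 (v i) (v j) (v k) (v l) by [].
(* Without ties the flipped comparisons coincide with the original ones, so one function [m]
   describes the windings on both sides. *)
have wind i' j' k' : (i' < j' < K)%N -> (k' < K)%N -> Ed i' j' -> k' != i' -> k' != j' ->
   chain_wind (flip_rel lex1) (flip_rel lex2) (v i') (g i' j') (v k') =
   chain_wind lex1 lex2 (v i') (g i' j') (v k').
  move=> ijK' kK' Eij' ki kj; apply: chain_wind_eq => a; rewrite /g -rcons_cons inE mem_rcons inE.
  case/andP: (ijK') => ij' jK'; have iK' := ltn_trans ij' jK'.
  rewrite /flip_rel /lex1 /lex2 => ai.
  have [n1 n2] : (v k').1 <> a.1 /\ (v k').2 <> a.2.
    case/or3P: ai => [/eqP ->|/eqP ->|ai]; [exact: vgeneric | exact: vgeneric |].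
    have [|//|n1 n2] := generic a k'; last by split=> /esym.
    rewrite /pts mem_cat; apply/orP; left; apply/flattenP; exists (p (r i') :: s0 i' j') => //.
    by apply/mapP; exists (i', j') => //; apply/allpairsP; exists (i', j'); rewrite !mem_iota.
  by rewrite -!flip.
case/andP: (ijK) => ij jK; have iK := ltn_trans ij jK.
rewrite (wind k l i klK iK Ekl ik il) (wind k l j klK jK Ekl jk jl) in E.
have addb_eq a b : a (+) b = false -> a = b by case: a b => [] [].
exact: addb_eq E.
Qed.

(** Representatives of the branch sets play the vertices of K5, and walks through B i, one
    connecting edge and B j play its edges. Walks for disjoint pairs are vertex-disjoint because the
    branch sets are. *)
Lemma planar_no_K5_minor (n : nat) (e : rel 'I_n) (B : nat -> {set 'I_n}) :
  simple_graph e -> planar e -> ~ K5_minor e B.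
Proof.
move=> simple_e planar_e [conn disj adj].
have [r0 _] := conn 0%N isT; have {r0} [x0 _] := r0.
have /choice[r Hr] : forall i, exists x, (i < 5)%N -> x \in B i.
  move=> i; have [i5|_] := boolP (i < 5)%N; last by exists x0.
  by have [[x xB] _] := conn i i5; exists x.
have /choice[w Hw] : forall ij : nat * nat, exists s : seq 'I_n, (ij.1 < ij.2 < 5)%N ->
   [/\ path e (r ij.1) s, last (r ij.1) s = r ij.2, s != [::] &
     forall x, x \in r ij.1 :: s -> (x \in B ij.1) || (x \in B ij.2)].
  move=> [i j] /=; have [ij5|_] := boolP (i < j < 5)%N; last by exists [::].
  have [i5 j5] : (i < 5)%N /\ (j < 5)%N by lia.
  have [x [y [xB yB exy]]] := adj i j ij5.
  have [p [pp lp pB]] := connected_in_path _ _ _ _ (conn i i5) (Hr i i5) xB.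
  have [q [qp lq qB]] := connected_in_path _ _ _ _ (conn j j5) yB (Hr j j5).
  exists (p ++ y :: q) => _; split.
  - by rewrite cat_path pp /= lp exy.
  - by rewrite last_cat.
  - by case: (p).
  - move=> z; rewrite inE mem_cat inE => /or4P[/eqP ->|/pB ->|/eqP ->|/qB ->]; rewrite ?orbT ?yB ?orbT //.
    by rewrite Hr.
have Hdisj i j x : (i < 5)%N -> (j < 5)%N -> i != j -> x \in B i -> x \notin B j.
  move=> i5 j5; rewrite neq_ltn => /orP[ij|ji] xB; first by apply: (disj i) => //; rewrite ij.
  by apply/negP => /(disj j i) H; move: xB; rewrite (negbTE (H _)) // ji.
have [||X [Y [m [aX aY H]]]] := planar_crossing_equations n 5 e r (fun i j => w (i, j)) (fun _ _ => true)
    simple_e planar_e.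
- by move=> i j ij5 _; have [] := Hw (i, j) ij5.
- move=> i j k l ij5 kl5 _ _ ik jl jk il x.
  have [_ _ _ hij] := Hw (i, j) ij5; have [_ _ _ hkl] := Hw (k, l) kl5.
  case/andP: ij5 => ij j5; case/andP: kl5 => kl l5.
  have [i5 k5] := (ltn_trans ij j5, ltn_trans kl l5).
  move=> /hij /= xij; apply/negP => /hkl /= xkl.
  by case/orP: xij => xij; case/orP: xkl; apply/negP; apply: Hdisj xij.
apply: (K5_odd_crossing X Y m aX aY) => i j k l ij5 kl5 ik jk jl.
by apply: H => //; lia.
Qed.

Lemma planar_no_K33 (n : nat) (e : rel 'I_n) (r : nat -> 'I_n) :
  simple_graph e -> planar e ->
  (forall i j, (i < j < 6)%N -> r i != r j) ->
  (forall i j, (i < 3)%N -> (3 <= j < 6)%N -> e (r i) (r j)) ->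
  False.
Proof.
move=> simple_e planar_e inj adj.
have inj' i j : (i < 6)%N -> (j < 6)%N -> i != j -> r i != r j.
  move=> i6 j6; rewrite neq_ltn => /orP[ij|ji]; first by apply: inj; rewrite ij.
  by rewrite eq_sym; apply: inj; rewrite ji.
have [||X [Y [m [aX aY H]]]] := planar_crossing_equations n 6 e r (fun i j => [:: r j])
   (fun i j => (i < 3 <= j)%N) simple_e planar_e.
- by move=> i j ij6 /andP[i3 j3]; split=> //=; rewrite andbT adj //; lia.
- move=> i j k l ij6 kl6 _ _ ik jl jk il x; rewrite !inE => /orP[] /eqP ->;
    by rewrite negb_or; apply/andP; split; apply: inj'; lia.
apply: (K33_odd_crossing X Y m aX aY) => i j k l i3j j6 k3l l6 ik jl.
by apply: H => //; lia.
Qed.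

(** * Perron vectors *)

Lemma continuous_sum (T : topologicalType) (I : Type) (r : seq I) (P : pred I) (f : I -> T -> RR) :
  (forall i, continuous (f i)) -> continuous (fun v => \sum_(i <- r | P i) f i v).
Proof.
move=> cf; elim: r => [|i r IH].
  rewrite (_ : (fun v => _) = fun=> 0); first by move=> v; apply: cvg_cst.
  by apply/funext => v; rewrite big_nil.
rewrite (_ : (fun v => _) = fun v => (if P i then f i v else 0) + \sum_(j <- r | P j) f j v).
  have cP : continuous (fun v => if P i then f i v else 0).
    by case: (P i); [exact: cf | move=> v; apply: cvg_cst].
  by move=> v; exact: (@continuousD RR RR^o T _ _ v (cP v) (IH v)).
by apply/funext => v; rewrite big_cons; case: (P i); rewrite ?add0r.
Qed.

Section Rayleigh.
Variables (n : nat) (e : rel 'I_n).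
Hypothesis sym : symmetric e.

Definition adj_sum (y : 'I_n -> RR) (i : 'I_n) : RR := \sum_(j | e i j) y j.
Definition quad_form (y : 'I_n -> RR) : RR := \sum_i y i * adj_sum y i.
Definition sq_norm (y : 'I_n -> RR) : RR := \sum_i y i ^+ 2.

Lemma sum_adjC (y z : 'I_n -> RR) :
  \sum_i y i * adj_sum z i = \sum_i z i * adj_sum y i.
Proof.
transitivity (\sum_i \sum_j if e i j then y i * z j else 0).
  by apply: eq_bigr => i _; rewrite /adj_sum mulr_sumr big_mkcond.
rewrite exchange_big; apply: eq_bigr => i _.
rewrite /adj_sum mulr_sumr [RHS]big_mkcond; apply: eq_bigr => j _.
by rewrite sym mulrC.
Qed.

Lemma adj_sumD (y z : 'I_n -> RR) t i :
  adj_sum (fun j => y j + t * z j) i = adj_sum y i + t * adj_sum z i.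
Proof. by rewrite /adj_sum big_split /= mulr_sumr. Qed.

Lemma quad_formD (y z : 'I_n -> RR) t :
  quad_form (fun j => y j + t * z j) =
  quad_form y + 2 * t * (\sum_i z i * adj_sum y i) + t ^+ 2 * quad_form z.
Proof.
rewrite /quad_form.
under eq_bigr do rewrite adj_sumD mulrDl !mulrDr.
rewrite !big_split /=.
have -> : \sum_i y i * (t * adj_sum z i) = t * \sum_i z i * adj_sum y i.
  by rewrite -sum_adjC mulr_sumr; apply: eq_bigr => i _; rewrite mulrCA.
have -> : \sum_i t * z i * adj_sum y i = t * \sum_i z i * adj_sum y i.
  by rewrite mulr_sumr; apply: eq_bigr => i _; rewrite mulrA.
have -> : \sum_i t * z i * (t * adj_sum z i) = t ^+ 2 * \sum_i z i * adj_sum z i.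
  by rewrite mulr_sumr; apply: eq_bigr => i _; ring.
by ring.
Qed.

Lemma sq_normD (y z : 'I_n -> RR) t :
  sq_norm (fun j => y j + t * z j) =
  sq_norm y + 2 * t * (\sum_i z i * y i) + t ^+ 2 * sq_norm z.
Proof.
rewrite /sq_norm !mulr_sumr -!big_split /=; apply: eq_bigr => i _; ring.
Qed.

Lemma sq_norm_ge0 y : 0 <= sq_norm y.
Proof. by apply: sumr_ge0 => i _; apply: sqr_ge0. Qed.

Lemma sq_norm_eq0 y : sq_norm y = 0 -> forall i, y i = 0.
Proof.
move=> /eqP; rewrite psumr_eq0 => [/allP H i|i _]; last exact: sqr_ge0.
by have := H i (mem_index_enum _); rewrite sqrf_eq0 => /eqP.
Qed.

Lemma unit_sphere_maximizer : (0 < n)%N ->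
  exists x : 'I_n -> RR, sq_norm x = 1 /\ forall y, sq_norm y = 1 -> quad_form y <= quad_form x.
Proof.
move=> n0.
pose S : set 'rV[RR]_n := [set v | sq_norm (fun i => v ord0 i) = 1]%classic.
have coord i : continuous (fun v : 'rV[RR]_n => v ord0 i) by exact: coord_continuous.
have contN : continuous (fun v : 'rV[RR]_n => sq_norm (fun i => v ord0 i)).
  by apply: continuous_sum => i v; exact: (@continuousM RR _ _ _ v (coord i v) (coord i v)).
have contQ : continuous (fun v : 'rV[RR]_n => quad_form (fun i => v ord0 i)).
  have cA i : continuous (fun v : 'rV[RR]_n => adj_sum (fun j => v ord0 j) i).
    by apply: continuous_sum => j; apply: coord.
  by apply: continuous_sum => i v; exact: (@continuousM RR _ _ _ v (coord i v) (cA i v)).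
have cS : compact S.
  apply: bounded_closed_compact.
    exists 1; split=> // M M1 v Sv; rewrite /= [leLHS]/Num.norm /= mx_normrE.
    apply/bigmax_leP; split=> [|[i j] _ /=]; first by apply: ltW; apply: lt_trans M1.
    apply: le_trans (ltW M1); rewrite ord1.
    have : v ord0 j ^+ 2 <= 1.
      by rewrite -Sv /sq_norm (bigD1 j) //= lerDl; apply: sumr_ge0 => k _; apply: sqr_ge0.
    by rewrite -real_normK ?num_real // expr_le1.
  by apply: (@closed_comp _ _ (fun v : 'rV[RR]_n => sq_norm (fun i => v ord0 i)) [set 1]%classic) => // v _; apply: contN.
have S0 : (S !=set0)%classic.
  exists (\row_j (j == Ordinal n0)%:R); rewrite /S /= /sq_norm (bigD1 (Ordinal n0)) //= mxE eqxx.
  by rewrite big1 ?addr0 ?expr1n // => i /negbTE ne; rewrite mxE ne expr0n.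
have [|v vS vmax] := compact_EVT_max (f := fun v : 'rV[RR]_n => quad_form (fun i => v ord0 i)) S0 cS.
  by apply: continuous_subspaceT.
exists (fun i => v ord0 i); split; first by rewrite classical_sets.in_setE in vS.
move=> y y1; have := vmax (\row_i y i); rewrite classical_sets.in_setE.
have E : (fun i => (\row_i0 y i0) ord0 i) = y by apply/funext => i; rewrite mxE.
by rewrite /S /= E; apply.
Qed.

Lemma perron_exists : (0 < n)%N ->
  exists (x : 'I_n -> RR) (rho : RR),
  [/\ forall i, 0 <= x i, sq_norm x = 1, forall i, adj_sum x i = rho * x i &
      forall y, quad_form y <= rho * sq_norm y].
Proof.
move=> n0; have [z [z1 zmax]] := unit_sphere_maximizer n0.
have bound y : quad_form y <= quad_form z * sq_norm y.
  have [y0|yn0] := eqVneq (sq_norm y) 0.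
    have {}y0 := sq_norm_eq0 _ y0.
    rewrite /quad_form big1 => [|i _]; last by rewrite y0 mul0r.
    by rewrite /sq_norm [X in _ * X]big1 ?mulr0 // => i _; rewrite y0 expr0n.
  have y0 : 0 < sq_norm y by rewrite lt_neqAle eq_sym yn0 sq_norm_ge0.
  pose c := Num.sqrt (sq_norm y).
  have c0 : 0 < c by rewrite sqrtr_gt0.
  have cc : c ^+ 2 = sq_norm y by rewrite sqr_sqrtr // ltW.
  have := zmax (fun i => y i / c).
  have -> : sq_norm (fun i => y i / c) = sq_norm y / c ^+ 2.
    by rewrite /sq_norm mulr_suml; apply: eq_bigr => i _; rewrite expr_div_n.
  have -> : quad_form (fun i => y i / c) = quad_form y / c ^+ 2.
    rewrite /quad_form mulr_suml; apply: eq_bigr => i _; rewrite /adj_sum -mulr_suml.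
    by field; rewrite gt_eqF.
  by rewrite cc divff // => /(_ erefl); rewrite ler_pdivrMr.
(* Absolute values keep the norm and do not decrease the form, so a nonnegative maximizer exists. *)
pose x i := `|z i|.
have x1 : sq_norm x = 1 by rewrite -z1; apply: eq_bigr => i _; rewrite real_normK ?num_real.
have xQ : quad_form x = quad_form z.
  apply/eqP; rewrite eq_le zmax //=; apply: ler_sum => i _.
  apply: le_trans (ler_norm _) _; rewrite normrM; apply: ler_wpM2l => //.
  exact: ler_norm_sum.
exists x, (quad_form z); split=> [i|//|i|//]; first exact: normr_ge0.
apply/eqP; rewrite -subr_eq0; apply/eqP.
set d := _ - _.
pose y (j : 'I_n) : RR := (j == i)%:R.
have yx (f : 'I_n -> RR) : \sum_j y j * f j = f i.
  rewrite (bigD1 i) //= /y eqxx mul1r big1 ?addr0 // => j /negbTE ->; by rewrite mul0r.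
have y1 : sq_norm y = 1.
  by rewrite /sq_norm -[RHS](yx (fun=> 1)); apply: eq_bigr => j _; rewrite /y mulr1 -natrX; case: (j == i).
(* First variation in the direction of the unit vector at i. Holding for every t, the inequality
   forces d = 0; t = d / (C + 1) shows it without a limit. *)
have lin t : 2 * t * d <= t ^+ 2 * (quad_form z - quad_form y).
  have := bound (fun j => x j + t * y j); rewrite quad_formD sq_normD x1 y1 xQ !yx /d.
  by lra.
have C0 : 0 <= quad_form z - quad_form y by rewrite subr_ge0 zmax.
set C := quad_form z - quad_form y in lin C0.
have := lin (d / (C + 1)); have := sqr_ge0 d => d2.
have C1 : 0 < C + 1 by lra.
have -> : 2 * (d / (C + 1)) * d = 2 * (C + 1) * (d ^+ 2 / (C + 1) ^+ 2) by field; lra.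
have -> : (d / (C + 1)) ^+ 2 * C = C * (d ^+ 2 / (C + 1) ^+ 2) by field; lra.
have q0 : 0 <= d ^+ 2 / (C + 1) ^+ 2 by rewrite divr_ge0 // sqr_ge0.
move=> H; have : d ^+ 2 / (C + 1) ^+ 2 = 0 by nra.
move/eqP; rewrite mulf_eq0 invr_eq0 !sqrf_eq0 (gt_eqF C1) orbF => /eqP //.
Qed.

(** The maximum rho of the form on the unit sphere is an eigenvalue and bounds all others, so the
    supremum in [spec_rad] is attained. [eigenvalue] speaks of row vectors; symmetry turns it into
    the [adj_sum] equation. *)
Lemma spec_rad_perron : (0 < n)%N ->
  exists x : 'I_n -> RR,
  [/\ forall i, 0 <= x i, sq_norm x = 1, forall i, adj_sum x i = spec_rad e * x i &
      forall y, quad_form y <= spec_rad e * sq_norm y].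
Proof.
move=> n0; have [x [rho [x0 x1 xE xQ]]] := perron_exists n0.
suff -> : spec_rad e = rho by exists x.
have eigenP a : eigenvalue (adjmx e) a <-> exists2 y : 'I_n -> RR, (exists i, y i != 0) & forall i, adj_sum y i = a * y i.
  split=> [/eigenvalueP[v vA v0]|[y [i yi] yE]].
    exists (fun i => v ord0 i).
      by have [i vi] := rV0Pn _ v0; exists i.
    move=> i; have := congr1 (fun w : 'rV_n => w ord0 i) vA; rewrite !mxE => <-.
    rewrite /adj_sum big_mkcond; apply: eq_bigr => j _; rewrite mxE sym.
    by case: (e j i); rewrite ?mulr1 ?mulr0.
  apply/eigenvalueP; exists (\row_i y i).
    apply/rowP => j; rewrite !mxE -yE /adj_sum [RHS]big_mkcond; apply: eq_bigr => k _.
    by rewrite !mxE sym; case: (e j k); rewrite ?mulr1 ?mulr0.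
  by apply/rV0Pn; exists i; rewrite mxE.
have ub a : eigenvalue (adjmx e) a -> a <= rho.
  move=> /eigenP[y [i yi] yE].
  have y0 : 0 < sq_norm y.
    rewrite lt_neqAle sq_norm_ge0 andbT eq_sym; apply: contraNneq yi => /sq_norm_eq0 ->.
    by rewrite eqxx.
  rewrite -(ler_pM2r y0); apply: le_trans (xQ y).
  by rewrite /quad_form /sq_norm mulr_sumr; apply: ler_sum => j _; rewrite yE; lra.
have ev : eigenvalue (adjmx e) rho.
  apply/eigenP; exists x => //; apply: contrapT => H.
  have : sq_norm x = 0 by apply: big1 => i _; rewrite (_ : x i = 0) ?expr0n //; apply/eqP/negPn/negP => xi; apply: H; exists i.
  by rewrite x1 => /eqP; rewrite oner_eq0.
apply/eqP; rewrite eq_le; apply/andP; split.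
  by apply: sup_le_ub; [exists rho | move=> a; apply: ub].
by apply: ub_le_sup; [exists rho => a; apply: ub | exact: ev].
Qed.

(* Perturbing a near-maximizer in the direction of w beats lam. *)
Lemma spec_rad_gt (y : 'I_n -> RR) (lam : RR) (w : 'I_n) :
  irreflexive e -> lam * sq_norm y <= quad_form y -> lam * y w < adj_sum y w ->
  lam < spec_rad e.
Proof.
move=> irr yQ yw; rewrite ltNge; apply/negP => le_lam.
have n0 : (0 < n)%N by case: w {yw} => w; case: (n).
have [x [_ _ _ bound]] := spec_rad_perron n0.
pose z (j : 'I_n) : RR := (j == w)%:R.
have zf (f : 'I_n -> RR) : \sum_j z j * f j = f w.
  by rewrite (bigD1 w) //= /z eqxx mul1r big1 ?addr0 // => j /negbTE ->; rewrite mul0r.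
have z1 : sq_norm z = 1.
  by rewrite /sq_norm -[RHS](zf (fun=> 1)); apply: eq_bigr => j _; rewrite /z mulr1 -natrX; case: (j == w).
have zQ : quad_form z = 0.
  rewrite /quad_form zf /adj_sum big1 // => j ewj; rewrite /z.
  by case: eqP ewj => // ->; rewrite irr.
pose d := adj_sum y w - lam * y w.
have d0 : 0 < d by rewrite subr_gt0.
(* The gain is 2 t d and the cost lam t^2, where lam t <= d. There is no further quadratic term
   because w carries no loop. *)
pose t := d / (`|lam| + 1).
have l1 : 0 < `|lam| + 1 by rewrite ltr_wpDl.
have t0 : 0 < t by rewrite divr_gt0.
have := bound (fun j => y j + t * z j); have N0 := sq_norm_ge0 (fun j => y j + t * z j).
move=> H; have {}H := le_trans H (ler_wpM2r N0 le_lam).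
move: H; rewrite quad_formD sq_normD zQ z1 !zf => H.
have td : t * (`|lam| + 1) = d by rewrite /t mulfVK // gt_eqF.
have lt : lam * t <= d.
  rewrite -td mulrC ler_pM2l //; apply: le_trans (ler_norm _) _; lra.
rewrite /d in td d0 lt; nra.
Qed.
End Rayleigh.

(** * Straight-line drawing of the joins *)

Definition fan_pos (n k : nat) : RR * RR :=
  if (k < n - 2)%N then (k.+1%:R, 0) else if k == (n - 2)%N then (0, 1) else (0, -1).

Lemma fan_pos_inj n i j : (i < n)%N -> (j < n)%N -> fan_pos n i = fan_pos n j -> i = j.
Proof.
move=> iN jN; rewrite /fan_pos; case: ltnP => il; case: ltnP => jl.
- by move=> [] /eqP; rewrite -!natr1 (inj_eq (addIr _)) eqr_nat => /eqP.
- by case: eqP => _ [] _ h; exfalso; clear -h; lra.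
- by case: eqP => _ [] _ h; exfalso; clear -h; lra.
- case: eqP => ei; case: eqP => ej //; first by rewrite ei.
  + by case=> h; exfalso; clear -h; lra.
  + by case=> h; exfalso; clear -h; lra.
  + by move=> _; clear -iN jN il jl ei ej; lia.
Qed.

Definition segment_pt (a b : RR * RR) (s : RR) : RR * RR :=
  ((1 - s) * a.1 + s * b.1, (1 - s) * a.2 + s * b.2).

Lemma segment_pt_rev a b s : segment_pt a b s = segment_pt b a (1 - s).
Proof. by rewrite /segment_pt; congr (_, _); ring. Qed.

Lemma affine_continuous (R : realType) (a b : R) : continuous (fun s : R => (1 - s) * a + s * b).
Proof.
move=> s; apply: cvgD; apply: cvgM; try exact: cvg_cst; last exact: cvg_id.
by apply: cvgB; [exact: cvg_cst | exact: cvg_id].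
Qed.

Lemma segment_pt_continuous a b : continuous (segment_pt a b).
Proof. by move=> s; exact: (cvg_pair (@affine_continuous RR a.1 b.1 s) (@affine_continuous RR a.2 b.2 s)). Qed.

Lemma segment_pt_inj a b : a <> b -> injective (segment_pt a b).
Proof.
move=> ab s t [e1 e2]; apply/eqP; rewrite -subr_eq0; apply/eqP.
have [a1|a1] := eqVneq a.1 b.1.
  have a2 : a.2 - b.2 != 0.
    rewrite subr_eq0; apply/eqP => a2; apply: ab.
    by rewrite (surjective_pairing a) (surjective_pairing b) a1 a2.
  by apply: (mulIf a2); lra.
have {}a1 : a.1 - b.1 != 0 by rewrite subr_eq0.
by apply: (mulIf a1); lra.
Qed.

(** The join of K2 with a single path on n - 2 vertices, which contains the joins of K2 with all
    linear forests; one drawing serves them all. *)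
Definition fan_edge (n i j : nat) : bool :=
  (i < j < n)%N && ((n - 2 <= j)%N || (i.+1 == j)).

(** The open segments in implicit form, so that the edge can be recovered from any of its points. *)
Definition fan_region (n i j : nat) (q : RR * RR) : Prop :=
  [\/ [/\ j = i.+1, q.2 = 0 & i.+1%:R < q.1 < i.+2%:R],
      [/\ j = (n - 2)%N, 0 < q.2 < 1 & q.1 = i.+1%:R * (1 - q.2)],
      [/\ j = (n - 1)%N, -1 < q.2 < 0 & q.1 = i.+1%:R * (1 + q.2)] |
      [/\ i = (n - 2)%N, j = (n - 1)%N, q.1 = 0 & -1 < q.2 < 1]].

Lemma fan_regionP n i j s : (1 < n)%N -> fan_edge n i j -> 0 < s < 1 ->
  fan_region n i j (segment_pt (fan_pos n i) (fan_pos n j) s).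
Proof.
move=> n2 /andP[/andP[ij jn] E] s01; rewrite /segment_pt /fan_pos.
have [jl|jg] := ltnP j (n - 2).
  have -> : (i < n - 2)%N by lia.
  have -> : j = i.+1 by lia.
  by constructor 1; split=> //=; rewrite -?natr1; lra.
have [jn2|jn2] := eqVneq j (n - 2)%N.
  have -> : (i < n - 2)%N by lia.
  by constructor 2; split=> //=; lra.
have jn1 : j = (n - 1)%N by lia.
have [il|ig] := ltnP i (n - 2).
  by constructor 3; split=> //=; lra.
have in2 : i = (n - 2)%N by lia.
by rewrite in2 eqxx; constructor 4; split=> //=; lra.
Qed.

Lemma fan_region_avoid n i j k q : (1 < n)%N -> (k < n)%N -> fan_region n i j q -> q <> fan_pos n k.
Proof.
move=> n2 kn R qE; move: R; rewrite {}qE /fan_pos.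
have [kl|kg] := ltnP k (n - 2).
  have k0 : (0 : RR) < k.+1%:R by rewrite ltr0Sn.
  case=> -[] /=; try lra.
  by move=> _ _; rewrite !ltr_nat; lia.
by case: eqP => _ [] [] /=; lra.
Qed.

Lemma fan_region_inj n i j i' j' q : (1 < n)%N ->
  fan_region n i j q -> fan_region n i' j' q -> i = i' /\ j = j'.
Proof.
move=> n2.
have S0 k : (0 : RR) < k.+1%:R by rewrite ltr0Sn.
have inj a b (r : RR) : r != 0 -> a.+1%:R * r = b.+1%:R * r -> a = b.
  by move=> r0 /(mulIf r0)/eqP; rewrite eqr_nat eqSS => /eqP.
case=> -[] => [jE q2 q1|jE q2 q1|jE q2 q1|iE jE q1 q2];
  case=> -[] => [jE' q2' q1'|jE' q2' q1'|jE' q2' q1'|iE' jE' q1' q2']; try (exfalso; clear -q2 q1 q2' q1'; lra).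
- have : (i.+1 < i'.+2)%N by rewrite -(ltr_nat RR); clear -q1 q1'; lra.
  have : (i'.+1 < i.+2)%N by rewrite -(ltr_nat RR); clear -q1 q1'; lra.
  by clear -jE jE'; lia.
- by exfalso; have := S0 i; clear -q1 q1'; lra.
- split; last by rewrite jE jE'.
  by apply: (inj _ _ (1 - q.2)); [rewrite gt_eqF // subr_gt0; case/andP: q2 | rewrite -q1].
- by exfalso; have : 0 < i.+1%:R * (1 - q.2); [rewrite mulr_gt0 // subr_gt0; case/andP: q2 | clear -q1 q1'; lra].
- split; last by rewrite jE jE'.
  by apply: (inj _ _ (1 + q.2)); [rewrite gt_eqF //; clear -q2; lra | rewrite -q1].
- by exfalso; have : 0 < i.+1%:R * (1 + q.2); [rewrite mulr_gt0 //; clear -q2; lra | clear -q1 q1'; lra].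
- by exfalso; have := S0 i'; clear -q1 q1'; lra.
- by exfalso; have : 0 < i'.+1%:R * (1 - q.2); [rewrite mulr_gt0 // subr_gt0; case/andP: q2' | clear -q1 q1'; lra].
- by exfalso; have : 0 < i'.+1%:R * (1 + q.2); [rewrite mulr_gt0 //; clear -q2'; lra | clear -q1 q1'; lra].
- by rewrite iE iE' jE jE'.
Qed.

Lemma fan_subgraph_planar (n : nat) (e : rel 'I_n) (f : 'I_n -> 'I_n) : (1 < n)%N ->
  injective f -> (forall x y, e x y -> fan_edge n (f x) (f y) || fan_edge n (f y) (f x)) ->
  planar e.
Proof.
move=> n2 finj fe.
exists (fun x => fan_pos n (f x)), (fun x y => segment_pt (fan_pos n (f x)) (fan_pos n (f y))).
have pinj : injective (fun x => fan_pos n (f x)).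
  by move=> x y /(fan_pos_inj _ _ _ (ltn_ord _) (ltn_ord _))/val_inj/finj.
have region x y s : e x y -> 0 < s < 1 -> exists i j : nat,
    fan_region n i j (segment_pt (fan_pos n (f x)) (fan_pos n (f y)) s) /\
    ((i, j) = (f x : nat, f y : nat) \/ (i, j) = (f y : nat, f x : nat)).
  move=> /fe /orP[E|E] s01.
    by exists (f x), (f y); split; [apply: fan_regionP | left].
  exists (f y), (f x); split; [rewrite segment_pt_rev; apply: fan_regionP => //; lra | by right].
split=> //; split.
  move=> x y xy exy; split.
    by apply: continuous_subspaceT; apply: segment_pt_continuous.
  split.
    move=> s t _ _; apply: segment_pt_inj => /pinj E.
    by move: xy; rewrite E ltnn.
  rewrite /segment_pt !subr0 !subrr !mul1r !mul0r !addr0 !add0r.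
  by rewrite -!surjective_pairing.
split.
  move=> x y z s xy exy s01; have [i [j [R _]]] := region x y s exy s01.
  exact: fan_region_avoid R.
move=> x y u v s s' xy exy uv euv ne s01 s01' E.
have [i [j [R ij]]] := region x y s exy s01; have [i' [j' [R' ij']]] := region u v s' euv s01'.
rewrite -E in R'; have [ii jj] := fan_region_inj n i j i' j' _ n2 R R'.
have val_f a b : (f a : nat) = f b -> a = b by move=> /val_inj /finj.
apply: ne; move: ij ij'; rewrite -ii -jj.
case=> -[-> ->] [] [/val_f e1 /val_f e2]; rewrite ?e1 ?e2 //.
- by move: xy uv; rewrite e1 e2 => h1 h2; have := ltn_trans h1 h2; rewrite ltnn.
- by move: xy uv; rewrite e1 e2 => h1 h2; have := ltn_trans h1 h2; rewrite ltnn.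
Qed.

(** * Two dominating vertices *)

Definition nbhd {T : finType} (e : rel T) (a : T) : {set T} := [set b | e a b].

Definition K33_free {T : finType} (e : rel T) : Prop :=
  forall a b c, a != b -> a != c -> b != c -> (#|nbhd e a :&: nbhd e b :&: nbhd e c| <= 2)%N.

(** Count ordered triples of distinct elements of L adjacent to w. With two of its neighbours in L
    held fixed, w has at least as many triples as its excess, and each of the at most |L|^3 triples
    has at most two common neighbours. *)
Lemma K33_free_excess {T : finType} (e : rel T) (L : {set T}) :
  symmetric e -> K33_free e -> (\sum_w (#|nbhd e w :&: L| - 2) <= 2 * #|L| ^ 3)%N.
Proof.
move=> sym K.
pose D := [set t : T * T * T | [&& t.1.1 \in L, t.1.2 \in L, t.2 \in L,
   t.1.1 != t.1.2, t.1.1 != t.2 & t.1.2 != t.2]].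
pose R w (t : T * T * T) := [&& e w t.1.1, e w t.1.2 & e w t.2].
have per w : (#|nbhd e w :&: L| - 2 <= \sum_(t in D) R w t)%N.
  have -> : (\sum_(t in D) R w t)%N = #|[set t in D | R w t]|.
    by rewrite -big_mkcondr /= sum1dep_card.
  have [|S3] := leqP #|nbhd e w :&: L| 2; first by rewrite -subn_eq0 => /eqP ->.
  have /card_gt1P[a [b [aS bS ab]]] := ltnW S3.
  have finj : injective (fun c : T => (a, b, c)) by move=> c d [].
  have sub : [set (a, b, c) | c in (nbhd e w :&: L) :\ a :\ b] \subset [set t in D | R w t].
    apply/subsetP => _ /imsetP[c + ->]; move: aS bS; rewrite /R !inE /= => /andP[-> ->] /andP[-> ->].
    by rewrite ab (eq_sym a) (eq_sym b) => /and3P[-> -> /andP[-> ->]].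
  have := subset_leq_card sub; rewrite card_imset //.
  have := cardsD1 a (nbhd e w :&: L); have := cardsD1 b ((nbhd e w :&: L) :\ a).
  by rewrite !in_setD1 aS bS (eq_sym b) ab /=; lia.
apply: (@leq_trans (\sum_w \sum_(t in D) R w t)%N); first by apply: leq_sum => w _; apply: per.
rewrite exchange_big /=.
have -> : (2 * #|L| ^ 3 = \sum_(t in setX (setX L L) L) 2)%N.
  by rewrite sum_nat_const !cardsX mulnC !expnS expn0 muln1 mulnA.
have DL : D \subset setX (setX L L) L.
  by apply/subsetP => -[[a b] c]; rewrite !inE /= => /and4P[-> -> -> _].
rewrite [leqRHS](big_setID D) /= (setIidPr DL).
apply: leq_trans (leq_addr _ _); apply: leq_sum => -[[a b] c]; rewrite inE /= => /and5P[_ _ _ ab /andP[ac bc]].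
rewrite -big_mkcond /= sum1dep_card; apply: leq_trans (K a b c ab ac bc).
apply: subset_leq_card; apply/subsetP => w; rewrite !inE /R /=.
by rewrite (sym w a) (sym w b) (sym w c) => /and3P[-> -> ->].
Qed.

Section PerronStructure.
Variables (n : nat) (e : rel 'I_n) (x : 'I_n -> RR) (lam : RR) (u : 'I_n).
Hypotheses (sym : symmetric e) (K33 : K33_free e)
  (sparse : forall A : {set 'I_n}, (deg_sum e A <= 6 * #|A|)%N)
  (x0 : forall i, 0 <= x i) (x1 : forall i, x i <= 1) (xu : x u = 1)
  (eigen : forall i, adj_sum n e x i = lam * x i)
  (lam_big : 2 * (n%:R - 2) <= lam ^+ 2) (n_big : 44 * 10 ^+ 15 <= (n%:R : RR)).

Let N := nbhd e.
Let big_set (eps : RR) : {set 'I_n} := [set z | eps <= x z].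

Lemma perron_lam_ge : 29 * 10 ^+ 7 <= lam.
Proof.
have nb := n_big; have lb := lam_big.
have l0 : 0 <= lam.
  have := eigen u; rewrite xu mulr1 => <-; exact: sumr_ge0.
have : (29 * 10 ^+ 7) ^+ 2 <= lam ^+ 2 by apply: le_trans lam_big; lra.
by rewrite ler_sqr // nnegrE; lra.
Qed.

Lemma sum_nbhd_card (A : {set 'I_n}) : (\sum_(w in A) #|N w| <= 6 * n)%N.
Proof.
have nb := n_big; have lb := lam_big.
apply: (@leq_trans (deg_sum e setT)); last by have := sparse setT; rewrite cardsT card_ord.
rewrite /deg_sum [leqRHS](big_setID A) setTI /= -[leqLHS]addn0; apply: leq_add => //.
by apply: leq_sum => a _; rewrite leq_eqVlt; apply/orP; left; apply/eqP/eq_card => b; rewrite !inE.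
Qed.

(** As all entries are at most 1, an entry at least eps requires degree at least lam eps, and the
    degrees sum up to at most 6n. *)
Lemma card_big_set eps : 0 < eps -> #|big_set eps|%:R * (lam * eps) <= 6 * n%:R.
Proof.
have nb := n_big; have lb := lam_big.
move=> eps0; have l0 : 0 < lam by apply: lt_le_trans perron_lam_ge; lra.
apply: (@le_trans _ _ (\sum_(w in big_set eps) lam * x w)).
  rewrite mulr_natl -sumr_const; apply: ler_sum => w; rewrite inE => h.
  by rewrite ler_pM2l.
apply: (@le_trans _ _ (\sum_(w in big_set eps) #|N w|%:R)).
  apply: ler_sum => w _; rewrite -eigen /adj_sum.
  apply: (@le_trans _ _ (\sum_(j | e w j) 1)); first by apply: ler_sum.
  by rewrite sumr_const; rewrite ler_nat leq_eqVlt; apply/orP; left;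
     apply/eqP/eq_card => b; rewrite !inE.
by rewrite -natr_sum -natrM ler_nat sum_nbhd_card.
Qed.

Let big_sum eps w := \sum_(z | e w z && (eps <= x z)) x z.

Lemma big_sum_le_card eps w : big_sum eps w <= #|N w :&: big_set eps|%:R.
Proof.
have nb := n_big; have lb := lam_big.
apply: (@le_trans _ _ (\sum_(z | e w z && (eps <= x z)) 1)); first by apply: ler_sum.
by rewrite sumr_const; rewrite ler_nat leq_eqVlt; apply/orP; left;
     apply/eqP/eq_card => b; rewrite !inE.
Qed.

(** The eigenvalue equation applied twice; entries below eps contribute at most eps times the sum of
    all degrees. *)
Lemma two_step eps z0 : 0 <= eps ->
  lam ^+ 2 * x z0 <= \sum_(w in N z0) big_sum eps w + 6 * eps * n%:R.
Proof.
have nb := n_big; have lb := lam_big.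
move=> eps0; rewrite expr2 -mulrA -eigen /adj_sum mulr_sumr.
have -> : \sum_(j | e z0 j) lam * x j = \sum_(w in N z0) adj_sum n e x w.
  by apply: eq_big => [j|j _]; rewrite ?inE // eigen.
apply: (@le_trans _ _ (\sum_(w in N z0) (big_sum eps w + eps * #|N w|%:R))).
  apply: ler_sum => w _; rewrite /adj_sum (bigID (fun z => eps <= x z)) /= lerD2l.
  apply: (@le_trans _ _ (\sum_(z | e w z && ~~ (eps <= x z)) eps)).
    by apply: ler_sum => z /andP[_]; rewrite -ltNge => /ltW.
  rewrite sumr_const -[leLHS]mulr_natr; apply: ler_wpM2l => //; rewrite ler_nat.
  by apply: subset_leq_card; apply/subsetP => z; rewrite unfold_in inE => /andP[].
rewrite big_split /= lerD2l -mulr_sumr -natr_sum.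
rewrite [leRHS](_ : _ = eps * (6 * n)%:R); last by rewrite natrM; ring.
by apply: ler_wpM2l => //; rewrite ler_nat sum_nbhd_card.
Qed.

(** Sparsity is applied to the union of [N z0] and [L], inside which all these edges lie. *)
Lemma sum_card_nbhdI (z0 : 'I_n) (L : {set 'I_n}) :
  (\sum_(w in N z0) #|N w :&: L| <= 6 * (#|N z0| + #|L|))%N.
Proof.
have nb := n_big; have lb := lam_big.
apply: (@leq_trans (deg_sum e (N z0 :|: L))).
  rewrite /deg_sum [leqRHS](big_setID (N z0)) /= (setIidPr (subsetUl _ _)).
  apply: leq_trans (leq_addr _ _); apply: leq_sum => w _; apply: subset_leq_card.
  by apply/subsetP => z; rewrite !inE => /andP[-> ->]; rewrite orbT.
by apply: (leq_trans (sparse _)); rewrite leq_mul2l /=; apply: leq_card_setU.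
Qed.

(** [two_step] with the threshold 2/10^4. Of lam^2 x z, at least 4/10^3 (n - 2), the small entries
    account for 12/10^4 n and the size of the big set for about 6/10^4 n; six times the degree must
    cover the rest. *)
Lemma heavy_degree z : 2 / 10 ^+ 3 <= x z -> 36 / 10 ^+ 5 * n%:R <= (#|N z|%:R : RR).
Proof.
have nb := n_big; have lb := lam_big.
move=> xz.
have eps0 : (0 : RR) < 2 / 10 ^+ 4 by lra.
have L0 := card_big_set _ eps0; have lam0 := perron_lam_ge.
have := two_step (2 / 10 ^+ 4) z (ltW eps0).
have : \sum_(w in N z) big_sum (2 / 10 ^+ 4) w <= (6 * (#|N z| + #|big_set (2 / 10 ^+ 4)|))%:R.
  apply: (@le_trans _ _ (\sum_(w in N z) #|N w :&: big_set (2 / 10 ^+ 4)|)%:R).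
    by rewrite natr_sum; apply: ler_sum => w _; apply: big_sum_le_card.
  by rewrite ler_nat sum_card_nbhdI.
rewrite natrM natrD; set d : RR := #|N z|%:R; set l : RR := #|big_set _|%:R in L0 *.
have l0 : 0 <= l by exact: ler0n.
have L1 : l * (58 * 10 ^+ 3) <= 6 * n%:R.
  apply: le_trans L0; apply: ler_wpM2l => //; lra.
have : 2 * (n%:R - 2) * (2 / 10 ^+ 3) <= lam ^+ 2 * x z.
  apply: (@le_trans _ _ (lam ^+ 2 * (2 / 10 ^+ 3))).
    by apply: ler_wpM2r => //; lra.
  by apply: ler_wpM2l => //; apply: sqr_ge0.
by move=> h1 h2 h3; lra.
Qed.

Let L1 := big_set (2 / 10 ^+ 3).

(** Degrees linear in n leave room for boundedly many heavy vertices. A bound free of n is what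
    makes the cubic [excess] negligible. *)
Lemma card_heavy : (#|L1|%:R : RR) <= 2 * 10 ^+ 4.
Proof.
have nb := n_big; have lb := lam_big.
have : #|L1|%:R * (36 / 10 ^+ 5 * n%:R) <= (6 * n%:R : RR).
  rewrite mulr_natl -sumr_const; apply: (@le_trans _ _ (\sum_(z in L1) #|N z|%:R)).
    by apply: ler_sum => z; rewrite inE => /heavy_degree.
  by rewrite -natr_sum -natrM ler_nat sum_nbhd_card.
have n0 : (0 : RR) < n%:R by apply: lt_le_trans n_big; lra.
rewrite mulrA ler_pM2r // => h; lra.
Qed.

Let excess : nat := \sum_w (#|N w :&: L1| - 2).

(** Here the size of n is spent: 2 (2 10^4)^3 = 16 10^12, while 37/10^5 of 44 10^15 is 16.28
    10^12. *)
Lemma excess_le : (excess%:R : RR) <= 37 / 10 ^+ 5 * n%:R.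
Proof.
have nb := n_big; have lb := lam_big.
have h1 : (excess%:R : RR) <= (2 * #|L1| ^ 3)%:R by rewrite ler_nat; apply: K33_free_excess.
rewrite natrM natrX in h1; have h2 := card_heavy.
have h3 : (#|L1|%:R ^+ 3 : RR) <= (2 * 10 ^+ 4) ^+ 3.
  by apply: lerXn2r h2; rewrite nnegrE //; lra.
lra.
Qed.

(** [two_step] with the threshold 2/10^3. Among the heavy neighbours of w, z0 counts at most 1, one
    other at most c, and further ones go to [excess]. The constant is 12/10^3 for the small entries
    plus 37/10^5. *)
Lemma two_step_heavy z0 c : 0 <= c <= 1 -> (forall z, z != z0 -> x z <= c) ->
  lam ^+ 2 * x z0 <= (1 + c) * #|N z0|%:R + 1237 / 10 ^+ 5 * n%:R.
Proof.
have nb := n_big; have lb := lam_big.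
move=> /andP[c0 c1] xc; have ex := excess_le.
have := two_step (2 / 10 ^+ 3) z0 ltac:(lra).
have sumle : \sum_(w in N z0) big_sum (2 / 10 ^+ 3) w <=
    \sum_(w in N z0) ((1 + c) + (#|N w :&: L1| - 2)%:R).
  apply: ler_sum => w _.
  have le1 : big_sum (2 / 10 ^+ 3) w <= \sum_(z in N w :&: L1) (c + (1 - c) * (z == z0)%:R).
    rewrite /big_sum [leLHS](eq_bigl (mem (N w :&: L1))) => [|z]; last by rewrite !inE.
    apply: ler_sum => z _; have [->|/xc] := eqVneq z z0; last by rewrite mulr0 addr0.
    by have := x1 z0; rewrite /= mulr1n; lra.
  apply: (le_trans le1); rewrite big_split /= sumr_const -mulr_sumr.
  have one : \sum_(z in N w :&: L1) ((z == z0)%:R : RR) <= 1.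
    apply: (@le_trans _ _ (\sum_z ((z == z0)%:R : RR))).
      by rewrite [leLHS]big_mkcond /=; apply: ler_sum => z _; case: ifP.
    by rewrite (bigD1 z0) //= eqxx big1 ?addr0 // => z /negbTE ->.
  have c1' : 0 <= 1 - c by lra.
  have := ler_wpM2l c1' one; rewrite mulr1 => h.
  rewrite -(mulr_natr c); case: (#|N w :&: L1|) => [|[|k]]; rewrite ?subSS ?subn0 ?sub0n ?mulr0 ?mulr1.
  - by lra.
  - by lra.
  - have k0 : (0 : RR) <= k%:R by exact: ler0n.
    have := ler_wpM2r k0 c1; rewrite -!natr1 !mulrDr !mulr1 mul1r; lra.
rewrite big_split /= sumr_const -natr_sum -(mulr_natr (1 + c)) in sumle.
have : ((\sum_(w in N z0) (#|N w :&: L1| - 2))%:R : RR) <= excess%:R.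
  by rewrite ler_nat /excess [leqRHS](bigID (mem (N z0))) /= leq_addr.
by move=> h1 h2; lra.
Qed.

(** The case c = 1 of [two_step_heavy], halved. *)
Lemma degree_ge z : x z * (n%:R - 2) - 62 / 10 ^+ 4 * n%:R <= #|N z|%:R.
Proof.
have nb := n_big; have lb := lam_big.
have := two_step_heavy z 1 ltac:(lra) (fun y _ => x1 y).
have := ler_wpM2r (x0 z) lam_big; lra.
Qed.

(** If all other entries were below 95/100, then 2 (n - 2) <= 1.95 n + 1237/10^5 n, which is false.
    The degrees of u and v are then so large that they share 93/100 of the vertices; a third entry
    above 1/10 would have degree above 9/100 n and give three vertices with more than two common
    neighbours. *)
Lemma perron_two_heads :
  exists v, [/\ v != u, 95 / 100 <= x v,
    forall z, z != u -> z != v -> x z <= 1 / 10 &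
    93 / 100 * n%:R <= (#|N u :&: N v|%:R : RR)].
Proof.
have nb := n_big; have lb := lam_big.
have [v vu xv] : exists2 v, v != u & 95 / 100 <= x v.
  apply: contrapT => H.
  have xc z : z != u -> x z <= 95 / 100.
    by move=> zu; rewrite leNgt; apply/negP => /ltW xz; apply: H; exists z.
  have := two_step_heavy u (95 / 100) ltac:(lra) xc; rewrite xu mulr1 => h.
  have : (#|N u|%:R : RR) <= n%:R by rewrite ler_nat -[leqRHS]card_ord max_card.
  by lra.
have du := degree_ge u; rewrite xu mul1r in du.
have dv : 943 / 10 ^+ 3 * n%:R <= (#|N v|%:R : RR).
  apply: le_trans (degree_ge v).
  have : 95 / 100 * (n%:R - 2) <= x v * (n%:R - 2) by apply: ler_wpM2r => //; lra.
  by lra.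
have cardU (A B : {set 'I_n}) : (#|A|%:R + #|B|%:R : RR) <= n%:R + #|A :&: B|%:R.
  rewrite -!natrD ler_nat -cardsUI leq_add2r -[leqRHS]card_ord; exact: max_card.
have uv := cardU (N u) (N v).
exists v; split=> //; last by lra.
move=> z zu zv; rewrite leNgt; apply/negP => xz.
have dz : 937 / 10 ^+ 4 * n%:R <= (#|N z|%:R : RR).
  apply: le_trans (degree_ge z).
  have : 1 / 10 * (n%:R - 2) <= x z * (n%:R - 2) by apply: ler_wpM2r; [lra | exact: ltW].
  by lra.
have uvz := cardU (N u :&: N v) (N z).
have := K33 u v z; rewrite (eq_sym u v) (eq_sym u z) (eq_sym v z) => /(_ vu zu zv).
rewrite -(ler_nat RR) -/N => h; lra.
Qed.
End PerronStructure.

(** * Linear forests *)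

Definition consecutive (x y : nat) : bool := (x.+1 == y) || (y.+1 == x).

Lemma block_starts_cons k s :
  block_starts (k :: s) = 0%N :: [seq (k + z)%N | z <- block_starts s].
Proof.
rewrite /block_starts /= big_ord0; congr (_ :: _).
rewrite -map_comp -[1%N]addn0 iotaDl -map_comp; apply: eq_map => j /=.
by rewrite add1n big_ord_recl.
Qed.

Lemma paths_adj_nil x y : paths_adj [::] x y = false.
Proof. by rewrite /paths_adj /= andbF. Qed.

(** Recursion on the first block, used from here on in place of the list of block starts. It also
    holds for blocks of size 0, which the exchanges may create. *)
Lemma paths_adj_cons k s x y : paths_adj (k :: s) x y =
  if (x < k)%N && (y < k)%N then consecutive x y
  else [&& (k <= x)%N, (k <= y)%N & paths_adj s (x - k) (y - k)].
Proof.
rewrite /paths_adj -/(consecutive x y) -/(consecutive (x - k) (y - k)) block_starts_cons /= inE negb_or.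
have notin z : (z < k)%N -> z \notin [seq (k + i)%N | i <- block_starts s].
  by move=> zk; apply/mapP => -[i _ zi]; lia.
have inE' z : (k <= z)%N -> (z \in [seq (k + i)%N | i <- block_starts s]) = ((z - k)%N \in block_starts s).
  move=> kz; apply/mapP/idP => [[i iS ->]|zS]; first by rewrite addKn.
  by exists (z - k)%N => //; lia.
have start0 : s != [::] -> 0%N \in block_starts s.
  by case: s {notin inE'} => // a s _; rewrite block_starts_cons inE eqxx.
have [C|nC] := boolP (consecutive x y); last first.
  rewrite /=; case: ifP => // _; apply/esym/negbTE; apply/negP => /and3P[kx ky /andP[c _]].
  by move: nC c; rewrite /consecutive; lia.
have M0 : (maxn x y != 0)%N by move: C; rewrite /consecutive; lia.
rewrite M0 /=; case: ifP => [/andP[xk yk]|xyk].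
  by rewrite notin ?andbT; [lia | rewrite gtn_max xk yk].
have [kx|xk] := leqP k x; have [ky|yk] := leqP k y => /=.
- have -> : consecutive (x - k) (y - k) by move: C; rewrite /consecutive; lia.
  have -> : maxn (x - k) (y - k) = (maxn x y - k)%N by lia.
  by rewrite inE' ?leq_max ?kx // /=; congr (_ && _); lia.
- have -> : maxn x y = k by move: C; rewrite /consecutive; lia.
  apply/negbTE; rewrite negb_and -leqNgt negbK inE' // subnn.
  have [->|/start0 ->] := eqVneq s [::]; first by rewrite /= addn0 leqnn.
  by rewrite orbT.
- have -> : maxn x y = k by move: C; rewrite /consecutive; lia.
  apply/negbTE; rewrite negb_and -leqNgt negbK inE' // subnn.
  have [->|/start0 ->] := eqVneq s [::]; first by rewrite /= addn0 leqnn.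
  by rewrite orbT.
- by move: xyk; rewrite xk yk.
Qed.

Lemma paths_adj_sym s x y : paths_adj s x y = paths_adj s y x.
Proof. by rewrite /paths_adj orbC maxnC. Qed.

Lemma paths_adj_consecutive s x y : paths_adj s x y -> consecutive x y.
Proof. by case/andP. Qed.

Lemma paths_adj_lt s x y : paths_adj s x y -> (x < sumn s)%N && (y < sumn s)%N.
Proof. by case/and3P => _; rewrite gtn_max. Qed.

Section LinearForest.
Variables (T : finType) (h : rel T).
Hypotheses (sym : symmetric h) (irr : irreflexive h) (deg2 : forall a, (#|[set b | h a b]| <= 2)%N).

Lemma unextendable_path (R : {set T}) a : a \in R ->
  exists x p, [/\ path h x p, uniq (x :: p), {subset x :: p <= R} &
    forall y, y \in R -> y \notin x :: p -> ~~ h y x && ~~ h (last x p) y].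
Proof.
move=> aR; apply: contrapT => H.
suff long k : exists x p, [/\ path h x p, uniq (x :: p), {subset x :: p <= R} & size p = k].
  have [x [p [_ U _ sp]]] := long #|T|.
  by have := card_uniqP U; have := max_card (mem (x :: p)) => le1 E; move: le1; rewrite E /= sp ltnn.
elim: k => [|k [x [p [hp U pR sp]]]].
  by exists a, [::]; split=> // b; rewrite inE => /eqP ->.
apply: contrapT => H'; apply: H; exists x, p; split=> // y yR yp.
apply/andP; split; apply/negP => hy; apply: H'.
  exists y, (x :: p); split; rewrite /= ?hy ?hp ?sp //; first by rewrite -[_ && _]/(uniq (y :: x :: p)) cons_uniq yp.
  by move=> b; rewrite in_cons => /orP[/eqP ->|/pR].
exists x, (rcons p y); split; rewrite ?rcons_path ?hp ?hy ?size_rcons ?sp //.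
  by rewrite -rcons_cons rcons_uniq yp.
by move=> b; rewrite -rcons_cons mem_rcons in_cons => /orP[/eqP ->|/pR].
Qed.

Lemma path_index (x : T) p i : path h x p -> (i < size p)%N ->
  h (nth x (x :: p) i) (nth x (x :: p) i.+1).
Proof. by move=> /(pathP x) H ip; apply: H. Qed.

(** An inner vertex of the path already has its two neighbours on it, an end has none off the path,
    and the two ends are not joined to each other by acyclicity. So the path is a whole component
    without chords. *)
Lemma unextendable_component (R : {set T}) x p a b :
  (forall a b, h a b -> b \in R) ->
  path h x p -> uniq (x :: p) -> (2 < size (x :: p) -> ~~ h (last x p) x)%N ->
  (forall y, y \in R -> y \notin x :: p -> ~~ h y x && ~~ h (last x p) y) ->
  a \in x :: p -> h a b -> b \in x :: p /\ consecutive (index a (x :: p)) (index b (x :: p)).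
Proof.
move=> hR hp U acyclic ext ap hab.
set s := x :: p in U ap *.
have inner a' b' : a' \in s -> (0 < index a' s)%N -> (index a' s < size p)%N -> h a' b' ->
    b' \in s /\ consecutive (index a' s) (index b' s).
  move=> a's i0 ip hab'; set i := index a' s in i0 ip *.
  have a'E : a' = nth x s i by rewrite nth_index.
  have h1 : h a' (nth x s i.-1).
    by rewrite a'E sym -{2}(prednK i0); apply: path_index => //; lia.
  have h2 : h a' (nth x s i.+1) by rewrite a'E; apply: path_index.
  have ne : nth x s i.-1 != nth x s i.+1 by rewrite nth_uniq //= ?ltnS; clear - i0 ip; lia.
  have sub : [set nth x s i.-1; nth x s i.+1] \subset [set c | h a' c].
    by apply/subsetP => c; rewrite !inE => /orP[] /eqP ->.
  have E : [set nth x s i.-1; nth x s i.+1] = [set c | h a' c].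
    by apply/eqP; rewrite eqEcard sub cards2 ne deg2.
  have : b' \in [set c | h a' c] by rewrite inE.
  have [im ip1] : (i.-1 < size s)%N /\ (i.+1 < size s)%N by split; rewrite /s /=; clear - i0 ip; lia.
  rewrite -E in_set2 => /orP[] /eqP ->; rewrite index_uniq // mem_nth // /consecutive; split=> //; clear - i0; lia.
have bs : b \in s.
  have [i0|i0] := posnP (index a s).
    have ax : a = x by rewrite -(nth_index x ap) i0.
    by apply: contraT => /(ext _ (hR _ _ hab)); rewrite -ax (sym b) hab.
  have [ip|pi] := ltnP (index a s) (size p); first by have [] := inner a b ap i0 ip hab.
  have al : a = last x p.
    have : (index a s <= size p)%N by rewrite -ltnS -[(size p).+1]/(size s) index_mem.
    move=> le; have E : index a s = size p by lia.
    by rewrite -(nth_index x ap) E -[size p]/((size s).-1) nth_last.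
  by apply: contraT => /(ext _ (hR _ _ hab)); rewrite -al hab andbF.
split=> //.
have [i0|i0] := posnP (index a s); last first.
  have [ip|pi] := ltnP (index a s) (size p); first by have [] := inner a b ap i0 ip hab.
  have le : (index a s <= size p)%N by rewrite -ltnS -[(size p).+1]/(size s) index_mem.
  have [j0|j0] := posnP (index b s); last first.
    have [jp|pj] := ltnP (index b s) (size p).
      by have [] := inner b a bs j0 jp; rewrite 1?sym // /consecutive orbC.
    have le' : (index b s <= size p)%N by rewrite -ltnS -[(size p).+1]/(size s) index_mem.
    have E : index a s = index b s by lia.
    by move: hab; rewrite -(nth_index x ap) E nth_index // irr.
  have bx : b = x by rewrite -(nth_index x bs) j0.
  have E : index a s = size p by lia.
  have al : a = last x p by rewrite -(nth_index x ap) E -[size p]/((size s).-1) nth_last.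
  move: acyclic; rewrite -/s -al -bx hab j0 E /consecutive /= => H.
  by have : ~~ (2 < (size p).+1)%N; [apply/negP => /H | lia].
have ax : a = x by rewrite -(nth_index x ap) i0.
have [j0|j0] := posnP (index b s).
  by move: hab; rewrite -(nth_index x ap) i0 -j0 nth_index // irr.
have [jp|pj] := ltnP (index b s) (size p).
  by have [] := inner b a bs j0 jp; rewrite 1?sym // /consecutive orbC.
have le : (index b s <= size p)%N by rewrite -ltnS -[(size p).+1]/(size s) index_mem.
have E : index b s = size p by lia.
have bl : b = last x p by rewrite -(nth_index x bs) E -[size p]/((size s).-1) nth_last.
move: acyclic; rewrite -/s -bl -ax (sym b) hab i0 E /consecutive /= => H.
by have : ~~ (2 < (size p).+1)%N; [apply/negP => /H | lia].
Qed.
End LinearForest.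

Lemma linear_forest_blocks (T : finType) (h : rel T) (R : {set T}) :
  symmetric h -> irreflexive h -> (forall a, (#|[set b | h a b]| <= 2)%N) ->
  (forall a b, h a b -> b \in R) ->
  (forall x p, path h x p -> uniq (x :: p) -> (2 < size (x :: p))%N -> ~~ h (last x p) x) ->
  exists bs : seq (seq T), [/\ uniq (flatten bs), forall a, (a \in flatten bs) = (a \in R),
    all (fun b => b != [::]) bs &
    forall a b, a \in R -> b \in R ->
      h a b = paths_adj (map size bs) (index a (flatten bs)) (index b (flatten bs))].
Proof.
have [m] := ubnP #|R|; elim: m => // m IH in h R * => Rm sym irr deg2 hR acyclic.
have [R0|/set0Pn[a aR]] := eqVneq R set0.
  by exists [::]; split=> // a; rewrite R0 !inE.
have [x [p [hp U pR ext]]] := unextendable_path _ h R a aR.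
have [s sE] : exists s, s = x :: p by exists (x :: p).
have comp a' b' : a' \in s -> h a' b' -> b' \in s /\ consecutive (index a' s) (index b' s).
  by rewrite sE => a's hab; apply: (unextendable_component _ _ sym irr deg2 R x p a' b' hR hp U (acyclic x p hp U) ext a's hab).
rewrite -sE in U pR ext.
pose R' := R :\: [set z in s].
pose h' := fun a b => [&& h a b, a \notin s & b \notin s].
have [bs [Ubs memb nonnil adj]] : exists bs : seq (seq T), [/\ uniq (flatten bs), forall a, (a \in flatten bs) = (a \in R'),
    all (fun b => b != [::]) bs &
    forall a b, a \in R' -> b \in R' ->
      h' a b = paths_adj (map size bs) (index a (flatten bs)) (index b (flatten bs))].
  apply: IH.
  - apply: leq_trans (_ : #|R| <= m)%N; last by [].
    apply: proper_card; apply/properP; split; first exact: subsetDl.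
    by exists x; [apply: pR | rewrite in_setD in_set]; rewrite sE mem_head.
  - by move=> b c; rewrite /h' sym [X in _ && X]andbC.
  - by move=> b; rewrite /h' irr.
  - move=> b; apply: leq_trans (deg2 b); apply: subset_leq_card.
    by apply/subsetP => c; rewrite !inE => /and3P[].
  - by move=> b c /and3P[hbc _ cs]; rewrite in_setD inE (negbTE cs) (hR _ _ hbc).
  - move=> y q hq Uq sq; rewrite /h' negb_and (acyclic y q) //.
    by apply: (sub_path _ hq) => b c /and3P[].
have memR c : (c \in R) = (c \in s) || (c \in R').
  by rewrite in_setD in_set; have [/pR ->|] := boolP (c \in s).
have indexR' c : c \in R' -> index c (s ++ flatten bs) = (size s + index c (flatten bs))%N.
  by rewrite in_setD in_set index_cat => /andP[/negbTE ->].
have indexs c : c \in s -> index c (s ++ flatten bs) = index c s by rewrite index_cat => ->.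
have indexlt c : c \in s -> (index c s < size s)%N by rewrite index_mem.
have sR' c : c \in s -> c \in R' -> False by rewrite in_setD in_set => ->.
exists (s :: bs); split.
- rewrite -[flatten _]/(s ++ flatten bs) cat_uniq U Ubs andbT andTb; apply/hasPn => c; rewrite memb => cR'.
  by apply/negP => cs; apply: sR' cs cR'.
- by move=> c; rewrite -[flatten _]/(s ++ flatten bs) mem_cat memb memR.
- by rewrite /= nonnil sE.
move=> b c; rewrite !memR -[flatten _]/(s ++ flatten bs) -[map _ _]/(size s :: map size bs) paths_adj_cons => /orP[bs'|bR'] /orP[cs'|cR'].
- rewrite !indexs // !indexlt //=; apply/idP/idP => [hbc|C]; first by have [] := comp b c bs' hbc.
  have bE := nth_index x bs'; have cE := nth_index x cs'.
  have hE i : (i.+1 < size s)%N -> h (nth x s i) (nth x s i.+1) by rewrite sE => ip; exact: (path_index _ _ _ _ _ hp ip).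
  case/orP: C => /eqP C.
    by have := hE (index b s); rewrite C bE cE indexlt //; apply.
  by have := hE (index c s); rewrite C bE cE indexlt // sym; apply.
- rewrite indexs // indexR' // indexlt //= ltnNge leq_addr /= leqNgt indexlt //=.
  by apply/negP => /(comp b c bs')[cs' _]; apply: sR' cs' cR'.
- rewrite indexR' // indexs // [(_ + _ < _)%N]ltnNge leq_addr /= [(size s <= index c s)%N]leqNgt indexlt //=.
  by rewrite sym; apply/negP => /(comp c b cs')[bs' _]; apply: sR' bs' bR'.
- rewrite !indexR' // !ltnNge !leq_addr /= !addKn -adj // /h'.
  by move: bR' cR'; rewrite !in_setD !in_set => /andP[-> _] /andP[-> _]; rewrite !andbT.
Qed.

(** * Joins of K2 with linear forests *)

(** [K2_join_HP n n1 n2] is convertible to [K2_join n (HP_blocks n n1 n2)]; arbitrary lists are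
    needed for the competitors. *)
Definition K2_join (n : nat) (s : seq nat) : rel 'I_n :=
  fun x y => (x != y) && [|| (n - 2 <= x)%N, (n - 2 <= y)%N | paths_adj s x y].

Lemma K2_join_simple n s : simple_graph (K2_join n s).
Proof.
split=> [x y|x]; last by rewrite /K2_join eqxx.
by rewrite /K2_join eq_sym paths_adj_sym orbCA.
Qed.

Lemma K2_join_fan n s (x y : 'I_n) : (sumn s <= n - 2)%N -> K2_join n s x y ->
  fan_edge n x y || fan_edge n y x.
Proof.
move=> sN /andP[xy H]; have xn := ltn_ord x; have yn := ltn_ord y.
have {}xy : (x : nat) <> y by move=> /val_inj E; rewrite E eqxx in xy.
case/or3P: H => [h|h|h]; rewrite /fan_edge ?xn ?yn; try lia.
have := paths_adj_consecutive _ _ _ h; have := paths_adj_lt _ _ _ h; rewrite /consecutive; lia.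
Qed.

Lemma isomorphic_sym n (e1 e2 : rel 'I_n) : isomorphic e1 e2 -> isomorphic e2 e1.
Proof.
move=> [f [[g fg gf] H]]; exists g; split; first by exists f.
by move=> a b; rewrite H !gf.
Qed.

Lemma isomorphic_trans n (e1 e2 e3 : rel 'I_n) :
  isomorphic e1 e2 -> isomorphic e2 e3 -> isomorphic e1 e3.
Proof.
move=> [f [bf H]] [f' [bf' H']]; exists (f' \o f); split; first exact: bij_comp.
by move=> a b; rewrite H H'.
Qed.

Lemma isomorphic_Ffree n k (eF : rel 'I_k) (e1 e2 : rel 'I_n) :
  isomorphic e1 e2 -> Ffree eF e2 -> Ffree eF e1.
Proof.
move=> [f [bf H]] F2 [g [gi gh]]; apply: F2; exists (f \o g); split.
  by apply: inj_comp => //; apply: bij_inj.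
by move=> a b /gh; rewrite H.
Qed.

Lemma isomorphic_planar n (e : rel 'I_n) s : (1 < n)%N -> (sumn s <= n - 2)%N ->
  isomorphic e (K2_join n s) -> planar e.
Proof.
move=> n1 sN [f [bf H]]; apply: (fan_subgraph_planar n e f n1 (bij_inj bf)) => x y.
by rewrite H; apply: K2_join_fan.
Qed.

Lemma spec_rad_le n (e1 e2 : rel 'I_n) (f : 'I_n -> 'I_n) : (0 < n)%N ->
  symmetric e1 -> symmetric e2 -> bijective f -> (forall a b, e1 a b -> e2 (f a) (f b)) ->
  spec_rad e1 <= spec_rad e2.
Proof.
move=> n0 sym1 sym2 bf hom.
have [x [x0 x1 xE _]] := spec_rad_perron n e1 sym1 n0.
have [_ [_ _ _ bound]] := spec_rad_perron n e2 sym2 n0.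
case: (bf) => g fg gf.
have <- : quad_form n e1 x = spec_rad e1.
  transitivity (\sum_i spec_rad e1 * x i ^+ 2); last by rewrite -mulr_sumr -[X in _ * X]/(sq_norm n x) x1 mulr1.
  by apply: eq_bigr => i _; rewrite xE; ring.
have := bound (x \o g).
have -> : sq_norm n (x \o g) = 1.
  rewrite -x1 /sq_norm (reindex f) /=; last exact: onW_bij.
  by apply: eq_bigr => i _; rewrite /= fg.
rewrite mulr1; apply: le_trans.
rewrite /quad_form [leRHS](reindex f) /=; last exact: onW_bij.
apply: ler_sum => i _; rewrite fg; apply: ler_wpM2l => //.
rewrite /adj_sum [leRHS](reindex f) /=; last exact: onW_bij.
rewrite [leLHS]big_mkcond [leRHS]big_mkcond; apply: ler_sum => j _; rewrite fg.
by case: ifP => [/hom ->//|_]; case: ifP.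
Qed.

Lemma isomorphic_spec_rad n (e1 e2 : rel 'I_n) : (0 < n)%N -> symmetric e1 -> symmetric e2 ->
  isomorphic e1 e2 -> spec_rad e1 = spec_rad e2.
Proof.
move=> n0 sym1 sym2 iso; have [g [bg H']] := isomorphic_sym _ _ _ iso.
case: iso => f [bf H]; apply/eqP; rewrite eq_le; apply/andP; split.
  by apply: (spec_rad_le _ _ _ f) => // a b; rewrite H.
by apply: (spec_rad_le _ _ _ g) => // a b; rewrite H'.
Qed.

Definition head_join {T : eqType} (u v : T) (h : rel T) : rel T :=
  fun a b => (a != b) && [|| a == u, a == v, b == u, b == v | h a b].

Lemma head_join_iso (n : nat) (u v : 'I_n) (h : rel 'I_n) (bs : seq (seq 'I_n)) :
  u != v -> uniq (flatten bs) -> (forall a, (a \in flatten bs) = (a != u) && (a != v)) ->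
  (forall a b, a \in flatten bs -> b \in flatten bs ->
     h a b = paths_adj (map size bs) (index a (flatten bs)) (index b (flatten bs))) ->
  sumn (map size bs) = (n - 2)%N /\ isomorphic (head_join u v h) (K2_join n (map size bs)).
Proof.
move=> uv U mem_bs adj; set s := map size bs; set l := flatten bs in U mem_bs adj.
have sl : size l = (n - 2)%N.
  have -> : size l = #|~: [set u; v]|.
    by rewrite -(card_uniqP U); apply: eq_card => a; rewrite mem_bs !inE negb_or.
  by rewrite cardsCs setCK cards2 uv card_ord.
have ss : sumn s = (n - 2)%N by rewrite /s -size_flatten.
have n2 : (1 < n)%N.
  by have := max_card (mem [set u; v]); rewrite cards2 uv card_ord.
pose pos a : nat := if a == u then (n - 2)%N else if a == v then (n - 1)%N else index a l.
have pos_bs a : a \in l -> pos a = index a l /\ (pos a < n - 2)%N.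
  by move=> al; move: (al); rewrite mem_bs /pos => /andP[/negbTE -> /negbTE ->]; rewrite -sl index_mem.
have posn a : (pos a < n)%N.
  rewrite /pos; case: eqP => _; first by lia.
  case: eqP => _; first by lia.
  by apply: leq_ltn_trans (index_size _ _) _; rewrite sl; lia.
pose f a : 'I_n := Ordinal (posn a).
have nl a : a \notin l -> a = u \/ a = v.
  by rewrite mem_bs negb_and !negbK => /orP[] /eqP; [left|right].
have posu : pos u = (n - 2)%N by rewrite /pos eqxx.
have posv : pos v = (n - 1)%N by rewrite /pos eqxx eq_sym (negbTE uv).
have big a' : a' \notin l -> (n - 2 <= pos a')%N by case/nl => ->; rewrite ?posu ?posv; lia.
have finj : injective f.
  move=> a b fab; have E : pos a = pos b := congr1 val fab.
  have [al|anl] := boolP (a \in l); have [bl|bnl] := boolP (b \in l).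
  - have [ea _] := pos_bs a al; have [eb _] := pos_bs b bl.
    have {}E : index a l = index b l by rewrite -ea -eb.
    by have := nth_index a al; rewrite E nth_index.
  - by exfalso; have [_ ha] := pos_bs a al; have := big b bnl; rewrite -E leqNgt ha.
  - by exfalso; have [_ hb] := pos_bs b bl; have := big a anl; rewrite E leqNgt hb.
  - move: E; case: (nl _ anl) => ->; case: (nl _ bnl) => -> //; rewrite posu posv; lia.
split=> //; exists f; split; first exact: injF_bij.
move=> a b; rewrite /head_join /K2_join (inj_eq finj); congr (_ && _).
rewrite -[nat_of_ord (f a)]/(pos a) -[nat_of_ord (f b)]/(pos b).
have bigE a' : (n - 2 <= pos a')%N = (a' == u) || (a' == v).
  have [al|anl] := boolP (a' \in l).
    by rewrite leqNgt (pos_bs a' al).2; move: al; rewrite mem_bs => /andP[/negbTE -> /negbTE ->].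
  by rewrite big //; case: (nl _ anl) => ->; rewrite eqxx ?orbT.
rewrite !bigE -!orbA; case al: (a \in l); last first.
  by move: al; rewrite mem_bs => /negbT; rewrite negb_and !negbK => /orP[] ->; rewrite ?orbT.
case bl: (b \in l); last first.
  by move: bl; rewrite mem_bs => /negbT; rewrite negb_and !negbK => /orP[] ->; rewrite ?orbT.
by rewrite adj // (pos_bs a al).1 (pos_bs b bl).1.
Qed.

(** * Paths and starlike trees in joins *)

Definition has_path {n : nat} (L : nat) (e : rel 'I_n) : Prop :=
  exists g : nat -> 'I_n,
    (forall i j, (i < L)%N -> (j < L)%N -> g i = g j -> i = j) /\
    (forall i, (i.+1 < L)%N -> e (g i) (g i.+1)).

(* [L i j] is the j-th vertex, counted from the centre c, of the i-th leg. *)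
Definition star_in {n : nat} (t m : nat) (e : rel 'I_n) (c : 'I_n) (L : nat -> nat -> 'I_n) : Prop :=
  [/\ forall i j i' j', (i < t)%N -> (j < m)%N -> (i' < t)%N -> (j' < m)%N ->
        L i j = L i' j' -> i = i' /\ j = j',
      forall i j, (i < t)%N -> (j < m)%N -> L i j <> c,
      forall i, (i < t)%N -> e c (L i 0%N) &
      forall i j, (i < t)%N -> (j.+1 < m)%N -> e (L i j) (L i j.+1)].

Definition has_star {n : nat} (t m : nat) (e : rel 'I_n) : Prop :=
  exists (c : 'I_n) (L : nat -> nat -> 'I_n), star_in t m e c L.

Lemma star_nat_leg l i j : (0 < l - 1)%N -> (j < l - 1)%N ->
  (1 + i * (l - 1) + j - 1)%N = (i * (l - 1) + j)%N /\
  ((i * (l - 1) + j) %/ (l - 1) = i /\ (i * (l - 1) + j) %% (l - 1) = j)%N.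
Proof.
move=> m0 jm; split; first by lia.
by rewrite divnMDl // divn_small // addn0 modnMDl modn_small.
Qed.

Lemma contains_starlike n (e : rel 'I_n) t l : symmetric e -> (1 < l)%N ->
  contains_sub (starlike t l) e <-> has_star t (l - 1) e.
Proof.
move=> sym l1; have m0 : (0 < l - 1)%N by lia.
set m := (l - 1)%N in m0 *.
split=> [[f [fi fh]]|[c [L [Linj Lc cL LL]]]].
  have lt i j : (i < t)%N -> (j < m)%N -> (1 + i * m + j < (t * m).+1)%N.
    move=> it jm; rewrite -addnA add1n ltnS.
    apply: leq_trans (_ : i.+1 * m <= _)%N; first by rewrite mulSn addnC ltn_add2r.
    by rewrite leq_mul2r it orbT.
  pose v k : 'I_n := f (inord k).
  have inordK' k : (k < (t * m).+1)%N -> ((inord k : 'I_(t * m).+1) : nat) = k by exact: inordK.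
  exists (f ord0), (fun i j => v (1 + i * m + j)%N); split.
  - move=> i j i' j' it jm it' jm' /fi /(congr1 val); rewrite /= !inordK' ?lt // => E.
    have [_ [d1 r1]] := star_nat_leg l i j m0 jm; have [_ [d2 r2]] := star_nat_leg l i' j' m0 jm'.
    have {}E : (i * m + j = i' * m + j')%N by lia.
    by rewrite -/m in d1 r1 d2 r2; split; [rewrite -d1 E d2 | rewrite -r1 E r2].
  - by move=> i j it jm /fi /(congr1 val); rewrite /= inordK' ?lt.
  - move=> i it; apply: fh; rewrite /starlike /star_nat -/m /= inordK' ?lt //.
    have [-> [_ ->]] := star_nat_leg l i 0 m0 m0.
    by rewrite !eqxx.
  - move=> i j it jm; apply: fh; rewrite /starlike /star_nat -/m.
    have jm' := ltnW jm; rewrite !inordK' ?lt //.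
    have [-> [-> ->]] := star_nat_leg l i j m0 jm'; have [-> [-> ->]] := star_nat_leg l i j.+1 m0 jm.
    by rewrite !eqxx ?orbT.
pose f (x : 'I_(t * m).+1) : 'I_n := if (x : nat) == 0%N then c else L ((x - 1) %/ m)%N ((x - 1) %% m)%N.
have lt (x : 'I_(t * m).+1) : (0 < x)%N -> ((x - 1) %/ m < t)%N /\ ((x - 1) %% m < m)%N.
  by move=> x0; rewrite ltn_divLR // ltn_mod m0; split=> //; have := ltn_ord x; lia.
exists f; split.
  move=> x y; rewrite /f; case: posnP => [x0|x0]; case: posnP => [y0|y0].
  - by move=> _; apply: val_inj; rewrite /= x0 y0.
  - by move=> /esym; have [a b] := lt y y0; move/(Lc _ _ a b).
  - by have [a b] := lt x x0; move/(Lc _ _ a b).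
  - have [a b] := lt x x0; have [a' b'] := lt y y0; move/(Linj _ _ _ _ a b a' b') => [d r].
    apply: val_inj => /=; have := divn_eq (x - 1) m; have := divn_eq (y - 1) m; rewrite d r; lia.
move=> x y; rewrite /starlike /star_nat -/m /f.
case/or3P.
- move=> /andP[/andP[x0 y0] /eqP r]; rewrite x0 (gtn_eqF y0) r.
  by apply: cL; have [] := lt y y0.
- move=> /andP[/andP[y0 x0] /eqP r]; rewrite y0 (gtn_eqF x0) r sym.
  by apply: cL; have [] := lt x x0.
- move=> /and4P[x0 y0 /eqP d C]; rewrite (gtn_eqF x0) (gtn_eqF y0) d.
  have [a b] := lt y y0; have [a' b'] := lt x x0.
  case/orP: C => /eqP C; first by rewrite -C; apply: LL => //; rewrite C.
  by rewrite -C sym; apply: LL => //; rewrite C.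
Qed.

Lemma starlike1_path n (e : rel 'I_n) l : symmetric e -> (1 < l)%N ->
  contains_sub (starlike 1 l) e <-> has_path l e.
Proof.
move=> sym l1; rewrite contains_starlike //; split=> [[c [L [Linj Lc cL LL]]]|[g [gi ge]]].
  exists (fun i => if i is j.+1 then L 0%N j else c); split.
    move=> [|i] [|j] //= il jl.
    - by move=> /esym /Lc; case=> //; lia.
    - by move=> /Lc; case=> //; lia.
    - by move=> E; have [||||_ ->] := Linj 0%N i 0%N j _ _ _ _ E => //; lia.
  by move=> [|i] il; [apply: cL | apply: LL => //; lia].
exists (g 0%N), (fun _ j => g j.+1); split.
- by move=> [|//] j [|//] j' _ jl _ jl' /gi H; split=> //; have := H _ _; lia.
- by move=> i j _ jl /gi H; have := H _ _; lia.
- by move=> i _; apply: ge; lia.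
- by move=> i j _ jl; apply: ge; lia.
Qed.

Lemma starlike2_path n (e : rel 'I_n) l : symmetric e -> (1 < l)%N ->
  contains_sub (starlike 2 l) e <-> has_path (2 * l - 1) e.
Proof.
move=> sym l1; rewrite contains_starlike //; set m := (l - 1)%N.
have -> : (2 * l - 1 = m + m.+1)%N by rewrite /m; lia.
have m0 : (0 < m)%N by rewrite /m; lia.
split=> [[c [L [Linj Lc cL LL]]]|[g [gi ge]]].
  pose g i := if (i < m)%N then L 0%N (m - 1 - i)%N else if i == m then c else L 1%N (i - m - 1)%N.
  exists g; split.
    move=> i j il jl; rewrite /g; case: ltnP => im; case: ltnP => jm;
      do ?[case: eqP => ?] => //.
    - by move=> E; have [||||_] := Linj _ _ _ _ _ _ _ _ E => //; lia.
    - by move=> E; have := Lc 0%N (m - 1 - i)%N; rewrite E; case=> //; lia.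
    - by move=> E; have [||||] := Linj _ _ _ _ _ _ _ _ E => //; lia.
    - by move=> E; have := Lc 0%N (m - 1 - j)%N; rewrite E; case=> //; lia.
    - by move=> E; have [||||] := Linj _ _ _ _ _ _ _ _ E => //; lia.
    - by lia.
    - by move=> E; have := Lc 1%N (j - m - 1)%N; rewrite E; case=> //; lia.
    - by move=> E; have := Lc 1%N (i - m - 1)%N; rewrite E; case=> //; lia.
    - by move=> E; have [||||_] := Linj _ _ _ _ _ _ _ _ E => //; lia.
  move=> i il; rewrite /g; case: ltnP => im; case: ltnP => jm.
  - have -> : (m - 1 - i = (m - 1 - i.+1).+1)%N by lia.
    by rewrite sym; apply: LL; lia.
  - have im1 : i.+1 = m by lia.
    by rewrite im1 eqxx (_ : m - 1 - i = 0)%N; [rewrite sym; apply: cL | lia].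
  - by lia.
  - rewrite (gtn_eqF (_ : m < i.+1)%N) //; case: eqP => [->|ne].
      by rewrite (_ : m.+1 - m - 1 = 0)%N; [apply: cL | lia].
    have -> : (i.+1 - m - 1 = (i - m - 1).+1)%N by lia.
    by apply: LL; lia.
exists (g m), (fun i j => if i == 0%N then g (m - 1 - j)%N else g (m + 1 + j)%N); split.
- move=> [|[|//]] j [|[|//]] j' _ jl _ jl' /= /gi H; have {}H := H _ _; split=> //; lia.
- by move=> [|[|//]] j _ jl /= /gi H; have := H _ _; lia.
- move=> [|[|//]] _ /=.
    have E : (m - 1).+1 = m by lia.
    by have := ge (m - 1)%N; rewrite E sym subn0; apply; lia.
  by rewrite addn0 addn1; apply: ge; lia.
- move=> [|[|//]] j _ jl; rewrite /=; last by have := ge (m + 1 + j)%N; rewrite -addnS; apply; lia.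
  rewrite sym (_ : m - 1 - j = (m - 1 - j.+1).+1)%N; [apply: ge; lia | lia].
Qed.

Fixpoint block_of (s : seq nat) (x : nat) : nat :=
  if s is k :: s' then if (x < k)%N then 0%N else (block_of s' (x - k)).+1 else 0%N.

Lemma block_of_adj s x y : paths_adj s x y -> block_of s x = block_of s y.
Proof.
elim: s x y => [|k s IH] x y; first by rewrite paths_adj_nil.
rewrite paths_adj_cons /=; have [xk|kx] := ltnP x k; have [yk|ky] := ltnP y k => //=.
by move/IH ->.
Qed.

Lemma block_of_lt s x : (x < sumn s)%N -> (block_of s x < size s)%N.
Proof.
elim: s x => [|k s IH] x //= xs; case: (ltnP x k) => // kx; rewrite ltnS; apply: IH; lia.
Qed.

Lemma count_block_of s i :
  count (fun x => block_of s x == i) (iota 0 (sumn s)) = nth 0%N s i.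
Proof.
elim: s i => [|k s IH] i /=; first by rewrite nth_nil.
have -> : iota 0 (k + sumn s) = iota 0 k ++ map (addn k) (iota 0 (sumn s)).
  by rewrite iotaD add0n -iotaDl addn0.
rewrite count_cat count_map.
have -> : count (fun x => (if x < k then 0 else (block_of s (x - k)).+1)%N == i) (iota 0 k) =
   if i == 0%N then k else 0%N.
  rewrite (@eq_in_count _ _ (fun=> i == 0%N)) => [|x]; last first.
    by rewrite mem_iota add0n => /andP[_ ->]; rewrite eq_sym.
  by case: ifP => _; rewrite ?count_predT ?count_pred0 ?size_iota.
rewrite (@eq_count _ _ (fun x => (block_of s x).+1 == i)) => [|x /=]; last first.
  by rewrite addKn (_ : (k + x < k)%N = false) //; lia.
case: i => [|i] /=; last by rewrite -IH add0n; apply: eq_count.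
by rewrite (@eq_count _ _ pred0) ?count_pred0 ?addn0.
Qed.

Lemma count_block_of_mem s l :
  (count (fun x => block_of s x \in l) (iota 0 (sumn s)) <= \sum_(i <- l) nth 0%N s i)%N.
Proof.
elim: l => [|i l IH]; first by rewrite big_nil (@eq_count _ _ pred0) ?count_pred0.
rewrite big_cons -count_block_of; apply: leq_trans (leq_add (leqnn _) IH).
rewrite -count_predUI; apply: leq_trans (leq_addr _ _).
by rewrite leq_eqVlt; apply/orP; left; apply/eqP/eq_count => x; rewrite /= in_cons.
Qed.

(** Every block is charged c, plus the surplus a - c or b - c if it is one of the first two. *)
Lemma sum_three_blocks a b c rest l : all (fun r => (r <= c)%N) rest -> (c <= a)%N -> (c <= b)%N ->
  uniq l -> (size l <= 3)%N -> (\sum_(i <- l) nth 0%N [:: a, b & rest] i <= a + b + c)%N.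
Proof.
move=> restc ca cb Ul l3.
apply: (@leq_trans (\sum_(i <- l) (c + ((i == 0) * (a - c) + (i == 1) * (b - c))))%N).
  apply: leq_sum => -[|[|i]] _ /=; [lia | lia |].
  rewrite addn0; have [ir|ri] := ltnP i (size rest); last by rewrite nth_default.
  by apply: (allP restc); apply: mem_nth.
rewrite big_split /= big_split /= -!big_distrl /= big_const_seq count_predT iter_addn_0.
have one z : (\sum_(i <- l) (i == z) <= 1)%N.
  rewrite (eq_bigr (fun i => if i == z then 1 else 0)%N) => [|i _]; last by case: (i == z).
  by rewrite -big_mkcond sum1_count count_uniq_mem //; case: (_ \in _).
have h0 := leq_mul (one 0%N) (leqnn (a - c)); have h1 := leq_mul (one 1%N) (leqnn (b - c)).
have h3 := leq_mul (leqnn c) l3.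
by apply: leq_trans (leq_add h3 (leq_add h0 h1)) _; lia.
Qed.

Section PathInJoin.
Variables (n : nat) (s : seq nat) (L : nat) (g : nat -> 'I_n).
Hypotheses (n2 : (1 < n)%N) (sn : sumn s = (n - 2)%N)
  (ginj : forall i j, (i < L)%N -> (j < L)%N -> g i = g j -> i = j)
  (gadj : forall i, (i.+1 < L)%N -> K2_join n s (g i) (g i.+1)).

Let low i := (g i < n - 2)%N.
Let seg i := count (fun j => ~~ low j) (iota 0 i).

Lemma uniq_path_vals (P : pred nat) : uniq [seq nat_of_ord (g i) | i <- iota 0 L & P i].
Proof.
rewrite map_inj_in_uniq ?filter_uniq ?iota_uniq // => i j.
by rewrite !mem_filter !mem_iota !add0n => /and3P[_ _ iL] /and3P[_ _ jL] /val_inj/ginj; apply.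
Qed.

Lemma seg_le2 i : (i <= L)%N -> (seg i <= 2)%N.
Proof.
move=> iL; apply: (@leq_trans (count (fun j => ~~ low j) (iota 0 L))).
  by rewrite -(subnKC iL) iotaD count_cat leq_addr.
rewrite -size_filter -(size_map (fun i => nat_of_ord (g i))).
apply: (@uniq_leq_size _ _ [:: n - 2; n - 1]%N); first exact: uniq_path_vals.
move=> x /mapP[j]; rewrite mem_filter /low -leqNgt => /andP[jh _] ->.
by have := ltn_ord (g j); rewrite !inE; lia.
Qed.

Lemma segS i : seg i.+1 = (seg i + ~~ low i)%N.
Proof. by rewrite /seg -addn1 iotaD count_cat /= add0n addn0. Qed.

Lemma seg_block i k : (i + k < L)%N -> low i -> low (i + k) -> seg (i + k) = seg i ->
  block_of s (g i) = block_of s (g (i + k)).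
Proof.
have mono j : (seg j <= seg j.+1)%N by rewrite segS leq_addr.
have mono' j k' : (seg j <= seg (j + k'))%N.
  by elim: k' => [|k' IH]; rewrite ?addn0 // addnS; apply: leq_trans IH (mono _).
elim: k => [|k IH]; first by rewrite addn0.
rewrite addnS => ikL li lik E.
have := mono (i + k)%N; have := mono' i k; rewrite E => h1 h2.
have E1 : seg (i + k)%N = seg i by lia.
have lk : low (i + k) by move: E; rewrite segS E1; case: (low (i + k)) => //=; lia.
rewrite (IH (ltnW ikL) li lk E1).
apply: block_of_adj; have /andP[_] := gadj _ ikL.
by rewrite leqNgt -/(low (i + k)) lk leqNgt -/(low (i + k).+1) lik.
Qed.

(** The path meets at most two heads, which cut it into at most three segments, and each segment
    stays within one block. *)
Lemma path_blocks : exists l, [/\ uniq l, (size l <= 3)%N &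
  (L <= 2 + \sum_(i <- l) nth 0%N s i)%N].
Proof.
pose l := undup [seq block_of s (g i) | i <- iota 0 L & low i].
exists l; split; first exact: undup_uniq.
  (* The block of the k-th segment; the default 0 for an empty segment only enlarges the covering
     list. *)
  pose beta k := head 0%N [seq block_of s (g i) | i <- iota 0 L & low i && (seg i == k)].
  apply: (@uniq_leq_size _ _ [:: beta 0; beta 1; beta 2]%N); first exact: undup_uniq.
  move=> b; rewrite mem_undup => /mapP[i]; rewrite mem_filter mem_iota add0n => /andP[li /andP[_ iL]] ->.
  suff -> : block_of s (g i) = beta (seg i).
    by have := seg_le2 i (ltnW iL); case: (seg i) => [|[|[|//]]] _; rewrite !inE eqxx ?orbT.
  rewrite /beta; set li' := [seq _ <- _ | _].
  have : i \in li' by rewrite mem_filter li eqxx mem_iota add0n iL.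
  have : all (fun j => [&& low j, seg j == seg i & (j < L)%N]) li'.
    by apply/allP => j; rewrite mem_filter mem_iota add0n -andbA => /and3P[-> -> /andP[_ ->]].
  case: li' => [//|j li'] /= /andP[/and3P[lj /eqP sj jL] _] _.
  have [ij|ji] := leqP i j.
    by have := seg_block i (j - i); rewrite subnKC //; apply.
  by have := seg_block j (i - j); rewrite (subnKC (ltnW ji)) => /(_ iL lj li (esym sj)) ->.
have -> : L = (count low (iota 0 L) + count (fun j => ~~ low j) (iota 0 L))%N.
  by rewrite count_predC size_iota.
rewrite addnC; apply: leq_add; first exact: (seg_le2 L (leqnn L)).
apply: leq_trans (count_block_of_mem s l); rewrite -!size_filter.
rewrite -(size_map (fun i => nat_of_ord (g i))); apply: uniq_leq_size; first exact: uniq_path_vals.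
move=> x /mapP[i iL ->]; rewrite mem_filter mem_undup.
apply/andP; split; first by apply/mapP; exists i.
by move: iL; rewrite mem_filter => /andP[li _]; rewrite mem_iota sn.
Qed.
End PathInJoin.

Lemma K2_join_no_path n a b c rest M : (1 < n)%N -> sumn [:: a, b & rest] = (n - 2)%N ->
  all (fun r => (r <= c)%N) rest -> (c <= a)%N -> (c <= b)%N -> (a + b + c <= M)%N ->
  ~ has_path (M + 3) (K2_join n [:: a, b & rest]).
Proof.
move=> n2 sn restc ca cb abcM [g [ginj gadj]].
have [l [Ul l3 Ll]] := path_blocks n _ _ g n2 sn ginj gadj.
have := sum_three_blocks a b c rest l restc ca cb Ul l3; lia.
Qed.

(** This is where t >= 5 matters: a vertex of the linear forest has at most four neighbours, two
    heads and two on its path. *)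
Lemma K2_join_star_centre n s t m c L : (1 < n)%N -> (4 < t)%N -> (0 < m)%N ->
  star_in t m (K2_join n s) c L -> (n - 2 <= c)%N.
Proof.
move=> n2 t5 m0 [Linj Lc cL _]; rewrite leqNgt; apply/negP => clt.
have : (size [seq nat_of_ord (L i 0%N) | i <- iota 0 t] <= size [:: n - 2; n - 1; c.-1; c.+1]%N)%N.
  apply: uniq_leq_size.
    rewrite map_inj_in_uniq ?iota_uniq // => i j; rewrite !mem_iota !add0n => /andP[_ it] /andP[_ jt].
    by move=> /val_inj /(Linj _ _ _ _ it m0 jt m0)[].
  move=> x /mapP[i]; rewrite mem_iota add0n => /andP[_ it] ->.
  have /andP[_] := cL i it; rewrite leqNgt clt /= => /orP[h|/paths_adj_consecutive].
    by have := ltn_ord (L i 0%N); rewrite !inE; lia.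
  by rewrite /consecutive !inE; lia.
by rewrite size_map size_iota /=; lia.
Qed.

(** The centre is a head and the other head lies on at most one leg. At least t - 1 legs avoid both
    heads, so each stays in one block, and a block of k vertices has room for k %/ m of them. *)
Lemma K2_join_no_star n s t m : (1 < n)%N -> sumn s = (n - 2)%N -> (4 < t)%N -> (0 < m)%N ->
  (sumn [seq (k %/ m)%N | k <- s] <= t - 2)%N -> ~ has_star t m (K2_join n s).
Proof.
move=> n2 sn t5 m0 few [c [L star]].
have chigh := K2_join_star_centre n s t m c L n2 t5 m0 star.
case: star => Linj Lc cL LL.
pose low i := all (fun j => L i j < n - 2)%N (iota 0 m).
have bad : (count (fun i => ~~ low i) (iota 0 t) <= 1)%N.
  have badE i : (i < t)%N -> ~~ low i -> exists2 j, (j < m)%N & (L i j : nat) = (n - 2 + (n - 1) - c)%N.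
    move=> it /allPn[j]; rewrite mem_iota add0n -leqNgt => /andP[_ jm] h; exists j => //.
    have : (L i j : nat) <> c by move=> /val_inj; apply: Lc.
    by have := ltn_ord (L i j); have := ltn_ord c; lia.
  rewrite -size_filter.
  have : uniq [seq i <- iota 0 t | ~~ low i] by rewrite filter_uniq ?iota_uniq.
  have : all (fun i => (i < t)%N && ~~ low i) [seq i <- iota 0 t | ~~ low i].
    by apply/allP => i; rewrite mem_filter mem_iota add0n => /and3P[-> _ ->].
  case: [seq _ <- _ | _] => [|i [|i' l]] //= /and3P[/andP[it bi] /andP[it' bi'] _].
  have [j jm E] := badE i it bi; have [j' jm' E'] := badE i' it' bi'.
  have /(Linj _ _ _ _ it jm it' jm')[-> _] : L i j = L i' j' by apply: val_inj; rewrite /= E E'.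
  by rewrite inE eqxx.
pose good := [seq i <- iota 0 t | low i].
have sgood : (t - 1 <= size good)%N.
  have := count_predC low (iota 0 t); rewrite size_iota /good size_filter => E.
  have {}bad : (count (predC low) (iota 0 t) <= 1)%N by [].
  change (t - 1 <= count low (iota 0 t))%N; lia.
have lowL i j : low i -> (j < m)%N -> (L i j < n - 2)%N.
  by move=> /allP h jm; apply: h; rewrite mem_iota add0n.
have blockL i j : (i < t)%N -> low i -> (j < m)%N -> block_of s (L i j) = block_of s (L i 0%N).
  move=> it li; elim: j => [//|j IH] jm; rewrite -IH ?(ltnW jm) //; apply/esym/block_of_adj.
  have /andP[_] := LL i j it jm.
  by rewrite leqNgt lowL ?(ltnW jm) //= leqNgt lowL.
have perblock b : (count (fun i => block_of s (L i 0%N) == b) good <= nth 0%N s b %/ m)%N.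
  rewrite leq_divRL // -count_block_of -!size_filter.
  set lb := [seq i <- good | _].
  have lbP i : i \in lb -> [/\ (i < t)%N, low i & block_of s (L i 0%N) = b].
    by rewrite !mem_filter mem_iota add0n => /and3P[/eqP -> -> /andP[_ ->]].
  rewrite -[m in (_ * m)%N](size_iota 0) -(size_allpairs (fun i j => nat_of_ord (L i j))).
  apply: uniq_leq_size.
    apply: allpairs_uniq; rewrite ?iota_uniq ?filter_uniq ?iota_uniq //.
    move=> [i j] [i' j'] /allpairsP[[a a'] [/= /lbP[at_ _ _] am [-> ->]]].
    move=> /allpairsP[[b' b''] [/= /lbP[bt _ _] bm [-> ->]]].
    rewrite !mem_iota !add0n in am bm.
    by move=> /val_inj /(Linj _ _ _ _ at_ am bt bm)[-> ->].
  move=> x /allpairsP[[i j] [/= /lbP[it li bi] jm ->]].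
  rewrite mem_iota add0n in jm.
  by rewrite mem_filter mem_iota add0n blockL // bi eqxx sn lowL.
have : (size good <= sumn [seq (k %/ m)%N | k <- s])%N.
  rewrite sumnE big_map (big_nth 0%N) big_mkord.
  apply: (@leq_trans (\sum_(b < size s) count (fun i => block_of s (L i 0%N) == b) good)%N).
    rewrite -sum1_size; under [leqRHS]eq_bigr do rewrite -sum1_count.
    rewrite (exchange_big_dep predT) //= !big_seq; apply: leq_sum => i.
    rewrite mem_filter => /andP[li _].
    have bl : (block_of s (L i 0%N) < size s)%N by apply: block_of_lt; rewrite sn lowL.
    by rewrite (bigD1 (Ordinal bl)) //=.
  by apply: leq_sum => b _; apply: perblock.
lia.
Qed.

Lemma paths_adj_catl s1 s2 x y : paths_adj s1 x y -> paths_adj (s1 ++ s2) x y.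
Proof.
elim: s1 x y => [|k s IH] x y; first by rewrite paths_adj_nil.
rewrite /= !paths_adj_cons; case: ifP => // _ /and3P[-> -> /IH ->] //.
Qed.

Lemma paths_adj_catr s1 s2 x y :
  paths_adj (s1 ++ s2) (sumn s1 + x) (sumn s1 + y) = paths_adj s2 x y.
Proof.
elim: s1 => [|k s IH] //=; rewrite paths_adj_cons -!addnA !addKn !leq_addr /= IH.
by rewrite (_ : (k + _ < k)%N = false) //; lia.
Qed.

Lemma paths_adj_head k s x : (x.+1 < k)%N -> paths_adj (k :: s) x x.+1.
Proof. by move=> xk; rewrite paths_adj_cons xk (ltnW xk) /consecutive eqxx. Qed.

Lemma paths_adj_second a b s x : (a <= x)%N -> (x.+1 < a + b)%N -> paths_adj [:: a, b & s] x x.+1.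
Proof.
move=> ax xb; have -> : x = (sumn [:: a] + (x - a))%N by rewrite /= addn0 subnKC.
by rewrite -addnS -[_ :: _]/([:: a] ++ b :: s) paths_adj_catr paths_adj_head //; lia.
Qed.

(** The path runs through the first block, one head, the second block, the other head and the third
    block. *)
Lemma K2_join_has_path n a b c rest L : (1 < n)%N -> sumn [:: a, b, c & rest] = (n - 2)%N ->
  (L <= a + b + c + 2)%N -> has_path L (K2_join n [:: a, b, c & rest]).
Proof.
case: n => [//|n] n2 sn Labc; set s := [:: a, b, c & rest] in sn *.
pose f k := if (k < a)%N then k else if k == a then (n.+1 - 2)%N
  else if (k <= a + b)%N then (k - 1)%N else if k == (a + b).+1 then n else (k - 2)%N.
have sn' : (a + (b + (c + sumn rest)) = n.+1 - 2)%N := sn.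
have flt k : (k < L)%N -> (f k < n.+1)%N.
  by rewrite /f; do ?case: ifP => ?; move=> ?; lia.
exists (fun k => inord (f k)); split=> [i j iL jL|i iL].
  move=> /(congr1 val); rewrite /= !inordK ?flt // /f.
  by do ?case: ifP => ?; lia.
rewrite /K2_join -(inj_eq val_inj) /= !inordK ?flt // ?(ltnW iL) //.
have cadj x : (a + b <= x)%N -> (x.+1 < a + b + c)%N -> paths_adj s x x.+1.
  move=> abx xc; have -> : x = (sumn [:: a] + (x - a))%N by rewrite /= addn0 subnKC //; lia.
  rewrite -addnS -[s]/([:: a] ++ [:: b, c & rest]) paths_adj_catr paths_adj_second //; lia.
have cases : [\/ (f i.+1 = (f i).+1 /\ paths_adj s (f i) (f i).+1),
    (f i < n.+1 - 2)%N /\ (n.+1 - 2 <= f i.+1)%N,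
    (f i.+1 < n.+1 - 2)%N /\ (n.+1 - 2 <= f i)%N |
    f i = (n.+1 - 2)%N /\ f i.+1 = n].
  have [ia|ai] := ltnP i.+1 a.
    constructor 1; rewrite /f ia (ltnW ia); split=> //; exact: paths_adj_head.
  have [ia|ia] := eqVneq i.+1 a.
    constructor 2; have -> : f i = i by rewrite /f; do ?case: ifP => ?; lia.
    have -> : f i.+1 = (n.+1 - 2)%N by rewrite /f; do ?case: ifP => ?; lia.
    lia.
  have [ia'|ia'] := eqVneq i a.
    have [b0|b0] := posnP b.
      by constructor 4; rewrite /f; do ?case: ifP => ?; lia.
    constructor 3; have -> : f i = (n.+1 - 2)%N by rewrite /f; do ?case: ifP => ?; lia.
    have -> : f i.+1 = i by rewrite /f; do ?case: ifP => ?; lia.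
    lia.
  have [iab|abi] := ltnP i (a + b).
    constructor 1.
    have -> : f i = i.-1.
      by rewrite /f; do ?case: ifP => ?; lia.
    have -> : f i.+1 = i by rewrite /f; do ?case: ifP => ?; lia.
    have E : i.-1.+1 = i by lia.
    rewrite E; split=> //; rewrite -{2}E; apply: paths_adj_second; lia.
  have [iab|iab] := eqVneq i (a + b)%N.
    constructor 2; have -> : f i = i.-1 by rewrite /f; do ?case: ifP => ?; lia.
    have -> : f i.+1 = n by rewrite /f; do ?case: ifP => ?; lia.
    lia.
  have [iab'|iab'] := eqVneq i (a + b).+1.
    constructor 3; have -> : f i = n by rewrite /f; do ?case: ifP => ?; lia.
    have -> : f i.+1 = i.-1 by rewrite /f; do ?case: ifP => ?; lia.
    lia.
  constructor 1; have -> : f i = i.-2 by rewrite /f; do ?case: ifP => ?; lia.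
  have -> : f i.+1 = i.-1 by rewrite /f; do ?case: ifP => ?; lia.
  have E : i.-2.+1 = i.-1 by lia.
  by rewrite E; split=> //; rewrite -E; apply: cadj; lia.
case: cases => [[-> p]|[h1 h2]|[h1 h2]|[h1 h2]].
- by rewrite p !orbT andbT; lia.
- by rewrite h2 orbT andbT; lia.
- by rewrite h2 andbT; lia.
- by rewrite h1 h2 leqnn andbT; lia.
Qed.

Lemma K2_join_block_path n a rest L : (1 < n)%N -> sumn (a :: rest) = (n - 2)%N ->
  (L <= a)%N -> has_path L (K2_join n (a :: rest)).
Proof.
case: n => [//|n] n2 sn La; have {}sn : (a + sumn rest = n.+1 - 2)%N := sn.
exists (fun k => inord k); split=> [i j iL jL|i iL].
  by move=> /(congr1 val); rewrite /= !inordK //; lia.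
rewrite /K2_join -(inj_eq val_inj) /= !inordK; try lia.
by rewrite paths_adj_head ?orbT ?andbT; lia.
Qed.

(** Cut every block of k vertices, from its left end, into k %/ m segments of m vertices; this is
    the first vertex of the i-th segment overall. *)
Fixpoint leg_start (s : seq nat) (m i : nat) : nat :=
  if s is k :: s' then
    if (i < k %/ m)%N then (i * m)%N else (k + leg_start s' m (i - k %/ m))%N
  else 0%N.

Lemma leg_startP s m i : (0 < m)%N -> (i < sumn [seq k %/ m | k <- s])%N ->
  (leg_start s m i + m <= sumn s)%N /\
  forall j, (j.+1 < m)%N -> paths_adj s (leg_start s m i + j) (leg_start s m i + j).+1.
Proof.
move=> m0; elim: s i => [|k s IH] i //= ilt.
have [ik|ki] := ltnP i (k %/ m).
  have h : (i * m + m <= k)%N.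
    rewrite addnC -mulSn; apply: leq_trans (leq_trunc_div k m); by rewrite leq_mul2r ik orbT.
  split; first by lia.
  by move=> j jm; apply: paths_adj_head; lia.
have [|h1 h2] := IH (i - k %/ m)%N; first by lia.
split; first by lia.
move=> j jm; rewrite -addnA -addnS.
by have := paths_adj_catr [:: k] s (leg_start s m (i - k %/ m) + j) (leg_start s m (i - k %/ m) + j).+1;
  rewrite /= addn0 => ->; apply: h2.
Qed.

Lemma leg_start_mono s m i i' : (0 < m)%N -> (i < i')%N -> (i' < sumn [seq k %/ m | k <- s])%N ->
  (leg_start s m i + m <= leg_start s m i')%N.
Proof.
move=> m0; elim: s i i' => [|k s IH] i i' //= ii ilt.
have [ik|ki] := ltnP i (k %/ m); have [ik'|ki'] := ltnP i' (k %/ m).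
- by rewrite addnC -mulSn leq_mul2r ii orbT.
- have : (i * m + m <= k)%N.
    rewrite addnC -mulSn; apply: leq_trans (leq_trunc_div k m); by rewrite leq_mul2r ik orbT.
  lia.
- lia.
- by rewrite -addnA leq_add2l; apply: IH; lia.
Qed.

(** The centre is the head n - 2. The blocks of [s1] hold t - 1 legs, and the last leg goes through
    the block x, the other head and the block y, which gives x + 1 + y vertices. *)
Lemma K2_join_has_star n t m s1 x y rest : (1 < n)%N -> (0 < m)%N ->
  sumn (s1 ++ [:: x, y & rest]) = (n - 2)%N ->
  (t - 1 <= sumn [seq k %/ m | k <- s1])%N -> (m <= x + y + 1)%N ->
  has_star t m (K2_join n (s1 ++ [:: x, y & rest])).
Proof.
case: n => [//|n] n2 m0; set s := s1 ++ _ => sn tl mxy.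
have {}sn : (sumn s1 + (x + (y + sumn rest)) = n.+1 - 2)%N by rewrite -sn /s sumn_cat.
pose P := sumn s1.
pose f i j := if (i < t - 1)%N then (leg_start s1 m i + j)%N
  else if (j < x)%N then (P + j)%N else if j == x then n else (P + j - 1)%N.
have leg i : (i < t - 1)%N -> (leg_start s1 m i + m <= P)%N.
  by move=> it; have [] := leg_startP s1 m i m0 (leq_trans it tl).
have flt i j : (i < t)%N -> (j < m)%N -> (f i j < n.+1 - 2)%N \/ f i j = n /\ i = (t - 1)%N.
  move=> it jm; rewrite /f; case: ifP => [/leg h|it']; first by left; rewrite /P in h; lia.
  case: ifP => jx; first by left; rewrite /P; lia.
  by case: eqP => jx'; [right; lia | left; rewrite /P; lia].
have flt' i j : (i < t)%N -> (j < m)%N -> (f i j < n.+1)%N.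
  by move=> it jm; case: (flt i j it jm); lia.
have nval : (inord (n.+1 - 2) : 'I_n.+1) = (n.+1 - 2)%N :> nat by rewrite inordK //; lia.
exists (inord (n.+1 - 2)), (fun i j => inord (f i j)); split.
- move=> i j i' j' it jm it' jm' /(congr1 val); rewrite /= !inordK ?flt' // /f.
  have mono a b : (a < b)%N -> (b < t - 1)%N -> (leg_start s1 m a + m <= leg_start s1 m b)%N.
    by move=> ab bt; apply: leg_start_mono => //; apply: leq_trans bt tl.
  have [i1|i1] := ltnP i (t - 1); have [i2|i2] := ltnP i' (t - 1).
  + have [lt|gt|->] := ltngtP i i'; last by move/addnI.
      by have := mono _ _ lt i2; lia.
    by have := mono _ _ gt i1; lia.
  + by have := leg i i1; rewrite /P => h; do ?case: ifP => ?; lia.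
  + by have := leg i' i2; rewrite /P => h; do ?case: ifP => ?; lia.
  + by do ?case: ifP => ?; rewrite /P; lia.
- move=> i j it jm /(congr1 val); rewrite /= nval inordK ?flt' //.
  by case: (flt i j it jm); lia.
- move=> i it; rewrite /K2_join -(inj_eq val_inj) /= nval leqnn andbT inordK ?flt' //.
  by case: (flt i 0%N it m0); lia.
move=> i j it jm; have jm' := ltnW jm.
rewrite /K2_join -(inj_eq val_inj) /= !inordK ?flt' //.
have [it1|it1] := ltnP i (t - 1).
  have [_ adj] := leg_startP s1 m i m0 (leq_trans it1 tl).
  have {}adj : paths_adj s (f i j) (f i j).+1.
    by rewrite /f it1; apply: paths_adj_catl; apply: adj.
  have -> : f i j.+1 = (f i j).+1 by rewrite /f it1 addnS.
  by rewrite adj !orbT andbT; lia.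
have radj a b : paths_adj [:: x, y & rest] a b -> paths_adj s (P + a) (P + b).
  by rewrite paths_adj_catr.
have nit1 : (i < t - 1)%N = false by lia.
have [jx|xj] := ltnP j.+1 x.
  have -> : f i j = (P + j)%N by rewrite /f nit1 (ltnW jx).
  have -> : f i j.+1 = (P + j.+1)%N by rewrite /f nit1 jx.
  by rewrite radj ?orbT ?andbT; [lia | apply: paths_adj_head].
have [jx|jx] := eqVneq j.+1 x.
  have -> : f i j = (P + j)%N by rewrite /f nit1 -jx ltnSn.
  have -> : f i j.+1 = n by rewrite /f nit1 jx ltnn eqxx.
  by rewrite /P; lia.
have [jx'|jx'] := eqVneq j x.
  have -> : f i j = n by rewrite /f nit1 jx' ltnn eqxx.
  have -> : f i j.+1 = (P + j)%N.
    by rewrite /f nit1; do ?case: ifP => ?; lia.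
  by rewrite /P; lia.
have -> : f i j = (P + j.-1)%N by rewrite /f nit1; do ?case: ifP => ?; lia.
have -> : f i j.+1 = (P + j.-1.+1)%N by rewrite /f nit1; do ?case: ifP => ?; lia.
by rewrite radj ?orbT ?andbT; [lia | apply: paths_adj_second; lia].
Qed.

(** A path on t m vertices in the neighbourhood of u is cut into t legs around the centre u. *)
Lemma has_star_of_path n t m (e : rel 'I_n) (u x : 'I_n) p : (0 < m)%N -> path e x p ->
  uniq (x :: p) -> (t * m <= size (x :: p))%N -> {in x :: p, forall y, e u y} -> irreflexive e ->
  has_star t m e.
Proof.
move=> m0 ep U tm eu irr.
have lt i j : (i < t)%N -> (j < m)%N -> (i * m + j < size (x :: p))%N.
  move=> it jm; apply: leq_trans tm; apply: leq_trans (_ : i.+1 * m <= _)%N.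
    by rewrite mulSn addnC ltn_add2r.
  by rewrite leq_mul2r it orbT.
exists u, (fun i j => nth x (x :: p) (i * m + j)); split.
- move=> i j i' j' it jm it' jm' /eqP; rewrite nth_uniq ?lt // => /eqP E.
  have d a b : (b < m)%N -> ((a * m + b) %/ m = a)%N.
    by move=> bm; rewrite divnMDl // divn_small // addn0.
  have ii : i = i' by rewrite -(d i j jm) E d.
  by split=> //; move: E; rewrite ii => /addnI.
- by move=> i j it jm E; have := eu _ (mem_nth x (lt i j it jm)); rewrite E irr.
- by move=> i it; apply: eu; apply: mem_nth; apply: lt.
- move=> i j it jm; rewrite addnS; move/(pathP x): ep; apply.
  by have := lt i j.+1 it jm; rewrite addnS.
Qed.

Lemma has_path_of_path n L (e : rel 'I_n) (x : 'I_n) p : path e x p ->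
  uniq (x :: p) -> (L <= size (x :: p))%N -> has_path L e.
Proof.
move=> ep U Lp; exists (fun i => nth x (x :: p) i); split.
  by move=> i j iL jL /eqP; rewrite nth_uniq ?(leq_trans _ Lp) // => /eqP.
by move=> i iL; move/(pathP x): ep; apply; have := leq_trans iL Lp.
Qed.

(** * Structure of extremal graphs *)

Lemma planar_K33_free n (e : rel 'I_n) : simple_graph e -> planar e -> K33_free e.
Proof.
move=> simple_e planar_e a b c ab ac bc; rewrite leqNgt; apply/negP => /card_gt2P.
move=> [x [y [z [[]]]]]; rewrite !inE => /andP[/andP[ax bx] cx] /andP[/andP[ay by_] cy] /andP[/andP[az bz] cz].
move=> [xy yz zx]; have [sym irr] := simple_e.
have ne p q : e p q -> p != q by apply: contraTneq => ->; rewrite irr.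
apply: (planar_no_K33 n e (fun i => nth a [:: a; b; c; x; y; z] i) simple_e planar_e).
  move=> [|[|[|[|[|i]]]]] [|[|[|[|[|[|j]]]]]]; rewrite !ltnS ?ltn0 ?andbF //= => _;
    rewrite ?(ne _ _ ax) ?(ne _ _ ay) ?(ne _ _ az) ?(ne _ _ bx) ?(ne _ _ by_) ?(ne _ _ bz)
      ?(ne _ _ cx) ?(ne _ _ cy) ?(ne _ _ cz) //.
  by rewrite eq_sym.
by move=> [|[|[|i]]] [|[|[|[|[|[|j]]]]]].
Qed.

Lemma planar_deg_sum n (e : rel 'I_n) (A : {set 'I_n}) : simple_graph e -> planar e ->
  (deg_sum e A <= 6 * #|A|)%N.
Proof.
move=> simple_e planar_e; have [sym irr] := simple_e.
have [A3|A3] := ltnP 2 #|A|.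
  have free : K5_minor_free e A by move=> B _; exact: (planar_no_K5_minor n e B simple_e planar_e).
  exact: leq_trans (leq_addr 12 _) (K5_minor_free_deg_sum e A sym irr free A3).
apply: (@leq_trans (\sum_(a in A) 2)%N); last by rewrite sum_nat_const; lia.
apply: leq_sum => a _; apply: leq_trans A3; apply: subset_leq_card.
by apply/subsetP => b; rewrite inE => /andP[].
Qed.

(** Sparsity gives a vertex a with at most six neighbours in B. Its edges contribute at most 2 x a 6
    M, and the induction continues on B without a. *)
Lemma degenerate_sum (T : finType) (e : rel T) (B : {set T}) (x : T -> RR) (M : RR) :
  symmetric e -> irreflexive e -> (forall A : {set T}, (deg_sum e A <= 6 * #|A|)%N) -> 0 <= M ->
  (forall a, a \in B -> 0 <= x a <= M) ->
  \sum_(a in B) x a * \sum_(b in B | e a b) x b <= 12 * M * \sum_(a in B) x a.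
Proof.
move=> sym irr sparse M0; have [k] := ubnP #|B|; elim: k => // k IH in B * => Bk xB.
have [->|B0] := eqVneq B set0; first by rewrite !big_set0 mulr0.
have [a aB deg_a] : exists2 a, a \in B & (#|nbrs e B a| <= 6)%N.
  apply/exists_inP; rewrite -[X in is_true X]negbK negb_exists_in; apply/negP => /forall_inP H.
  have : (\sum_(a in B) 7 <= deg_sum e B)%N by apply: leq_sum => a /H; rewrite -ltnNge.
  rewrite sum_nat_const => /leq_trans/(_ (sparse B)).
  by move: B0; rewrite -card_gt0; lia.
have xa : 0 <= x a by have /andP[] := xB a aB.
have IHa := IH (B :\ a); have Ba := cardsD1 a B; rewrite aB in Ba.
have {}IHa := IHa ltac:(lia) (fun b bB => xB b (subsetP (subsetDl _ _) b bB)).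
set s := \sum_(b in B | e a b) x b.
have s_le : s <= 6 * M.
  apply: (@le_trans _ _ (\sum_(b in B | e a b) M)).
    by apply: ler_sum => b /andP[bB _]; have /andP[] := xB b bB.
  rewrite sumr_const -[leLHS]mulr_natl; apply: ler_wpM2r => //; rewrite (ler_nat _ _ 6).
  by apply: leq_trans deg_a; apply: subset_leq_card; apply/subsetP => b; rewrite !inE.
rewrite [leLHS](big_setD1 a aB) [in leRHS](big_setD1 a aB) /= -/s.
have -> : \sum_(i in B :\ a) x i * \sum_(b in B | e i b) x b =
    x a * s + \sum_(i in B :\ a) x i * \sum_(b in B :\ a | e i b) x b.
  have split_i i : i \in B :\ a -> x i * \sum_(b in B | e i b) x b =
      (if e a i then x a * x i else 0) + x i * \sum_(b in B :\ a | e i b) x b.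
    rewrite !inE => /andP[ia iB]; rewrite (bigID (pred1 a)) /= mulrDr; congr (_ + _).
      rewrite (sym a i); case: ifP => eia.
        rewrite (big_pred1 a) => [|b /=]; first by rewrite mulrC.
        by have [->|] := eqVneq b a; rewrite ?andbF // aB eia.
      rewrite big1 ?mulr0 // => b /andP[/andP[_ eib] /eqP ba].
      by rewrite -ba eib in eia.
    congr (_ * _); apply: eq_bigl => b; rewrite !inE.
    by case: (b == a); case: (b \in B); case: (e i b).
  rewrite (eq_bigr _ split_i) big_split /=; congr (_ + _).
  rewrite /s mulr_sumr -big_mkcondr; apply: eq_bigl => b; rewrite !inE.
  by have [->|] := eqVneq b a; rewrite ?irr ?andbF.
have := ler_wpM2l xa s_le; rewrite mulrDr; lra.
Qed.

(** The cycle is contracted to the triangle x, y, q. The common neighbour w off the cycle, merged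
    with v, stands in for the possibly missing edge uv. *)
Lemma double_wheel_K5 n (e : rel 'I_n) (u v w x y : 'I_n) q : simple_graph e -> planar e ->
  path e x (y :: q) -> uniq [:: x, y & q] -> q != [::] -> e (last y q) x ->
  u != v -> w \notin [:: x, y & q] -> e u w -> e v w ->
  (forall z, z \in [:: x, y & q] -> e u z && e v z) -> False.
Proof.
move=> simple_e planar_e /= /andP[exy pq] /and3P[] xyq yq Uq q0 elx uv wp euw evw heads.
have [sym irr] := simple_e.
have ne a b : e a b -> a != b by apply: contraTneq => ->; rewrite irr.
pose B i := nth set0 [:: [set x]; [set y]; [set z in q]; [set u]; [set v; w]] i.
have [z1 [q' qE]] : exists z1 q', q = z1 :: q' by case: (q) q0 => // z1 q' _; exists z1, q'.
have z1q : z1 \in q by rewrite qE mem_head.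
have eyz1 : e y z1 by move: pq; rewrite qE => /andP[].
have lq : last y q \in q by rewrite qE /= mem_last.
have inp z : z \in q -> z \in [:: x, y & q] by rewrite !in_cons => ->; rewrite !orbT.
have [xp yp] : x \in [:: x, y & q] /\ y \in [:: x, y & q] by rewrite !in_cons !eqxx orbT.
have qconn : connected_in e [set z in q].
  split; first by exists z1; rewrite in_set.
  pose r := [rel a b | [&& e a b, a \in [set z in q] & b \in [set z in q]]].
  have rsym : connect_sym r.
    by apply: sym_connect_sym => a b /=; rewrite sym andbCA andbC -andbA [X in _ && X]andbC.
  have from_z1 z : z \in q -> connect r z1 z.
    rewrite qE inE => /orP[/eqP ->//|zq'].
    have pr : path r z1 q'.
      move: pq; rewrite qE /= => /andP[_ pq'].
      have : all (fun z => z \in q) (z1 :: q') by rewrite -qE; apply/allP.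
      elim: (q') z1 pq' {zq' qE z1q eyz1} => [|c l IHl] d //= /andP[edc pl] /and3P[dq cq lq'].
      by rewrite edc !inE dq cq /=; apply: IHl => //; rewrite /= cq.
    have := path_connect pr; apply; by rewrite inE zq' orbT.
  by move=> a b; rewrite !in_set => aq bq; apply: connect_trans (from_z1 b bq); rewrite rsym from_z1.
apply: (planar_no_K5_minor n e B simple_e planar_e); split.
- case=> [_|[_|[_|[_|[_|//]]]]]; try exact: connected_in_set1; first exact: qconn.
  exact: connected_in_set2.
- have dis (X Y : {set 'I_n}) : (forall z, z \in X -> z \notin Y) -> forall z, z \in X -> z \notin Y by [].
  have [eux evx] := andP (heads x xp); have [euy evy] := andP (heads y yp).
  have [xy xq] : x != y /\ x \notin q by apply/andP; rewrite -negb_or -in_cons.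
  have [wx wy wq] : [/\ w != x, w != y & w \notin q] by move: wp; rewrite !in_cons !negb_or => /and3P.
  move=> i j z ij; move: i j ij z; apply: K5_pairs; rewrite /B /=; apply: dis => z.
  + by rewrite !in_set1 => /eqP ->.
  + by rewrite in_set1 in_set => /eqP ->.
  + by rewrite !in_set1 => /eqP ->; rewrite eq_sym ne.
  + by rewrite in_set1 in_set2 => /eqP ->; rewrite negb_or (eq_sym x v) (ne _ _ evx) (eq_sym x w) wx.
  + by rewrite in_set1 in_set => /eqP ->.
  + by rewrite !in_set1 => /eqP ->; rewrite eq_sym ne.
  + by rewrite in_set1 in_set2 => /eqP ->; rewrite negb_or (eq_sym y v) (ne _ _ evy) (eq_sym y w) wy.
  + rewrite in_set in_set1 => zq; have [euz _] := andP (heads z (inp z zq)).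
    by rewrite eq_sym ne.
  + rewrite in_set in_set2 => zq; have [_ evz] := andP (heads z (inp z zq)).
    by rewrite negb_or eq_sym ne //=; apply: contraNneq wq => <-.
  + by rewrite in_set1 in_set2 => /eqP ->; rewrite negb_or uv ne.
- have [eux evx] := andP (heads x xp); have [euy evy] := andP (heads y yp).
  have [euz evz] := andP (heads z1 (inp z1 z1q)).
  apply: K5_pairs; rewrite /B /=.
  + by exists x, y; rewrite !in_set1.
  + by exists x, (last y q); rewrite in_set1 in_set sym.
  + by exists x, u; rewrite !in_set1 sym.
  + by exists x, v; rewrite in_set1 in_set2 !eqxx sym.
  + by exists y, z1; rewrite in_set1 in_set.
  + by exists y, u; rewrite !in_set1 sym.
  + by exists y, v; rewrite in_set1 in_set2 !eqxx sym.
  + by exists z1, u; rewrite in_set in_set1 sym.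
  + by exists z1, v; rewrite in_set in_set2 !eqxx sym.
  + by exists u, w; rewrite in_set1 in_set2 !eqxx orbT.
Qed.

Lemma perron_vector_max1 n (e : rel 'I_n) : (0 < n)%N -> symmetric e ->
  exists (x : 'I_n -> RR) u, [/\ forall i, 0 <= x i, forall i, x i <= 1, x u = 1 &
    forall i, adj_sum n e x i = spec_rad e * x i].
Proof.
move=> n0 sym; have [y [y0 y1 yE _]] := spec_rad_perron n e sym n0.
have [u _ umax] := @arg_maxP _ _ _ (Ordinal n0) predT y isT.
have yu : 0 < y u.
  rewrite lt_neqAle y0 andbT eq_sym; apply/eqP => yu0.
  have : sq_norm n y = 0.
    apply: big1 => i _; have -> : y i = 0; last by rewrite expr0n.
    by apply/eqP; rewrite eq_le y0 andbT -yu0; apply: umax.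
  by rewrite y1 => /eqP; rewrite oner_eq0.
exists (fun i => y i / y u), u; split.
- by move=> i; rewrite divr_ge0.
- by move=> i; rewrite ler_pdivrMr // mul1r; apply: umax.
- by rewrite divff // gt_eqF.
- by move=> i; rewrite /adj_sum -mulr_suml -[\sum_(_ | _) _]/(adj_sum n e y i) yE mulrA.
Qed.

(* By K33-freeness a vertex outside the common neighbourhood R of u and v has
   at most two neighbours in R, the edges outside R are sparse, and all entries
   but those at u and v are at most 1/10: the edges lost weigh less than the
   edges gained at u and v. *)
Lemma head_join_quad_form n (e : rel 'I_n) (u v : 'I_n) (x : 'I_n -> RR) :
  simple_graph e -> K33_free e -> (forall A : {set 'I_n}, (deg_sum e A <= 6 * #|A|)%N) ->
  u != v -> (forall i, 0 <= x i) -> x u = 1 -> 95 / 100 <= x v ->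
  (forall z, z != u -> z != v -> x z <= 1 / 10) ->
  quad_form n e x <= quad_form n (head_join u v
    [rel a b | [&& e a b, a \in nbhd e u :&: nbhd e v & b \in nbhd e u :&: nbhd e v]]) x.
Proof.
move=> [sym irr] K33 sparse uv x0 xu xv xz; set f := head_join _ _ _.
pose R := nbhd e u :&: nbhd e v; pose h := [rel a b | [&& e a b, a \in R & b \in R]].
pose B := ~: R :\ u :\ v.
have uR : u \notin R by rewrite !inE irr.
have vR : v \notin R by rewrite !inE irr andbF.
have xB b : b \in B -> 0 <= x b <= 1 / 10.
  by rewrite !inE => /and3P[bv bu _]; rewrite x0 xz.
have xR b : b \in R -> x b <= 1 / 10.
  by move=> bR; apply: xz; [apply: contraNneq uR => <- | apply: contraNneq vR => <-].
have split_sum (F : 'I_n -> RR) : \sum_a F a = F u + F v + \sum_(a in R) F a + \sum_(a in B) F a.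
  have E : \sum_(a | a \notin R) F a = F u + (F v + \sum_(a in B) F a).
    rewrite (bigD1 u) // (bigD1 v) /=; last by rewrite vR eq_sym.
    do 2 congr (_ + _); apply: eq_bigl => a; rewrite /B !in_setD1 in_setC.
    by case: (a == u); case: (a == v); rewrite ?andbF ?andbT.
  by rewrite (bigID (mem R)) /= E; ring.
have Rne a : a \in R -> [/\ a != u, a != v, e a u & e a v].
  move=> aR; split; first by apply: contraNneq uR => <-.
  - by apply: contraNneq vR => <-.
  - by move: aR; rewrite !inE sym => /andP[].
  - by move: aR; rewrite !inE (sym a v) => /andP[].
have Bne a : a \in B -> [/\ a != u, a != v & a \notin R] by rewrite in_setD1 in_setD1 in_setC => /and3P[].
pose gap w := \sum_(b in B | ~~ e w b) x b.
have gap0 w : 0 <= gap w by apply: sumr_ge0.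
have adj_split (g : rel 'I_n) y a : adj_sum n g y a = (if g a u then y u else 0) + (if g a v then y v else 0)
   + \sum_(b in R | g a b) y b + \sum_(b in B | g a b) y b.
  by rewrite /adj_sum big_mkcond split_sum -!big_mkcondr.
have headsE w : (w == u) || (w == v) ->
    [/\ forall b, f w b = (w != b), \sum_(b in R | f w b) x b = \sum_(b in R | e w b) x b &
      \sum_(b in B | f w b) x b = \sum_(b in B | e w b) x b + gap w].
  move=> wuv.
  have fw b : f w b = (w != b) by rewrite /f /head_join; case/orP: wuv => ->; rewrite ?orbT andbT.
  split=> //.
    apply: eq_bigl => b; rewrite fw; have [bR|//] := boolP (b \in R).
    have [bu bv eub evb] := Rne b bR; rewrite !andTb (sym w).
    by case/orP: wuv => /eqP ->; rewrite ?eub ?evb eq_sym ?bu ?bv.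
  rewrite /gap (bigID (e w)) /=; congr (_ + _); apply: eq_bigl => b; rewrite fw;
    have [bB|//] := boolP (b \in B); have [bu bv _] := Bne b bB;
    by case/orP: wuv => /eqP ->; rewrite (eq_sym _ b) ?bu ?bv.
have fu : adj_sum n e x u + gap u <= adj_sum n f x u.
  have [|fw E1 E2] := headsE u; first by rewrite eqxx.
  rewrite !adj_split E1 E2 !fw eqxx irr uv /=.
  have : (if e u v then x v else 0) <= x v by case: ifP.
  lra.
have fv : adj_sum n e x v + gap v <= adj_sum n f x v.
  have [|fw E1 E2] := headsE v; first by rewrite eqxx orbT.
  rewrite !adj_split E1 E2 !fw eqxx irr (eq_sym v u) uv /=.
  have : (if e v u then x u else 0) <= x u by case: ifP.
  lra.
have fR a : a \in R -> adj_sum n e x a - \sum_(b in B | e a b) x b = adj_sum n f x a.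
  move=> aR; have [au av eau eav] := Rne a aR.
  rewrite !adj_split /f /head_join /= eau eav !eqxx !orbT !andbT au av addrK.
  rewrite (negbTE au) (negbTE av) /=.
  have -> : \sum_(b in B | (a != b) && [|| b == u, b == v | [&& e a b, a \in R & b \in R]]) x b = 0.
    apply: big1 => b /andP[bB]; have [bu bv bR] := Bne b bB.
    by rewrite (negbTE bu) (negbTE bv) (negbTE bR) !andbF.
  rewrite addr0; congr (_ + _); apply: eq_bigl => b; have [bR|//] := boolP (b \in R).
  have [bu bv _ _] := Rne b bR; rewrite (negbTE bu) (negbTE bv) aR /= andbT.
  by have [->|//] := eqVneq a b; rewrite irr.
(* A vertex of B misses u or v in [e], so joining it to both brings at least the smaller bound,
   95/100. *)
have fB a : a \in B -> adj_sum n e x a + 95 / 100 - \sum_(b in R | e a b) x b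
    - \sum_(b in B | e a b) x b <= adj_sum n f x a.
  move=> aB; have [au av aR] := Bne a aB.
  rewrite !adj_split /f /head_join /= !eqxx !orbT !andbT au av (negbTE au) (negbTE av) /=.
  have : 0 <= \sum_(b in R | (a != b) && [|| b == u, b == v | [&& e a b, a \in R & b \in R]]) x b by apply: sumr_ge0.
  have : 0 <= \sum_(b in B | (a != b) && [|| b == u, b == v | [&& e a b, a \in R & b \in R]]) x b by apply: sumr_ge0.
  have : (if e a u then x u else 0) + (if e a v then x v else 0) + 95 / 100 <= x u + x v.
    by move: aR; rewrite !inE (sym u) (sym v); case: (e a u); case: (e a v) => //= _; lra.
  lra.
pose S := \sum_(b in B) x b.
have S0 : 0 <= S by apply: sumr_ge0.
have gapS : S <= gap u + gap v.
  rewrite /S /gap [\sum_(b in B | ~~ e u b) _]big_mkcondr [\sum_(b in B | ~~ e v b) _]big_mkcondr -big_split.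
  apply: ler_sum => b bB; have [_ _ bR] := Bne b bB; have xb := x0 b.
  by move: bR; rewrite !inE; case: (e u b); case: (e v b) => //= _; lra.
have cross : \sum_(a in R) x a * \sum_(b in B | e a b) x b = \sum_(b in B) x b * \sum_(a in R | e b a) x a.
  transitivity (\sum_(a in R) \sum_(b in B) if e a b then x a * x b else 0).
    by apply: eq_bigr => a _; rewrite mulr_sumr -big_mkcondr.
  rewrite exchange_big; apply: eq_bigr => b _; rewrite mulr_sumr [RHS]big_mkcondr.
  by apply: eq_bigr => a _; rewrite sym mulrC.
have crossB : \sum_(b in B) x b * \sum_(a in R | e b a) x a <= 2 / 10 * S.
  rewrite /S mulr_sumr; apply: ler_sum => b bB; rewrite mulrC; apply: ler_wpM2r => //.
  have [bu bv _] := Bne b bB.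
  apply: (@le_trans _ _ (\sum_(a in R | e b a) 1 / 10)); first by apply: ler_sum => a /andP[/xR].
  rewrite sumr_const -[leLHS]mulr_natl.
  have : (#|[pred a in R | e b a]| <= 2)%N.
    apply: leq_trans (K33 b u v bu bv uv); apply: subset_leq_card; apply/subsetP => a.
    by rewrite !inE => /andP[/andP[-> ->] ->].
  by rewrite -(ler_nat RR); lra.
have inB : \sum_(a in B) x a * \sum_(b in B | e a b) x b <= 12 * (1 / 10) * S.
  by apply: degenerate_sum => //; lra.
rewrite /quad_form !split_sum xu !mul1r.
have xv0 := x0 v.
have tv : x v * adj_sum n e x v + 95 / 100 * gap v <= x v * adj_sum n f x v.
  have h1 := ler_wpM2l xv0 fv; have h2 := ler_wpM2r (gap0 v) xv; rewrite mulrDr in h1; lra.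
have tR : \sum_(a in R) x a * adj_sum n e x a - \sum_(a in R) x a * \sum_(b in B | e a b) x b
    = \sum_(a in R) x a * adj_sum n f x a.
  rewrite -sumrB; apply: eq_bigr => a aR; rewrite -fR //; ring.
have tB : \sum_(a in B) x a * adj_sum n e x a + 95 / 100 * S
    - \sum_(a in B) x a * \sum_(b in R | e a b) x b
    - \sum_(a in B) x a * \sum_(b in B | e a b) x b <= \sum_(a in B) x a * adj_sum n f x a.
  rewrite /S mulr_sumr -big_split -!sumrB; apply: ler_sum => a aB.
  by have := ler_wpM2l (x0 a) (fB a aB); rewrite /= !mulrBr mulrDr; lra.
rewrite cross in tR.
(* The balance in units of S: at least 0.95 is gained at the heads and 0.95 on B, against losses of
   0.2 on R, 0.2 from B to R and 1.2 inside B. *)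
have gu := gap0 u; have gv := gap0 v.
lra.
Qed.

Lemma head_join_sym (T : eqType) (u v : T) (h : rel T) : symmetric h -> symmetric (head_join u v h).
Proof.
move=> sym a b; rewrite /head_join eq_sym sym; congr (_ && _).
by case: (a == u); case: (a == v); case: (b == u); case: (b == v).
Qed.

Lemma head_join_irr (T : eqType) (u v : T) (h : rel T) : irreflexive (head_join u v h).
Proof. by move=> a; rewrite /head_join eqxx. Qed.

(** K33-freeness bounds the degrees of [h] by 2. A cycle of [h] on K or more vertices contains a
    path excluded from the neighbourhood of u; a shorter one leaves a common neighbour off the cycle
    and completes a double wheel. The final alternative is the equality case of
    [head_join_quad_form]: if no vertex gains at the Perron vector, the graph was already a join. *)
Lemma planar_dominating_pair n (e : rel 'I_n) (K : nat) :
  simple_graph e -> planar e -> 44 * 10 ^+ 15 <= (n%:R : RR) ->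
  2 * (n%:R - 2) <= spec_rad e ^+ 2 -> (K%:R : RR) <= n%:R / 2 ->
  (forall u x p, path e x p -> uniq (x :: p) -> (K <= size (x :: p))%N ->
     {in x :: p, forall z, e u z} -> False) ->
  exists (u v : 'I_n) (h : rel 'I_n) (bs : seq (seq 'I_n)),
  [/\ [/\ u != v, symmetric h, forall a b, h a b -> [/\ e a b, e u a & e v a],
        (forall a, #|[set b | h a b]| <= 2)%N & n%:R / 2 <= (#|nbhd e u :&: nbhd e v|%:R : RR)],
      [/\ uniq (flatten bs), forall a, (a \in flatten bs) = (a != u) && (a != v),
        all (fun b => b != [::]) bs &
        forall a b, a \in flatten bs -> b \in flatten bs ->
          h a b = paths_adj (map size bs) (index a (flatten bs)) (index b (flatten bs))] &
      e =2 head_join u v h \/ spec_rad e < spec_rad (head_join u v h)].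
Proof.
move=> simple_e planar_e n_big rho_big K_small no_path; have [sym irr] := simple_e.
have n0 : (0 < n)%N by rewrite -(ltr_nat RR); lra.
have K33 := planar_K33_free n e simple_e planar_e.
have sparse A := planar_deg_sum n e A simple_e planar_e.
have [x [u [x0 x1 xu xE]]] := perron_vector_max1 n e n0 sym.
have [v [vu xv xz Nuv]] := perron_two_heads n e x _ u sym K33 sparse x0 x1 xu xE rho_big n_big.
have uv : u != v by rewrite eq_sym.
pose R := nbhd e u :&: nbhd e v; pose h := [rel a b | [&& e a b, a \in R & b \in R]].
have symh : symmetric h by move=> a b; rewrite /= sym [X in _ && X]andbC.
have irrh : irreflexive h by move=> a; rewrite /= irr.
have uR : u \notin R by rewrite !inE irr.
have vR : v \notin R by rewrite !inE irr andbF.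
have deg2 a : (#|[set b | h a b]| <= 2)%N.
  have [aR|aR] := boolP (a \in R); last first.
    by rewrite (_ : [set b | h a b] = set0) ?cards0 //; apply/setP => b; rewrite in_set in_set0 /= (negbTE aR) andbF.
  have au : a != u by apply: contraNneq uR => <-.
  have av : a != v by apply: contraNneq vR => <-.
  apply: leq_trans (K33 a u v au av uv); apply: subset_leq_card; apply/subsetP => b.
  by rewrite in_set /= => /and3P[eab _]; rewrite !inE eab => /andP[-> ->].
pose Rest := [set a | (a != u) && (a != v)].
have hRest a b : h a b -> b \in Rest.
  move=> /= /and3P[_ _ bR]; rewrite inE; apply/andP; split.
    by apply: contraNneq uR => <-.
  by apply: contraNneq vR => <-.
have acyclic y p : path h y p -> uniq (y :: p) -> (2 < size (y :: p))%N -> ~~ h (last y p) y.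
  move=> hp U s3; apply/negP => hly.
  have pR z : z \in y :: p -> z \in R.
    have yR : y \in R by move: hly => /= /and3P[].
    have : all (mem R) p by elim: (p) (y) hp => [|b q IH] a //= /andP[/and3P[_ _ ->] /IH].
    by move=> /allP allR; rewrite in_cons => /orP[/eqP -> //|/allR].
  have heads z : z \in y :: p -> e u z && e v z by move=> /pR; rewrite !inE.
  have ep : path e y p by apply: (sub_path _ hp) => a b /and3P[].
  have [Kp|pK] := leqP K (size (y :: p)).
    by apply: (no_path u y p ep U Kp) => z /heads /andP[].
  have [w wR wp] : exists2 w, w \in R & w \notin y :: p.
    have : ~~ (R \subset y :: p).
      apply/negP => /subset_leq_card; rewrite (card_uniqP U) leqNgt.
      suff -> : (size (y :: p) < #|R|)%N by [].
      by apply: leq_trans pK _; rewrite -(ler_nat RR); lra.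
    by case/subsetPn => w wR wp; exists w.
  case: p hp U s3 hly pR heads ep pK wp => [//|y1 q] hp U s3 hly _ heads ep _ wp.
  have /andP[euw evw] : e u w && e v w by move: wR; rewrite !inE.
  apply: (double_wheel_K5 n e u v w y y1 q simple_e planar_e ep U) => //.
    by case: (q) s3.
  by move: hly => /= /and3P[].
have [bs [Ubs mem_bs nonnil adj]] := linear_forest_blocks _ h Rest symh irrh deg2 hRest acyclic.
have mem_bs' a : (a \in flatten bs) = (a != u) && (a != v) by rewrite mem_bs inE.
exists u, v, h, bs; split.
- split=> //; last by rewrite -/R; lra.
  by move=> a b /= /and3P[eab]; rewrite !inE => /andP[-> ->] _.
- by split=> // a b; rewrite !mem_bs => aR bR; apply: adj.
have quad := head_join_quad_form n e u v x simple_e K33 sparse uv x0 xu xv xz.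
rewrite -/R -/h in quad; set f := head_join u v h in quad *.
have symf : symmetric f by apply: head_join_sym.
have lam_quad : spec_rad e * sq_norm n x = quad_form n e x.
  by rewrite /sq_norm mulr_sumr; apply: eq_bigr => i _; rewrite xE; ring.
have [[w w_lt]|no_w] := pselect (exists w, spec_rad e * x w < adj_sum n f x w).
  right; apply: (spec_rad_gt n f symf x _ w) => //; first exact: head_join_irr.
  by rewrite lam_quad.
left.
have le w : adj_sum n f x w <= adj_sum n e x w.
  by rewrite xE leNgt; apply/negP => w_lt; apply: no_w; exists w.
have x_zero w b : (w == u) || (w == v) -> b != w -> ~~ e w b -> x b = 0.
  move=> wuv bw ewb; have := le w; rewrite /adj_sum.
  have -> : \sum_(j | f w j) x j = \sum_(j | e w j) x j + \sum_(j | (j != w) && ~~ e w j) x j.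
    rewrite (bigID (e w)) /=; congr (_ + _); apply: eq_bigl => j; rewrite /f /head_join eq_sym.
      have [->|jw] := eqVneq j w; first by rewrite irr.
      by case/orP: wuv => ->; rewrite ?orbT.
    by case/orP: wuv => ->; rewrite ?orbT andbT.
  rewrite gerDl => h0; apply/eqP; rewrite eq_le x0 andbT; apply: le_trans h0.
  by rewrite (bigD1 b) /= ?bw //= lerDl; apply: sumr_ge0.
have euv : e u v.
  by apply: contraT => nuv; have := x_zero u v; rewrite eqxx vu nuv => /(_ isT isT isT); lra.
(* A missing edge wb forces x b = 0. But b is joined to u in [f] and x u = 1, so its sum in [f] is
   positive, against [le b]. *)
have full w b : (w == u) || (w == v) -> b != u -> b != v -> e w b.
  move=> wuv bu bv; apply: contraT => ewb.
  have bw : b != w by case/orP: wuv => /eqP ->.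
  have xb := x_zero w b wuv bw ewb.
  have := le b; rewrite xE xb mulr0 /adj_sum (bigD1 u) /=; last by rewrite /f /head_join bu eqxx !orbT.
  have : 0 <= \sum_(i | f b i && (i != u)) x i by apply: sumr_ge0.
  lra.
have inR a : a != u -> a != v -> a \in R by move=> au av; rewrite !inE !full ?eqxx ?orbT.
have heads w b : (w == u) || (w == v) -> b != w -> e w b.
  move=> wuv bw; have [bu|bu] := eqVneq b u.
    by case/orP: wuv => /eqP wE; move: bw; rewrite bu wE ?eqxx // sym.
  have [bv|bv] := eqVneq b v; last exact: full.
  by case/orP: wuv => /eqP wE; move: bw; rewrite bv wE ?eqxx.
move=> a b; rewrite /f /head_join.
have [<-|ab] := eqVneq a b; first by rewrite irr.
have [auv|] := boolP ((a == u) || (a == v)).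
  have -> : e a b by apply: heads; rewrite // eq_sym.
  by case/orP: auv => ->; rewrite ?orbT.
rewrite negb_or => /andP[au av]; rewrite (negbTE au) (negbTE av) /=.
have [buv|] := boolP ((b == u) || (b == v)).
  have -> : e a b by rewrite sym; apply: heads.
  by case/orP: buv => ->; rewrite ?orbT.
rewrite negb_or => /andP[bu bv]; rewrite (negbTE bu) (negbTE bv) /=.
by rewrite !inR // !andbT.
Qed.

(** * Pulling paths and stars back from the join *)

Section PullBack.
Variables (n : nat) (e h : rel 'I_n) (u v : 'I_n).
Hypotheses (sym : symmetric e) (symh : symmetric h) (uv : u != v)
  (he : forall a b, h a b -> [/\ e a b, e u a & e v a]).
Let R := nbhd e u :&: nbhd e v.
Hypotheses (irr : irreflexive e) (deg2 : forall a, (#|[set b | h a b]| <= 2)%N).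

(** As [h] lives on R, a vertex outside R other than a head has only heads as neighbours in the
    join, and a fresh vertex of R can stand in for it. Only the pair uv may still fail to be an edge
    of [e]; w is a further fresh vertex kept for that case. Since |R| > 2K, there are K + 1 fresh
    vertices. *)
Lemma head_join_replace K (g : nat -> 'I_n) : (2 * K < #|R|)%N ->
  (forall i j, (i < K)%N -> (j < K)%N -> g i = g j -> i = j) ->
  exists (g' : nat -> 'I_n) w,
  [/\ forall i j, (i < K)%N -> (j < K)%N -> g' i = g' j -> i = j,
      forall i, (i < K)%N -> g' i <> w, w \in R,
      forall i, (i < K)%N -> (g i == u) || (g i == v) -> g' i = g i &
      forall i j, (i < K)%N -> (j < K)%N -> head_join u v h (g i) (g j) ->
        ((g i == u) || (g i == v)) && ((g j == u) || (g j == v)) \/ e (g' i) (g' j)].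
Proof.
move=> RK ginj.
pose im := [set x in [seq g i | i <- iota 0 K]].
have im_mem i : (i < K)%N -> g i \in im.
  by move=> iK; rewrite inE; apply/mapP; exists i; rewrite ?mem_iota.
have imK : (#|im| <= K)%N.
  rewrite cardsE; apply: leq_trans (card_size _) _; by rewrite size_map size_iota.
pose fr := enum (R :\: im).
have frK : (K < size fr)%N.
  rewrite -cardE; have := cardsID im R; have := subset_leq_card (subsetIr R im).
  by move=> h1 h2; move: RK; clear -h1 h2 imK; lia.
have frP k : (k <= K)%N -> nth u fr k \in R /\ nth u fr k \notin im.
  move=> kK; have : nth u fr k \in fr by apply: mem_nth; apply: leq_ltn_trans frK.
  by rewrite mem_enum in_setD => /andP[].
have frinj k k' : (k <= K)%N -> (k' <= K)%N -> nth u fr k = nth u fr k' -> k = k'.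
  move=> kK k'K /eqP; rewrite nth_uniq ?enum_uniq ?(leq_ltn_trans _ frK) //; by move/eqP.
pose ok x := [|| x == u, x == v | x \in R].
pose g' i := if ok (g i) then g i else nth u fr i.
have uR : u \notin R by rewrite !inE irr.
have vR : v \notin R by rewrite !inE irr andbF.
exists g', (nth u fr K); split.
- move=> i j iK jK; rewrite /g'; case: ifP => _; case: ifP => _; first exact: ginj.
  + by move=> E; have [_] := frP j (ltnW jK); rewrite -E im_mem.
  + by move=> E; have [_] := frP i (ltnW iK); rewrite E im_mem.
  + by apply: frinj; apply: ltnW.
- move=> i iK; rewrite /g'; case: ifP => _.
    by move=> E; have [_] := frP K (leqnn K); rewrite -E im_mem.
  by move/(frinj _ _ (ltnW iK) (leqnn K)) => E; rewrite E ltnn in iK.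
- by have [] := frP K (leqnn K).
- by move=> i _ hd; rewrite /g' /ok orbA hd.
- move=> i j iK jK /andP[ne H].
  have g'R k : (k < K)%N -> ~~ ((g k == u) || (g k == v)) -> g' k \in R.
    move=> kK; rewrite /g' /ok orbA => /negbTE ->; rewrite orFb; case: ifP => // _.
    by have [] := frP k (ltnW kK).
  have g'h k : (g k == u) || (g k == v) -> g' k = g k by move=> hd; rewrite /g' /ok orbA hd.
  have headR w x : (w == u) || (w == v) -> x \in R -> e w x.
    by rewrite !inE => /orP[] /eqP -> /andP[].
  have [hi|hi] := boolP ((g i == u) || (g i == v)); have [hj|hj] := boolP ((g j == u) || (g j == v)).
  + by left.
  + by right; rewrite (g'h i hi); apply: headR => //; apply: g'R.
  + by right; rewrite sym (g'h j hj); apply: headR => //; apply: g'R.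
  + right; move: hi hj H; rewrite !negb_or => /andP[/negbTE iu /negbTE iv] /andP[/negbTE ju /negbTE jv].
    rewrite iu iv ju jv /= => hij.
    have [eij eui evi] := he _ _ hij; have [_ euj evj] : [/\ e (g j) (g i), e u (g j) & e v (g j)].
      by apply: he; rewrite symh.
    by rewrite /g' /ok !inE eui evi euj evj !orbT.
Qed.

(** A path uses the pair uv at most once. If it is not an edge of [e], w is inserted between the
    heads and the last vertex is dropped. *)
Lemma head_join_has_path L : (2 * L < #|R|)%N -> has_path L (head_join u v h) -> has_path L e.
Proof.
move=> RL [g [ginj gadj]].
have [g' [w [g'inj g'w wR g'h g'adj]]] := head_join_replace L g RL ginj.
have [euw evw] : e u w /\ e v w by move: wR; rewrite !inE => /andP.
have head i : (i < L)%N -> (g i == u) || (g i == v) -> e (g' i) w.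
  by move=> iL hd; rewrite g'h //; case/orP: hd => /eqP ->.
have [[i [iL bad]]|ok] := pselect (exists i, (i.+1 < L)%N /\ ~~ e (g' i) (g' i.+1)); last first.
  exists g'; split=> // i iL; apply/negPn/negP => bad; apply: ok; by exists i.
have iL' := ltnW iL.
have [/andP[hi hj]|eij] := g'adj i i.+1 iL' iL (gadj i iL); last by rewrite eij in bad.
have only j : (j.+1 < L)%N -> j != i -> e (g' j) (g' j.+1).
  move=> jL ji; have jL' := ltnW jL.
  have [/andP[hj1 hj2]|//] := g'adj j j.+1 jL' jL (gadj j jL).
  exfalso; have heads k : (k < L)%N -> (g k == u) || (g k == v) -> k = i \/ k = i.+1.
    move=> kL hk; have := uv; have gii : g i <> g i.+1 by move/(ginj _ _ iL' iL)/n_Sn.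
    case/orP: hi => /eqP Ei; case/orP: hj => /eqP Ej; rewrite Ei Ej in gii => //.
      by case/orP: hk => /eqP Ek _; [left|right]; apply: ginj; rewrite ?Ek.
    by case/orP: hk => /eqP Ek _; [right|left]; apply: ginj; rewrite ?Ek.
  by have h1 := heads j jL' hj1; have h2 := heads j.+1 jL hj2; move/eqP: ji; clear -h1 h2; lia.
exists (fun j => if (j <= i)%N then g' j else if j == i.+1 then w else g' j.-1); split.
  move=> j k jL kL; have jL1 : (j.-1 < L)%N := leq_ltn_trans (leq_pred j) jL.
  have kL1 : (k.-1 < L)%N := leq_ltn_trans (leq_pred k) kL.
  case: leqP => ij; case: leqP => ik.
  - exact: g'inj.
  - case: eqP => ki; first by move/(g'w j jL).
    by move/(g'inj _ _ jL kL1); clear -ij ik ki; lia.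
  - case: eqP => ji; first by move/esym/(g'w k kL).
    by move/(g'inj _ _ jL1 kL); clear -ij ik ji; lia.
  - case: eqP => ji; case: eqP => ki.
    + by rewrite ji ki.
    + by move/esym/(g'w _ kL1).
    + by move/(g'w _ jL1).
    + by move/(g'inj _ _ jL1 kL1); clear -ij ik ji ki; lia.
move=> j jL /=; have [ji|ij] := ltnP j i.
  by rewrite (ltnW ji); apply: only; rewrite // ltn_eqF.
have [->|ji] := eqVneq j i.
  by rewrite leqnn eqxx; apply: head.
have ij' : (i < j)%N by rewrite ltn_neqAle eq_sym ji ij.
rewrite [(j <= i)%N]leqNgt ij' /=.
have -> : (j.+1 == i.+1) = false by rewrite eqSS (negbTE ji).
have [->|ji'] := eqVneq j i.+1; first by rewrite sym; apply: head.
have j0 : (0 < j)%N := leq_ltn_trans (leq0n i) ij'.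
have := only j.-1; rewrite prednK //; apply; first exact: ltnW.
by apply: contraNneq ji' => <-; rewrite prednK.
Qed.

(** With t >= 5 the centre is a head, so the pair uv can only be the first edge of a leg. If it is
    not an edge of [e], that leg starts with w instead and loses its last vertex. *)
Lemma head_join_has_star t m : (4 < t)%N -> (1 < m)%N -> (2 * (t * m).+1 < #|R|)%N ->
  has_star t m (head_join u v h) -> has_star t m e.
Proof.
move=> t5 m2 RL [c [L [Linj Lc cL LL]]]; have m0 := ltnW m2.
pose K := (t * m).+1; pose g k := if k is k'.+1 then L (k' %/ m)%N (k' %% m)%N else c.
have rangek k : (k < t * m)%N -> (k %/ m < t)%N /\ (k %% m < m)%N.
  by move=> kK; rewrite ltn_divLR // ltn_mod.
have ginj i j : (i < K)%N -> (j < K)%N -> g i = g j -> i = j.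
  case: i j => [|i] [|j] //=; rewrite /K ltnS => iK jK.
  - by move=> /esym; have [a b] := rangek j jK; move/(Lc _ _ a b).
  - by have [a b] := rangek i iK; move/(Lc _ _ a b).
  - have [a b] := rangek i iK; have [a' b'] := rangek j jK.
    by move=> /(Linj _ _ _ _ a b a' b')[d r]; rewrite (divn_eq i m) (divn_eq j m) d r.
have [g' [w [g'inj g'w wR g'h g'adj]]] := head_join_replace K g RL ginj.
have idx i j : (i < t)%N -> (j < m)%N -> ((i * m + j).+1 < K)%N.
  move=> it jm; rewrite /K ltnS; apply: leq_trans (_ : i.+1 * m <= _)%N.
    by rewrite mulSn addnC ltn_add2r.
  by rewrite leq_mul2r it orbT.
have gL i j : (j < m)%N -> g (i * m + j).+1 = L i j.
  by move=> jm; rewrite /= divnMDl // divn_small // addn0 modnMDl modn_small.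
have K0 : (0 < K)%N by [].
have chead : (c == u) || (c == v).
  apply: contraT; rewrite negb_or => /andP[cu cv].
  have : (#|[set L i 0%N | i : 'I_t]| <= 4)%N.
    apply: (@leq_trans #|[set u; v] :|: [set b | h c b]|).
      apply: subset_leq_card; apply/subsetP => _ /imsetP[i _ ->].
      have /andP[_] := cL i (ltn_ord i); rewrite (negbTE cu) (negbTE cv) !inE /=.
      by case/or3P => ->; rewrite ?orbT.
    apply: leq_trans (leq_card_setU _ _) _; rewrite cards2 uv.
    by rewrite (leq_add (leqnn 2) (deg2 c)).
  rewrite card_imset ?card_ord; first by rewrite leqNgt t5.
  by move=> i j /(Linj _ _ _ _ (ltn_ord i) m0 (ltn_ord j) m0)[/val_inj].
pose d := if c == u then v else u.
have heads k : (k < K)%N -> (g k == u) || (g k == v) -> k = 0%N \/ g k = d.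
  move=> kK /orP[] /eqP E; rewrite /d; case: eqP => cE.
  - by left; apply: ginj; rewrite // E -cE.
  - by right.
  - by right.
  - by left; apply: ginj; rewrite // E; case/orP: chead => /eqP.
pose L' i j := g' (i * m + j).+1.
have c'E : g' 0%N = c by rewrite g'h.
have L'inj i j i' j' : (i < t)%N -> (j < m)%N -> (i' < t)%N -> (j' < m)%N ->
    L' i j = L' i' j' -> i = i' /\ j = j'.
  move=> it jm it' jm' /(g'inj _ _ (idx i j it jm) (idx i' j' it' jm')) [E].
  have dm a b : (b < m)%N -> ((a * m + b) %/ m = a)%N by move=> bm; rewrite divnMDl // divn_small // addn0.
  have ii : i = i' by rewrite -(dm i j jm) E dm.
  by split=> //; move: E; rewrite ii => /addnI.
have L'c i j : (i < t)%N -> (j < m)%N -> L' i j <> c.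
  by move=> it jm; rewrite -c'E => /(g'inj _ _ (idx i j it jm) K0).
have L'w i j : (i < t)%N -> (j < m)%N -> L' i j <> w by move=> it jm; apply: g'w; apply: idx.
have ecw : e c w by move: wR chead; rewrite !inE => /andP[euw evw] /orP[] /eqP ->.
have L'L i j : (i < t)%N -> (j.+1 < m)%N -> e (L' i j) (L' i j.+1).
  move=> it jm; have jm' := ltnW jm.
  have fadj : head_join u v h (g (i * m + j).+1) (g (i * m + j.+1).+1) by rewrite !gL //; apply: LL.
  have [/andP[h1 h2]|//] := g'adj _ _ (idx i j it jm') (idx i j.+1 it jm) fadj.
  exfalso; have [//|E1] := heads _ (idx i j it jm') h1; have [//|E2] := heads _ (idx i j.+1 it jm) h2.
  rewrite gL // in E1; rewrite gL // -E1 in E2.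
  by have [_ /esym/n_Sn] := Linj _ _ _ _ it jm it jm' E2.
have cL' i : (i < t)%N -> e c (L' i 0%N) \/ L i 0%N = d /\ L' i 0%N = d.
  move=> it; have fadj : head_join u v h (g 0%N) (g (i * m + 0).+1) by rewrite gL //; apply: cL.
  have [/andP[_ h2]|] := g'adj _ _ K0 (idx i 0%N it m0) fadj.
  - have [//|E] := heads _ (idx i 0%N it m0) h2.
    right; split; first by rewrite -(gL i 0%N m0) E.
    by rewrite /L' (g'h _ (idx i 0%N it m0) h2) E.
  - by rewrite c'E; left.
have [[i0 [it0 bad]]|ok] := pselect (exists i, (i < t)%N /\ ~~ e c (L' i 0%N)); last first.
  exists c, L'; split=> // i it; apply/negPn/negP => bad; apply: ok; by exists i.
have [ecL|[LE L'E]] := cL' i0 it0; first by rewrite ecL in bad.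
have edw : e d w.
  by rewrite /d; case: ifP => _; move: wR; rewrite !inE => /andP[].
exists c, (fun i j => if i == i0 then (if j is j'.+1 then L' i j' else w) else L' i j); split.
- move=> i j i' j' it jm it' jm'; case: eqP => ii; case: eqP => ii'.
  + case: j j' jm jm' => [|j] [|j'] jm jm'.
    * by rewrite ii ii'.
    * by move/esym/(L'w _ _ it' (ltnW jm')).
    * by move/(L'w _ _ it (ltnW jm)).
    * by move/(L'inj _ _ _ _ it (ltnW jm) it' (ltnW jm'))=> [-> ->].
  + case: j jm => [|j] jm; first by move/esym/(L'w _ _ it' jm').
    by move/(L'inj _ _ _ _ it (ltnW jm) it' jm') => [E]; rewrite -E in ii'.
  + case: j' jm' => [|j'] jm'; first by move/(L'w _ _ it jm).
    by move/(L'inj _ _ _ _ it jm it' (ltnW jm')) => [E]; rewrite E in ii.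
  + exact: L'inj.
- move=> i j it jm; case: eqP => _; last exact: L'c.
  case: j jm => [|j] jm; last by apply: L'c => //; apply: ltnW.
  by move=> wc; move: ecw; rewrite wc irr.
- move=> i it; case: eqP => // ii.
  have [//|[E _]] := cL' i it; exfalso; rewrite -LE in E.
  by have [] := Linj _ _ _ _ it m0 it0 m0 E.
- move=> i j it jm; case: eqP => ii; last exact: L'L.
  case: j jm => [|j] jm; last by apply: L'L => //; apply: ltnW.
  by rewrite ii L'E sym.
Qed.
End PullBack.

(** * The spectral radius of a join *)

(* Entry i (1 <= i <= k) of the solution of lam y_i = 2 + y_(i-1) + y_(i+1),
   y_0 = y_(k+1) = 0, where lam = q + 1/q. *)
Definition path_vec (q : RR) (k i : nat) : RR :=
  2 * q / (1 - q) ^+ 2 * (1 - (q ^+ i + q ^+ (k.+1 - i)) / (1 + q ^+ k.+1)).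

(* Up to affine terms, the sum of the entries of [path_vec q k] is
   [- path_deficit q k]. *)
Definition path_deficit (q : RR) (k : nat) : RR := (q - q ^+ k.+1) / (1 + q ^+ k.+1).

Definition deficit (q : RR) (s : seq nat) : RR := \sum_(k <- s) path_deficit q k.

Fixpoint blocks_vec (q : RR) (s : seq nat) (x : nat) : RR :=
  if s is k :: s' then if (x < k)%N then path_vec q k x.+1 else blocks_vec q s' (x - k) else 0.

Section JoinSums.
Variables (n : nat) (s : seq nat).
Hypotheses (n2 : (1 < n)%N) (sn : sumn s = (n - 2)%N).

Lemma sum_low (F : nat -> RR) : \sum_(j < n) F j =
  \sum_(x < sumn s) F x + F (n - 2)%N + F (n - 1)%N.
Proof.
rewrite -(big_mkord predT) -(big_mkord predT (fun i => F i)) sn.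
have E : n = (n - 2).+2 by lia.
rewrite [in LHS]E !big_nat_recr //=; congr (_ + F _); lia.
Qed.

Lemma adj_sum_low (z : 'I_n -> RR) (zn : nat -> RR) (i : 'I_n) : (forall j : 'I_n, z j = zn j) ->
  (i < n - 2)%N -> adj_sum n (K2_join n s) z i =
  zn (n - 2)%N + zn (n - 1)%N + (if paths_adj s i i.+1 then zn i.+1 else 0)
    + (if (0 < i)%N && paths_adj s i.-1 i then zn i.-1 else 0).
Proof.
move=> zE il.
pose F x := if ((i : nat) != x) && [|| (n - 2 <= i)%N, (n - 2 <= x)%N | paths_adj s i x] then zn x else 0.
rewrite /adj_sum big_mkcond (eq_bigr (fun j : 'I_n => F j)) => [|j _]; last first.
  by rewrite /F /K2_join -val_eqE zE.
rewrite sum_low /F leqnn !orbT !andbT [(n - 2 <= i)%N]leqNgt il /=.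
have -> : (n - 2 <= n - 1)%N by lia.
have -> : ((i : nat) != n - 2)%N by lia.
have -> : ((i : nat) != n - 1)%N by lia.
rewrite /= -[LHS]addrA [LHS]addrC -!addrA; congr (_ + (_ + _)).
have hi x : (x < sumn s)%N -> (if ((i : nat) != x) && ((n - 2 <= x)%N || paths_adj s i x) then zn x else 0) =
    (if (x == i.+1) && paths_adj s i i.+1 then zn x else 0)
    + (if (x.+1 == i) && paths_adj s i.-1 i then zn x else 0).
  rewrite sn => xs; rewrite [(n - 2 <= x)%N]leqNgt xs /=.
  have [->|x1] := eqVneq x i.+1.
    by rewrite (gtn_eqF (_ : (i < i.+2)%N)) //= addr0 ltn_eqF.
  have [xi|x2] := eqVneq x.+1 i.
    by rewrite -xi /= add0r paths_adj_sym (gtn_eqF (ltnSn x)).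
  rewrite addr0; case: ifP => // /andP[_ /paths_adj_consecutive].
  by rewrite /consecutive [i.+1 == x]eq_sym (negbTE x1) (negbTE x2).
rewrite (eq_bigr _ (fun (x : 'I_(sumn s)) _ => hi x (ltn_ord x))) big_split /=; congr (_ + _).
  case adj: (paths_adj s i i.+1); last by rewrite big1 // => x _; rewrite andbF.
  have /andP[_ lt] := paths_adj_lt _ _ _ adj.
  rewrite (bigD1 (Ordinal lt)) //= eqxx big1 ?addr0 // => x.
  by rewrite -val_eqE /= => /negbTE ->.
case: posnP => [i0|i0] /=; first by rewrite big1 // => x _; rewrite i0.
case adj: (paths_adj s i.-1 i); last by rewrite big1 // => x _; rewrite andbF.
have /andP[lt _] := paths_adj_lt _ _ _ adj.
rewrite (bigD1 (Ordinal lt)) //= prednK // eqxx big1 ?addr0 // => x.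
rewrite -val_eqE /= => ne; have -> : (x.+1 == i) = false; last by [].
by apply/negbTE; apply: contraNneq ne => <-.
Qed.

End JoinSums.

Section Weights.
Variable q : RR.
Hypothesis q01 : 0 < q < 1.

Let q0 : 0 < q. Proof. by case/andP: q01. Qed.
Let q1 : q < 1. Proof. by case/andP: q01. Qed.
Let qX0 k : 0 < q ^+ k. Proof. exact: exprn_gt0. Qed.
Let den0 k : 0 < 1 + q ^+ k. Proof. by apply: addr_gt0. Qed.
Let den k : 1 + q ^+ k != 0. Proof. by rewrite gt_eqF. Qed.
Let dq : 1 - q != 0. Proof. by rewrite gt_eqF // subr_gt0. Qed.

Lemma path_vec_rec k i : (0 < i <= k)%N ->
  path_vec q k i.-1 + path_vec q k i.+1 + 2 = (q + q^-1) * path_vec q k i.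
Proof.
case: i => [//|i] /= ik; rewrite /path_vec.
have -> : (k.+1 - i = (k - i.+1).+2)%N by lia.
have -> : (k.+1 - i.+1 = (k - i.+1).+1)%N by lia.
have -> : (k.+1 - i.+2 = k - i.+1)%N by lia.
rewrite !exprS; field.
by rewrite -exprS den dq gt_eqF.
Qed.

Lemma path_vec_0 k : path_vec q k 0 = 0.
Proof. by rewrite /path_vec expr0 subn0 divff ?den // subrr mulr0. Qed.

Lemma path_vec_last k : path_vec q k k.+1 = 0.
Proof. by rewrite /path_vec subnn expr0 [q ^+ _ + 1]addrC divff ?den // subrr mulr0. Qed.

Lemma sum_path_vec k : \sum_(i < k) path_vec q k i.+1 =
  2 * q / (1 - q) ^+ 2 * (k%:R - 2 / (1 - q) * path_deficit q k).
Proof.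
rewrite -mulr_sumr; congr (_ * _).
rewrite big_split /= sumr_const card_ord; congr (_ + _).
rewrite sumrN -mulr_suml big_split /=; congr (- _).
have geo : \sum_(i < k) q ^+ i.+1 = (q - q ^+ k.+1) / (1 - q).
  elim: k => [|k IH]; first by rewrite big_ord0 expr1 subrr mul0r.
  by rewrite big_ord_recr /= IH !exprS; field.
have -> : \sum_(i < k) q ^+ (k.+1 - i.+1) = \sum_(i < k) q ^+ i.+1.
  rewrite [RHS](reindex_inj rev_ord_inj) /=; apply: eq_bigr => i _.
  by congr (_ ^+ _); have := ltn_ord i; lia.
by rewrite geo /path_deficit; field; rewrite dq den.
Qed.

(** At an end of a block the absent neighbour has the value [path_vec q k 0] or [path_vec q k k.+1],
    both 0, so the recurrence of [path_vec] survives the concatenation. *)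
Lemma blocks_vec_rec s x : (x < sumn s)%N ->
  2 + (if paths_adj s x x.+1 then blocks_vec q s x.+1 else 0)
    + (if (0 < x)%N && paths_adj s x.-1 x then blocks_vec q s x.-1 else 0)
  = (q + q^-1) * blocks_vec q s x.
Proof.
elim: s x => [//|k s IH] x /= xs; rewrite !paths_adj_cons.
have [xk|kx] := ltnP x k.
  rewrite -path_vec_rec; last by lia.
  have -> : (if if true && (x.+1 < k)%N then consecutive x x.+1
       else [&& false, (k <= x.+1)%N & paths_adj s (x - k) (x.+1 - k)]
     then if (x.+1 < k)%N then path_vec q k x.+2 else blocks_vec q s (x.+1 - k) else 0) = path_vec q k x.+2.
    rewrite /= /consecutive eqxx /=; case: (ltnP x.+1 k) => //= h.
    have -> : k = x.+1 by lia.
    by rewrite path_vec_last.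
  have -> : (if (0 < x)%N && (if (x.-1 < k)%N && true then consecutive x.-1 x
       else [&& (k <= x.-1)%N, false & paths_adj s (x.-1 - k) (x - k)])
     then if (x.-1 < k)%N then path_vec q k x.-1.+1 else blocks_vec q s (x.-1 - k) else 0) = path_vec q k x.
    case: x xk {xs} => [|x] xk /=; first by rewrite path_vec_0.
    by rewrite (ltnW xk) /consecutive eqxx.
  by rewrite /=; ring.
have -> : (x.+1 < k)%N = false by lia.
have -> : (k <= x.+1)%N by lia.
rewrite !andbF /= -IH; last by lia.
rewrite -subSn //; congr (_ + _).
have [kx1|xk1] := ltnP k x.
  have -> : (0 < x)%N by lia.
  have -> : (0 < x - k)%N by lia.
  have -> : (k <= x.-1)%N by lia.
  have -> : (x.-1 < k)%N = false by lia.
  by have -> : (x.-1 - k = (x - k).-1)%N by lia.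
have -> : (x - k)%N = 0%N by lia.
rewrite /=; case: ifP => // /andP[x0 /and3P[]]; lia.
Qed.

(** For a fixed total order only [deficit] depends on the list, with a negative coefficient: a
    smaller deficit means a larger sum. *)
Lemma sum_blocks_vec s : \sum_(x < sumn s) blocks_vec q s x =
  2 * q / (1 - q) ^+ 2 * ((sumn s)%:R - 2 / (1 - q) * deficit q s).
Proof.
rewrite /deficit; elim: s => [|k s IH] /=; first by rewrite big_ord0 big_nil mulr0 subrr mulr0.
rewrite big_split_ord /= big_cons natrD.
have -> : \sum_(i < k) (if (i < k)%N then path_vec q k i.+1 else blocks_vec q s (i - k)) =
   \sum_(i < k) path_vec q k i.+1 by apply: eq_bigr => i _; rewrite ltn_ord.
rewrite (eq_bigr (fun i : 'I_(sumn s) => blocks_vec q s i)) => [|i _]; last first.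
  by rewrite ltnNge leq_addr /= addKn.
by rewrite IH sum_path_vec; ring.
Qed.

Section Join.
Variables (n : nat) (s : seq nat).
Hypotheses (n2 : (1 < n)%N) (sn : sumn s = (n - 2)%N).

Let y (i : 'I_n) : RR := if (i < n - 2)%N then blocks_vec q s i else 1.

Let total : RR := \sum_(x < sumn s) blocks_vec q s x.

Lemma adj_sum_join_low (i : 'I_n) : (i < n - 2)%N ->
  adj_sum n (K2_join n s) y i = (q + q^-1) * y i.
Proof.
move=> il; pose yn x := if (x < n - 2)%N then blocks_vec q s x else 1.
rewrite (adj_sum_low n s n2 sn y yn) // /yn ltnn [(n - 1 < n - 2)%N](_ : _ = false); last by lia.
rewrite /y il -blocks_vec_rec ?sn //; congr (_ + _ + _).
  by case: ifP => // /paths_adj_lt/andP[_]; rewrite sn => ->.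
case: ifP => // /andP[_ /paths_adj_lt/andP[+ _]]; by rewrite sn => ->.
Qed.

Lemma adj_sum_join_head (i : 'I_n) : (n - 2 <= i)%N ->
  adj_sum n (K2_join n s) y i = 1 + total.
Proof.
move=> hi; pose F x := if (i : nat) != x then (if (x < n - 2)%N then blocks_vec q s x else 1) else 0.
rewrite /adj_sum big_mkcond (eq_bigr (fun j : 'I_n => F j)) => [|j _]; last first.
  by rewrite /F /K2_join hi -val_eqE /= andbT.
have i_n := ltn_ord i; rewrite (sum_low n s n2 sn) /F ltnn [(n - 1 < n - 2)%N](_ : _ = false); last by lia.
have -> : \sum_(x < sumn s) (if (i : nat) != x then (if (x < n - 2)%N then blocks_vec q s x else 1) else 0) = total.
  apply: eq_bigr => x _; have xl : (x < n - 2)%N by rewrite -sn ltn_ord.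
  by rewrite xl (_ : ((i : nat) != x) = true) //; lia.
have [E|E] := eqVneq (i : nat) (n - 2)%N.
  by rewrite E (_ : (n - 2 != n - 1)%N = true) /= ?addr0 1?addrC //; lia.
have -> : (i : nat) = (n - 1)%N by lia.
by rewrite eqxx /= addr0 addrC.
Qed.

(** Whatever q is, [y] satisfies the eigenvalue equation for q + 1/q exactly on the blocks; the
    assumption is a surplus at the heads, which [spec_rad_gt] turns into a strict bound. *)
Lemma spec_rad_join_gt : q + q^-1 < 1 + total -> q + q^-1 < spec_rad (K2_join n s).
Proof.
move=> lt; have [sym irr] := K2_join_simple n s.
have u_lt : (n - 2 < n)%N by lia.
apply: (spec_rad_gt n (K2_join n s) sym y (q + q^-1) (Ordinal u_lt)) => //.
  rewrite /quad_form /sq_norm mulr_sumr; apply: ler_sum => i _.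
  have [il|hi] := ltnP i (n - 2); first by rewrite adj_sum_join_low // expr2 mulrCA.
  by rewrite adj_sum_join_head // /y ltnNge hi /= expr1n mulr1 mul1r ltW.
by rewrite adj_sum_join_head // /y /= ltnn mulr1.
Qed.

(** The defect of [y] in the eigenvalue equation is orthogonal to the Perron vector z. Were it
    positive at the heads, z would vanish there and then, by the equation at a head, everywhere. *)
Lemma spec_rad_join_le : spec_rad (K2_join n s) = q + q^-1 -> q + q^-1 <= 1 + total.
Proof.
move=> rhoE; rewrite leNgt; apply/negP => lt.
have [sym irr] := K2_join_simple n s.
have [z [z0 z1 zE _]] := spec_rad_perron n (K2_join n s) sym (ltnW n2).
have lam0 : 0 < q + q^-1 by rewrite addr_gt0 // invr_gt0.
have u_lt : (n - 2 < n)%N by lia.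
have v_lt : (n - 1 < n)%N by lia.
have E : \sum_i z i * adj_sum n (K2_join n s) y i = \sum_i (q + q^-1) * (z i * y i).
  rewrite sum_adjC //; apply: eq_bigr => i _; rewrite zE rhoE; ring.
have heads_zero (i : 'I_n) : (n - 2 <= i)%N -> z i = 0.
  move=> hi; have : \sum_j z j * ((q + q^-1) * y j - adj_sum n (K2_join n s) y j) = 0.
    under eq_bigr do rewrite mulrBr.
    rewrite sumrB E; apply/eqP; rewrite subr_eq0; apply/eqP/eq_bigr => j _; ring.
  move/eqP; rewrite psumr_eq0 => [/allP H|j _].
    have := H i (mem_index_enum _); rewrite adj_sum_join_head // /y ltnNge hi /= mulr1 mulf_eq0.
    by rewrite subr_eq0 (gt_eqF lt) orbF => /eqP.
  have [jl|hj] := ltnP j (n - 2); first by rewrite adj_sum_join_low // subrr mulr0.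
  by rewrite adj_sum_join_head // /y ltnNge hj /= mulr1 mulr_ge0 // subr_ge0 ltW.
have : adj_sum n (K2_join n s) z (Ordinal u_lt) = 0 by rewrite zE heads_zero //= mulr0.
move/eqP; rewrite /adj_sum psumr_eq0 => [/allP H|//].
have zz j : z j = 0.
  have [jl|hj] := ltnP j (n - 2); last exact: heads_zero.
  have := H j (mem_index_enum _); rewrite /K2_join /= leqnn andbT -val_eqE /= => /implyP h.
  by apply/eqP/h; rewrite gtn_eqF.
have := z1; rewrite /sq_norm big1 => [/eqP|j _]; first by rewrite eq_sym oner_eq0.
by rewrite zz expr0n.
Qed.
End Join.

Lemma deficit_le_of_spec_rad n s s' : (1 < n)%N -> sumn s = (n - 2)%N -> sumn s' = (n - 2)%N ->
  spec_rad (K2_join n s) = q + q^-1 -> spec_rad (K2_join n s') <= q + q^-1 ->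
  deficit q s <= deficit q s'.
Proof.
move=> n2 sn sn' rs rs'; rewrite leNgt; apply/negP => lt.
have := spec_rad_join_le n s n2 sn rs; rewrite sum_blocks_vec sn => le.
have : q + q^-1 < spec_rad (K2_join n s'); last by rewrite ltNge rs'.
apply: (spec_rad_join_gt n s' n2 sn'); apply: le_lt_trans le _.
rewrite sum_blocks_vec sn' ltrD2l.
have c0 : 0 < 2 * q / (1 - q) ^+ 2 by apply: divr_gt0; [exact: mulr_gt0|apply: exprn_gt0; rewrite subr_gt0].
rewrite ltr_pM2l // ltrD2l ltrN2 ltr_pM2l // divr_gt0 // subr_gt0 //.
Qed.
End Weights.

(** * Optimal block sizes *)

Lemma deficit_cons q k s : deficit q (k :: s) = path_deficit q k + deficit q s.
Proof. by rewrite /deficit big_cons. Qed.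

Lemma deficit_cat q s s' : deficit q (s ++ s') = deficit q s + deficit q s'.
Proof. by rewrite /deficit big_cat. Qed.

Lemma deficit_nseq q k c : deficit q (nseq k c) = k%:R * path_deficit q c.
Proof. by rewrite /deficit big_nseq -Monoid.iteropE /= -[iterop _ _ _ _]/(_ *+ k) mulr_natl. Qed.

Section Concavity.
Variable q : RR.
Hypothesis q01 : 0 < q < 1.
Local Notation w := (path_deficit q).

Lemma path_deficit_step k :
  w k.+1 - w k = (1 - q ^+ 2) * q ^+ k.+1 / ((1 + q ^+ k.+1) * (1 + q ^+ k.+2)).
Proof.
have /andP[q0 q1] := q01.
have d j : 1 + q ^+ j != 0 by rewrite gt_eqF // addr_gt0 // exprn_gt0.
have := d k.+1; have := d k.+2; rewrite /path_deficit !exprS => d2 d1.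
by field; rewrite d1 d2.
Qed.

Lemma path_deficit_step_gt0 k : 0 < w k.+1 - w k.
Proof.
have /andP[q0 q1] := q01; rewrite path_deficit_step.
have X j : 0 < q ^+ j by exact: exprn_gt0.
have d j : 0 < 1 + q ^+ j by rewrite addr_gt0.
have h : 0 < 1 - q ^+ 2 by rewrite subr_gt0 exprn_ilt1 // ltW.
by rewrite divr_gt0 ?mulr_gt0.
Qed.

Lemma path_deficit_step_le k : (0 < k)%N -> w k.+1 - w k <= q ^+ 2.
Proof.
case: k => // k _; have /andP[q0 q1] := q01; rewrite path_deficit_step.
have X j : 0 < q ^+ j by exact: exprn_gt0.
have X1 j : q ^+ j <= 1 by rewrite exprn_ile1 // ltW.
have d j : 0 < 1 + q ^+ j by rewrite addr_gt0.
rewrite ler_pdivrMr ?mulr_gt0 //.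
have -> : q ^+ k.+2 = q ^+ 2 * q ^+ k by rewrite !exprS; ring.
have := X1 k; have := X k; have := X 2; have := X k.+3; move: (q ^+ k) (q ^+ 2) (q ^+ k.+3) => a b c c0 b0 a0 a1.
have h1 : b * a <= b by rewrite ler_piMr // ltW.
have h2 : 0 < b * a by rewrite mulr_gt0.
have h3 : b <= b * ((1 + b * a) * (1 + c)).
  rewrite ler_peMr ?ltW //; nra.
apply: le_trans h3; nra.
Qed.

Lemma path_deficit_step_decr k : w k.+2 - w k.+1 < w k.+1 - w k.
Proof.
have /andP[q0 q1] := q01; rewrite !path_deficit_step.
have X j : 0 < q ^+ j by exact: exprn_gt0.
have d j : 0 < 1 + q ^+ j by rewrite addr_gt0.
rewrite ltr_pdivrMr ?mulr_gt0 // mulrAC ltr_pdivlMr ?mulr_gt0 //.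
rewrite -subr_gt0.
have -> : (1 - q ^+ 2) * q ^+ k.+1 * ((1 + q ^+ k.+2) * (1 + q ^+ k.+3)) -
  (1 - q ^+ 2) * q ^+ k.+2 * ((1 + q ^+ k.+1) * (1 + q ^+ k.+2)) =
  (1 - q ^+ 2) * (q ^+ k.+1 * (1 + q ^+ k.+2)) * ((1 - q) * (1 - q ^+ k.+2)).
  rewrite !exprS; ring.
have s2 j : 0 < 1 - q ^+ j.+1 by rewrite subr_gt0 exprn_ilt1 // ltW.
have s0 : 0 < 1 - q by rewrite subr_gt0.
by apply: mulr_gt0; apply: mulr_gt0 => //; exact: mulr_gt0.
Qed.

Lemma path_deficit_mono j k : (j <= k)%N -> w j <= w k.
Proof.
move=> /subnKC <-; elim: (k - j)%N => [|i IH]; first by rewrite addn0.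
by rewrite addnS (le_trans IH) // -subr_ge0 ltW // path_deficit_step_gt0.
Qed.

Lemma path_deficit_lt j k : (j < k)%N -> w j < w k.
Proof.
move=> jk; apply: (@lt_le_trans _ _ (w j.+1)); last exact: path_deficit_mono.
by rewrite -subr_gt0 path_deficit_step_gt0.
Qed.

Lemma path_deficit_exchange1 a b : (0 < b)%N -> (b <= a)%N -> w a.+1 + w b.-1 < w a + w b.
Proof.
case: b => // b _ /= ba; rewrite -ltrBlDl addrAC -ltrBrDr.
move: ba; elim: a b => // a IH b; rewrite ltnS leq_eqVlt => /orP[/eqP ->|lt].
  exact: path_deficit_step_decr.
by apply: lt_trans (IH _ lt); exact: path_deficit_step_decr.
Qed.

(** Moving m vertices at once keeps the sum of the floors of the lengths divided by m, which single
    moves would not. *)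
Lemma path_deficit_exchange m a b : (0 < m)%N -> (m <= b)%N -> (b <= a)%N ->
  w (a + m)%N + w (b - m)%N < w a + w b.
Proof.
case: m => // m _; elim: m => [|m IH] mb ba.
  by rewrite addn1 subn1 path_deficit_exchange1.
apply: lt_trans (IH (ltnW mb) ba).
have -> : (b - m.+2 = (b - m.+1).-1)%N by lia.
by rewrite addnS path_deficit_exchange1 //; lia.
Qed.

Lemma path_deficit_lt_q k : w k < q.
Proof.
have /andP[q0 q1] := q01; have X : 0 < q ^+ k.+1 by exact: exprn_gt0.
rewrite /path_deficit ltr_pdivrMr ?addr_gt0 //.
have := mulr_gt0 q0 X; move: (q ^+ k.+1) X => c X h; nra.
Qed.

(** Together with [path_deficit_lt_q]: a nonempty block costs q up to order q^2, whatever its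
    length. *)
Lemma path_deficit_ge k : (0 < k)%N -> q * (1 - 2 * q) <= w k.
Proof.
move=> k0; apply: le_trans (path_deficit_mono 1 k k0).
have /andP[q0 q1] := q01; rewrite /path_deficit ler_pdivlMr ?addr_gt0 // ?exprn_gt0 //.
have q2 := mulr_gt0 q0 q0; have q3 := mulr_gt0 q0 q2; have q4 := mulr_gt0 q0 q3.
rewrite !expr2; nra.
Qed.
End Concavity.

Lemma sorted_geq_split c s : sorted geq s -> all (fun x => x <= c)%N s ->
  exists k tl, [/\ s = nseq k c ++ tl, sorted geq tl & all (fun x => x < c)%N tl].
Proof.
elim: s => [|x s IH]; first by exists 0%N, [::].
move=> xs /= /andP[xc sc].
move: xc; rewrite leq_eqVlt => /orP[/eqP xE|xc].
  have [k [tl [-> st tlc]]] := IH (path_sorted xs) sc.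
  by exists k.+1, tl; rewrite xE.
exists 0%N, (x :: s); split => //=; rewrite xc /=.
have tr : transitive geq by move=> a b d h1 h2; exact: leq_trans h2 h1.
apply/allP => z zs; move: xs; rewrite /= (path_sortedE tr) => /andP[/allP/(_ z zs) + _].
by move=> h; exact: leq_ltn_trans h xc.
Qed.

Lemma HP_blocksE n n1 c k r : (n - 2 = n1 + (k * c + r))%N -> (r < c)%N ->
  HP_blocks n n1 c = n1 :: nseq k c ++ (if r == 0%N then [::] else [:: r]).
Proof.
move=> E rc; have -> : HP_blocks n n1 c = if (c %| k * c + r)%N
  then n1 :: nseq ((k * c + r) %/ c)%N c
  else n1 :: nseq ((k * c + r) %/ c)%N c ++ [:: (k * c + r - (k * c + r) %/ c * c)%N].
  by rewrite /HP_blocks E addKn.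
have c0 : (0 < c)%N by lia.
rewrite divnMDl // divn_small // addn0 addKn /dvdn modnMDl modn_small //.
by case: eqP => // _; rewrite cats0.
Qed.

Lemma all_leq_trans c c' (s : seq nat) : (c <= c')%N -> all (fun x => x <= c)%N s -> all (fun x => x <= c')%N s.
Proof. by move=> cc; apply: sub_all => x; move/leq_trans; apply. Qed.

Lemma sorted_geq_all a s : sorted geq (a :: s) -> all (fun x => x <= a)%N s.
Proof.
have tr : transitive geq by move=> x y z h1 h2; exact: leq_trans h2 h1.
by move=> /= /(order_path_min tr).
Qed.

(** Two blocks shorter than c could exchange a vertex in favour of the longer one, so at most one
    block is shorter. *)
Lemma optimal_tail q c s : 0 < q < 1 -> (0 < c)%N -> sorted geq s ->
  all (fun x => x <= c)%N s -> all (fun x => 0 < x)%N s ->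
  (forall s', sumn s' = sumn s -> all (fun x => x <= c)%N s' -> deficit q s <= deficit q s') ->
  exists k r, (r < c)%N /\ s = nseq k c ++ (if r == 0%N then [::] else [:: r]).
Proof.
move=> q01 c0 sorted_s sc s0 opt.
have [k [[|x [|y tl]] [sE st tlc]]] := sorted_geq_split c s sorted_s sc.
- by exists k, 0%N.
- exists k, x; move: s0 tlc; rewrite sE all_cat /= !andbT => /andP[_ x0] ->.
  by rewrite gtn_eqF.
have yx : (y <= x)%N by case/andP: st.
move: s0 tlc; rewrite sE all_cat /= => /and4P[_ x0 y0 _] /and3P[xc yc tlc].
have : deficit q s <= deficit q (nseq k c ++ [:: x.+1, y.-1 & tl]).
  apply: opt; first by rewrite sE !sumn_cat /=; lia.
  rewrite all_cat all_nseq leqnn orbT /=; apply/and3P; split; [by []|by lia|].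
  by apply: sub_all tlc => z; exact: ltnW.
rewrite sE !deficit_cat !deficit_cons lerD2l !addrA lerD2r leNgt.
by rewrite (path_deficit_exchange1 q q01 x y).
Qed.

(** Lengthening the first block at the expense of the second forces b = c, at the expense of the
    third a + 2c = M, and [optimal_tail] shapes the rest. The value of c is then settled by the
    number of blocks. *)
Lemma optimal_path_blocks q M N a b c rest : 0 < q < 1 -> 4 * (M.+2)%:R * q < 1 -> (2 < M)%N ->
  (M * M + 5 * M < N)%N ->
  let s := [:: a, b, c & rest] in
  sorted geq s -> all (fun x => 0 < x)%N s -> sumn s = N -> (a + b + c <= M)%N ->
  (forall a' b' c' rest', sumn [:: a', b' & rest'] = N -> all (fun x => x <= c')%N rest' ->
     (c' <= a')%N -> (c' <= b')%N -> (a' + b' + c' <= M)%N -> deficit q s <= deficit q [:: a', b' & rest']) ->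
  exists k r, (r < M %/ 3)%N /\
    s = (M - 2 * (M %/ 3))%N :: nseq k (M %/ 3)%N ++ (if r == 0%N then [::] else [:: r]).
Proof.
move=> q01 qM M2 NM s sorted_s /and4P[a0 b0 c0 rest0] sN abcM opt.
have [q0 q1] := andP q01.
have [ba cb] : (b <= a)%N /\ (c <= b)%N by case/and3P: sorted_s.
have restc : all (fun x => x <= c)%N rest.
  by apply: sorted_geq_all; move: sorted_s => /= /and3P[].
have bE : b = c.
  apply/eqP; rewrite eqn_leq cb andbT leqNgt; apply/negP => lt.
  have : deficit q s <= deficit q [:: a.+1, b.-1, c & rest].
    apply: (opt _ _ c); rewrite /= ?leqnn //; move: sN; rewrite /=; clear - lt ba cb abcM; lia.
  rewrite /s !deficit_cons !addrA !lerD2r leNgt.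
  by rewrite (path_deficit_exchange1 q q01 a b).
subst b.
have aE : (a + 2 * c)%N = M.
  apply/eqP; rewrite eqn_leq; apply/andP; split; first by clear - abcM; lia.
  rewrite leqNgt; apply/negP => lt.
  have : deficit q s <= deficit q [:: a.+1, c, c.-1 & rest].
    apply: (opt _ _ c) => /=; rewrite ?leq_pred //; move: sN; rewrite /=; clear - lt ba c0 abcM; lia.
  rewrite /s !deficit_cons [w in _ <= w]addrCA [w in w <= _]addrCA lerD2l !addrA lerD2r leNgt.
  by rewrite (path_deficit_exchange1 q q01 a c).
have [k [r [rc restE]]] : exists k r, (r < c)%N /\ c :: c :: rest = nseq k c ++ (if r == 0%N then [::] else [:: r]).
  have st : sorted geq rest by move: sorted_s => /= /and3P[_ _ /path_sorted].
  have optr k : sumn k = sumn rest -> all (fun x => x <= c)%N k -> deficit q rest <= deficit q k.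
    move=> sk kc; have : deficit q s <= deficit q [:: a, c, c & k].
      apply: (opt _ _ c) => //=; [by rewrite sk|by rewrite leqnn].
    by rewrite /s !deficit_cons !lerD2l.
  have [k [r [rc E]]] := optimal_tail q c rest q01 c0 st restc rest0 optr.
  by exists k.+2, r; rewrite /= E.
have Mc : (M %/ 3)%N = c.
  have cM : (c <= M %/ 3)%N by rewrite leq_divRL //; clear - aE ba; lia.
  apply/eqP; rewrite eqn_leq cM andbT leqNgt; apply/negP => lt.
  have a3 : (c.+3 <= a)%N.
    have : (c.+1 * 3 <= M)%N by rewrite -leq_divRL.
    by clear - aE; lia.
  have sumrest : (a + (k * c + r) = N)%N.
    rewrite -sN /s -[sumn _]/(a + sumn (c :: c :: rest))%N restE sumn_cat sumn_nseq mulnC.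
    by case: eqP => [->|_] /=; rewrite ?addn0.
  have kc : (c + 3 <= k)%N.
    rewrite leqNgt; apply/negP => kc.
    have : (k * c <= (c + 2) * c)%N by rewrite leq_mul2r; clear - kc; lia.
    have : (c * c <= M * M)%N by apply: leq_mul; clear - aE; lia.
    clear - sumrest NM aE rc; nia.
  (* As c (c + 3) + 2 = (c + 1)(c + 2), c + 3 blocks of length c and two vertices of the first block
     become c + 2 blocks of length c + 1. This saves one block, worth at least q (1 - 2q), and the
     growth costs at most (c + 2) q^2 < q / 4. *)
  pose s' := [:: a - 2, c.+1 & nseq c.+1 c.+1 ++ nseq (k - (c + 3)) c ++ (if r == 0%N then [::] else [:: r])]%N.
  have : deficit q s <= deficit q s'.
    apply: (opt _ _ c.+1); rewrite ?leqnn //.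
    - rewrite /s' /= !sumn_cat !sumn_nseq -sumrest.
      have -> : sumn (if r == 0%N then [::] else [:: r]) = r by case: eqP => [->|_] //=; rewrite addn0.
      have -> : (k * c = (k - (c + 3)) * c + (c + 3) * c)%N by rewrite -mulnDl subnK.
      by clear - a3; lia.
    - rewrite !all_cat !all_nseq leqnn leqnSn !orbT /=; case: eqP => //= _.
      by rewrite andbT; clear - rc; lia.
    - by clear - a3; lia.
    - by clear - a3 aE; lia.
  rewrite /s' /s deficit_cons restE -cat_cons -[c.+1 :: nseq _ _]/(nseq c.+2 c.+1).
  rewrite deficit_cons !deficit_cat !addrA lerD2r !deficit_nseq leNgt natrB // => /negP; apply.
  have h1 := path_deficit_lt q q01 (a - 2) a ltac:(clear - a3; lia).
  have h2 := path_deficit_step_le q q01 c c0.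
  have h3 := path_deficit_ge q q01 c c0.
  have h4 : c.+2%:R * (path_deficit q c.+1 - path_deficit q c) <= c.+2%:R * q ^+ 2 :> RR.
    by rewrite ler_wpM2l.
  have h5 : 4 * c.+2%:R * q < 1.
    apply: le_lt_trans qM; rewrite ler_pM2r // ler_pM2l // ler_nat; clear - aE a3; lia.
  have h6 : (2%:R : RR) <= c.+2%:R by rewrite ler_nat.
  have -> : (c + 3)%:R = c.+2%:R + 1 :> RR by rewrite natr1; congr (_%:R); clear; lia.
  move: h1 h2 h3 h4 h5 h6; move: (path_deficit q _) (path_deficit q _) (path_deficit q _) (path_deficit q _) => p1 p2 p3 p4.
  move: (c.+2%:R : RR) (k%:R : RR) => C K; nra.
exists k, r; rewrite Mc; split=> //; rewrite -restE /s; congr cons; clear - aE; lia.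
Qed.

Lemma sumn_le_size (b : nat) s : all (fun x => x <= b)%N s -> (sumn s <= size s * b)%N.
Proof.
elim: s => //= x s IH /andP[xb /IH h]; rewrite mulSn; exact: leq_add.
Qed.

Lemma deficit_ge_size q s : 0 < q < 1 -> all (fun x => 0 < x)%N s ->
  (size s)%:R * (q * (1 - 2 * q)) <= deficit q s.
Proof.
move=> q01; elim: s => [|x s IH] /=; first by rewrite mul0r /deficit big_nil.
move=> /andP[x0 /IH h]; rewrite deficit_cons -natr1 mulrDl mul1r addrC lerD //.
exact: path_deficit_ge.
Qed.

Lemma deficit_le_size q s : 0 < q < 1 -> deficit q s <= (size s)%:R * q.
Proof.
move=> q01; elim: s => [|x s IH] /=; first by rewrite mul0r /deficit big_nil.
by rewrite deficit_cons -natr1 mulrDl mul1r addrC lerD // ltW // path_deficit_lt_q.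
Qed.

(** In decreasing order each block contributes at least 1 to the sum until all later ones contribute
    0. *)
Lemma sumn_divn_take m r s : sorted geq s ->
  (minn r (sumn [seq (k %/ m)%N | k <- s]) <= sumn [seq (k %/ m)%N | k <- take r s])%N.
Proof.
elim: s r => [|x s IH] [|r] //=; rewrite ?min0n ?minn0 // => sx.
have [x0|x0] := posnP (x %/ m)%N.
  have z : all (fun y => y <= 0)%N [seq (k %/ m)%N | k <- s].
    rewrite all_map; apply: sub_all (sorted_geq_all x s sx) => y /= yx.
    by rewrite -x0 leq_div2r.
  have := sumn_le_size 0 _ z; rewrite muln0; clear - x0; lia.
have := IH r (path_sorted sx); clear - x0; lia.
Qed.

Lemma sumn_divn0 m s : (0 < m)%N -> all (fun x => x <= m - 1)%N s -> sumn [seq (k %/ m)%N | k <- s] = 0%N.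
Proof.
by move=> m0; elim: s => //= x s IH /andP[xm /IH ->]; rewrite divn_small //; lia.
Qed.

(** If the floors sum up to at most t - 2, moving m vertices to the first block shows that no other
    block holds a leg; the first block is then as long as allowed and [optimal_tail] shapes the
    rest. *)
Lemma optimal_star_blocks q t m N s : 0 < q < 1 -> 20 * q < 1 -> (4 < t)%N -> (1 < m)%N ->
  (100 * (t * t * m + m) <= N)%N ->
  sorted geq s -> all (fun x => 0 < x)%N s -> sumn s = N ->
  all (fun x => x < t * m)%N s ->
  (forall s1 x y rest, s = s1 ++ [:: x, y & rest] ->
     (t - 1 <= sumn [seq (k %/ m)%N | k <- s1])%N -> (x + y + 1 < m)%N) ->
  (forall s', sumn s' = N -> (sumn [seq (k %/ m)%N | k <- s'] <= t - 2)%N -> deficit q s <= deficit q s') ->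
  exists k r, (r < m - 1)%N /\
    s = ((t - 1) * m - 1)%N :: nseq k (m - 1)%N ++ (if r == 0%N then [::] else [:: r]).
Proof.
move=> q01 q20 t4 m1 NT sorted_s s0 sN stm small opt.
have [q0 q1] := andP q01.
have m0 : (0 < m)%N by exact: ltnW.
have n1E : ((t - 1) * m - 1 = (t - 2) * m + (m - 1))%N.
  have -> : (t - 1 = (t - 2).+1)%N by clear - t4; lia.
  by rewrite mulSn; move: ((t - 2) * m)%N => A; clear - m0; lia.
have n1m : (((t - 1) * m - 1) %/ m = t - 2)%N.
  by rewrite n1E divnMDl // divn_small ?addn0 //; clear - m0; lia.
have n1N : ((t - 1) * m - 1 <= N)%N.
  apply: leq_trans NT; rewrite n1E.
  have : ((t - 2) * m <= t * m)%N by rewrite leq_mul2r leq_subr orbT.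
  have : (t * m <= t * t * m)%N by rewrite -mulnA leq_pmull //; clear - t4; lia.
  by move: ((t - 2) * m)%N (t * m)%N (t * t * m)%N => A B C; clear; lia.
have [le|gt] := leqP (sumn [seq (k %/ m)%N | k <- s]) (t - 2).
  case: s s0 sorted_s sN stm small opt le => [|a s] s0 sorted_s sN _ _ opt le.
    by move: sN NT => /= <-; clear - m0; lia.
  have sa := sorted_geq_all a s sorted_s.
  have sm : all (fun x => x <= m - 1)%N s.
    case: s s0 sorted_s sN opt le sa => [//|b s] s0 sorted_s sN opt le sa.
    have ba : (b <= a)%N by case/andP: sa.
    have bm : (b <= m - 1)%N.
      rewrite leqNgt; apply/negP => lt.
      have mb : (m <= b)%N by clear - lt m0; lia.
      have : deficit q [:: a, b & s] <= deficit q [:: a + m, b - m & s]%N.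
        apply: opt => /=; first by rewrite -sN /=; clear - mb; lia.
        move: le => /=; rewrite divnDr // divnn m0.
        have : (b %/ m = (b - m) %/ m + 1)%N by rewrite -[in LHS](subnK mb) divnDr // divnn m0.
        by clear; lia.
      rewrite !deficit_cons !addrA lerD2r leNgt.
      by rewrite (path_deficit_exchange q q01 m a b).
    rewrite /= bm /=; apply: all_leq_trans bm _.
    by apply: sorted_geq_all; move: sorted_s => /= /andP[].
  have fs := sumn_divn0 m s m0 sm.
  move: le; rewrite /= fs addn0 => aq.
  have an1 : (a <= (t - 1) * m - 1)%N.
    have : (a < (t - 1) * m)%N by rewrite -ltn_divLR //; clear - aq t4; lia.
    by clear; lia.
  have aE : a = ((t - 1) * m - 1)%N.
    apply/eqP; rewrite eqn_leq an1 leqNgt; apply/negP => lt.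
    case: s s0 sorted_s sN opt sa sm fs => [|b s] s0 sorted_s sN opt sa sm fs.
      by move: sN => /=; clear - lt n1N; lia.
    have ba : (b <= a)%N by case/andP: sa.
    have b0 : (0 < b)%N by case/and3P: s0.
    have : deficit q [:: a, b & s] <= deficit q [:: a.+1, b.-1 & s].
      apply: opt => /=; first by rewrite -sN /=; clear - b0; lia.
      have -> : (b.-1 %/ m = 0)%N.
        by rewrite divn_small //; case/andP: sm; clear - b0 m0; lia.
      move: fs => /=.
      have : (a.+1 %/ m <= t - 2)%N by rewrite -n1m leq_div2r.
      by move=> h /eqP; rewrite addn_eq0 => /andP[_ /eqP ->]; rewrite !addn0.
    rewrite !deficit_cons !addrA lerD2r leNgt.
    by rewrite (path_deficit_exchange1 q q01 a b).
  have s0' : all (fun x => 0 < x)%N s by case/andP: s0.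
  have c0 : (0 < m - 1)%N by clear - m1; lia.
  have opt' s' : sumn s' = sumn s -> all (fun x => x <= m - 1)%N s' -> deficit q s <= deficit q s'.
    move=> ss sm'; have : deficit q (a :: s) <= deficit q (a :: s').
      apply: opt => /=; first by rewrite ss.
      by rewrite (sumn_divn0 m s' m0 sm') addn0.
    by rewrite !deficit_cons lerD2l.
  have [k [r [rc E]]] := optimal_tail q (m - 1) s q01 c0 (path_sorted sorted_s) sm s0' opt'.
  by exists k, r; rewrite -aE -E.
(* Otherwise t - 1 legs fit into the first t - 1 blocks, and [small] bounds the next two lengths
   together, so that all but about t blocks are shorter than m / 2. That is nearly twice the number
   of blocks of the list [hp] below, too many when each costs between 9/10 q and q. *)
exfalso.
have fl : (t - 1 <= sumn [seq (k %/ m)%N | k <- take (t - 1) s])%N.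
  by apply: leq_trans (sumn_divn_take m _ s sorted_s); rewrite leq_min leqnn; clear - gt t4; lia.
have szs : (t < size s)%N.
  rewrite ltnNge; apply/negP => sz.
  have h : all (fun x => x <= t * m)%N s by apply: sub_all stm => x; exact: ltnW.
  have := sumn_le_size _ _ h; rewrite sN => le.
  have : (size s * (t * m) <= t * (t * m))%N by rewrite leq_mul2r sz orbT.
  by rewrite mulnA; move: le NT; clear - m0; lia.
have : (t.+1 - (t - 1) <= size (drop (t - 1) s))%N by rewrite size_drop leq_sub2r.
have := cat_take_drop (t - 1) s.
case: (drop (t - 1) s) => [|x [|y rest]] sE; [by clear - t4 => /=; lia|by clear - t4 => /=; lia|move=> _].
have xy := small _ _ _ _ (esym sE) fl.
have szt : size (take (t - 1) s) = (t - 1)%N.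
  by rewrite size_take ifT //; clear - szs t4; lia.
have sums1 : (sumn (take (t - 1) s) <= (t - 1) * (t * m))%N.
  rewrite -[in leqRHS]szt; apply: sumn_le_size; apply/allP => z /mem_take zs.
  by apply: ltnW; exact: (allP stm).
have tr : transitive geq by move=> a b d h1 h2; exact: leq_trans h2 h1.
have xyrest : [/\ (y <= x)%N & all (fun z => z <= y)%N rest].
  have : sorted geq (drop (t - 1) s) by exact: drop_sorted.
  by rewrite -[in drop _ _]sE drop_size_cat // => h; split; [case/andP: h|apply: sorted_geq_all; case/andP: h].
have [yx yrest] := xyrest.
have srest := sumn_le_size y rest yrest.
have szE : size s = (t + 1 + size rest)%N.
  by rewrite -sE size_cat szt /=; clear - t4; lia.
have Nle : (2 * N <= 2 * (t * t * m + m) + size s * (m - 1))%N.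
  rewrite -sN -sE sumn_cat /= sE szE mulnDl.
  have h1 : (2 * (size rest * y) <= size rest * (m - 1))%N.
    rewrite mulnCA leq_mul2l; apply/orP; right; clear - xy yx; lia.
  have h2 : ((t - 1) * (t * m) <= t * t * m)%N by rewrite -mulnA leq_mul2r leq_subr orbT.
  move: h2 sums1 h1 srest xy; move: ((t - 1) * (t * m))%N (t * t * m)%N ((t + 1) * (m - 1))%N.
  move: (size rest * (m - 1))%N (size rest * y)%N (sumn (take _ _)) (sumn rest) => A B C D E F G.
  by clear; lia.
pose n1 := ((t - 1) * m - 1)%N.
pose k := ((N - n1) %/ (m - 1))%N.
pose hp := n1 :: nseq k (m - 1)%N ++ [:: ((N - n1) %% (m - 1))%N].
have : deficit q s <= deficit q hp.
  apply: opt.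
    rewrite /= sumn_cat sumn_nseq /= addn0 mulnC -divn_eq subnKC //.
  rewrite /= n1m sumn_divn0 ?addn0 // all_cat all_nseq leqnn orbT /= andbT ltnW //.
  by rewrite ltn_mod; clear - m1; lia.
have := deficit_le_size q hp q01; have := deficit_ge_size q s q01 s0.
rewrite /= size_cat size_nseq /= => lo up h.
have : (size s)%:R * (q * (1 - 2 * q)) <= (k + 1).+1%:R * q by exact: le_trans lo (le_trans h up).
have -> : (size s)%:R * (q * (1 - 2 * q)) = (size s)%:R * (1 - 2 * q) * q by ring.
rewrite ler_pM2r // => h'.
have km : (k * (m - 1) <= N)%N by apply: leq_trans (leq_trunc_div _ _) _; exact: leq_subr.
have h9 : (9 * size s <= 10 * (k + 2))%N.
  rewrite -(ler_nat RR) !natrM; move: h'; rewrite addn2 addn1.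
  have : (0 : RR) <= (size s)%:R by [].
  move: (size s)%:R (k.+2%:R : RR) => S K S0 hh; nra.
have : (9 * size s * (m - 1) <= 10 * (k + 2) * (m - 1))%N by rewrite leq_mul2r h9 orbT.
move: km Nle NT m1; rewrite -!mulnA [((k + 2) * _)%N]mulnDl.
move: (t * (t * m))%N (k * (m - 1))%N (size s * (m - 1))%N => A B C; clear; lia.
Qed.

(** The smaller root of X^2 - lam X + 1; the last bound is q (lam - 1) = 1 - q (1 - q). *)
Lemma add_inv_root (lam : RR) : 2 < lam -> exists q, [/\ 0 < q < 1, lam = q + q^-1 & q * (lam - 1) < 1].
Proof.
move=> lam2; pose r := Num.sqrt (lam ^+ 2 - 4).
have r2 : r ^+ 2 = lam ^+ 2 - 4 by rewrite sqr_sqrtr //; nra.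
have r0 : 0 <= r by exact: sqrtr_ge0.
have rl : r < lam by nra.
have lr : lam - 2 < r by nra.
have q01 : 0 < (lam - r) / 2 < 1 by apply/andP; split; lra.
have e1 : (lam - r) / 2 * (lam - (lam - r) / 2) = 1 by move: r2; rewrite !expr2 => r2; nra.
exists ((lam - r) / 2); split => //.
  have q0 : (lam - r) / 2 != 0 by rewrite gt_eqF //; case/andP: q01.
  by apply: (mulfI q0); rewrite mulrDr divff //; nra.
have /andP[h1 h2] := q01; nra.
Qed.


Lemma expr4_le_exp2 (E : nat) : (E%:R + 10) ^+ 4 <= 2 ^+ (E + 14) :> RR.
Proof.
elim: E => [|E IH]; first by rewrite add0r add0n; lra.
rewrite addSn (exprS 2) -natr1; apply: le_trans (_ : 2 * (E%:R + 10) ^+ 4 <= _); last by rewrite ler_wpM2l.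
have : (10 : RR) <= E%:R + 10 by rewrite lerDr.
have -> : E%:R + 1 + 10 = (E%:R + 10) + 1 :> RR by ring.
move: (_ + 10) => x x10.
have h1 : 10 * x <= x ^+ 2 by rewrite expr2; nra.
have h2 : 10 * x ^+ 2 <= x ^+ 3 by rewrite (exprS _ 2) ler_wpM2r // sqr_ge0.
have h3 : 10 * x ^+ 3 <= x ^+ 4 by rewrite (exprS _ 3) ler_wpM2r // exprn_ge0 //; lra.
have -> : (x + 1) ^+ 4 = x ^+ 4 + 4 * x ^+ 3 + 6 * x ^+ 2 + 4 * x + 1 by ring.
lra.
Qed.

(** The first bound is 2.67 9^17 > 44 10^15. For the second, (n - 2)^2 is at least 170 10^6 times 10
    2^E, one factor from each part of [n0], which beats the fourth power in [expr4_le_exp2]. *)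
Lemma order_bounds (t l n E : nat) : E = ((t - 1) * (l - 1) + l - 3)%N -> n0 t l <= n%:R ->
  44 * 10 ^+ 15 <= n%:R :> RR /\ (100 * ((E + 10) * (E + 10)) <= n - 2)%N.
Proof.
rewrite /n0 ge_max => -> /andP[h1 h2]; split; first by apply: le_trans h1; lra.
set E' := (_ - 3)%N in h2 *.
have n2 : (2 <= n)%N by rewrite -(ler_nat RR); apply: le_trans h1; lra.
rewrite -(ler_nat RR) natrB // natrM natrM natrD.
have := expr4_le_exp2 E'; rewrite exprD => h3.
have h4 : 170 * 10 ^+ 6 <= n%:R - 2 :> RR by rewrite lerBrDr; apply: le_trans h1; lra.
have h5 : 10 * 2 ^+ E' <= n%:R - 2 :> RR.
  have : 0 <= 2 ^+ E' :> RR by rewrite exprn_ge0.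
  by move: h2; move: (2 ^+ E') => A *; lra.
have A0 : 0 < 2 ^+ E' :> RR by rewrite exprn_gt0.
have xg : (0 : RR) <= E'%:R + 10 by rewrite addr_ge0.
move: h3 h4 h5 A0 xg; have -> : (10%:R : RR) = 10 by [].
move: (2 ^+ E') (E'%:R + 10) (n%:R - 2) => A x N h3 h4 h5 A0 xg.
rewrite -(@ler_pXn2r _ 2) //; last first.
- by rewrite nnegrE; lra.
- by rewrite nnegrE; nra.
have : 170 * 10 ^+ 6 * (10 * A) <= N ^+ 2.
  rewrite expr2; apply: ler_pM => //; lra.
have -> : (100 * (x * x)) ^+ 2 = 10 ^+ 4 * x ^+ 4 by ring.
lra.
Qed.

(** * Extremal graphs *)

Lemma K2_join_block_star n a rest t m : (1 < n)%N -> (0 < m)%N -> sumn (a :: rest) = (n - 2)%N ->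
  (t * m <= a)%N -> has_star t m (K2_join n (a :: rest)).
Proof.
case: n => [//|n] n2 m0 sn tma; have {}sn : (a + sumn rest = n.+1 - 2)%N := sn.
have lt i j : (i < t)%N -> (j < m)%N -> (i * m + j < a)%N.
  move=> it jm; apply: leq_trans tma; apply: (@leq_trans (i.+1 * m)).
    by rewrite mulSn addnC ltn_add2r.
  by rewrite leq_mul2r it orbT.
exists (inord (n.+1 - 2)), (fun i j => inord (i * m + j)); split.
- move=> i j i' j' it jm it' jm' /(congr1 val); have := lt _ _ it jm; have := lt _ _ it' jm'.
  move=> h h'; rewrite /= !inordK; try by clear - h h' sn; lia.
  move=> E; have Ei : i = i'.
    by have := congr1 (divn^~ m) E; rewrite /= !divnMDl // !divn_small // !addn0.
  by split=> //; move: E; rewrite Ei; apply: addnI.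
- move=> i j it jm /(congr1 val); have h := lt _ _ it jm.
  by rewrite /= !inordK; clear - h sn; lia.
- move=> i it; have h := lt i 0%N it m0.
  rewrite /K2_join -(inj_eq val_inj) /= !inordK; try by clear - h sn; lia.
- move=> i j it jm; have h := lt _ _ it jm; rewrite /K2_join -(inj_eq val_inj) /=.
  rewrite !inordK; try by clear - h sn; lia.
  move: h; rewrite addnS => h; rewrite paths_adj_head // !orbT andbT; clear; lia.
Qed.

(** A form of the adjacency that ignores the order of the blocks, so that they may be sorted by
    length. *)
Lemma paths_adj_flatten (T : eqType) (bs : seq (seq T)) a b : uniq (flatten bs) ->
  a \in flatten bs -> b \in flatten bs ->
  paths_adj (map size bs) (index a (flatten bs)) (index b (flatten bs)) =
  has (fun B => [&& a \in B, b \in B & consecutive (index a B) (index b B)]) bs.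
Proof.
elim: bs => [|B bs IH] //=; rewrite cat_uniq !mem_cat => /and3P[_ /hasPn dis ubs] aB bB.
have out c : c \in flatten bs -> c \in B = false by move=> /dis /negbTE.
rewrite paths_adj_cons !index_cat.
case aB' : (a \in B); case bB' : (b \in B); rewrite ?index_mem ?aB' ?bB' /=.
- case: hasP => [[C Cbs /and3P[aC _ _]]|_]; last by rewrite orbF.
  by have := out a (introT flattenP (ex_intro2 _ _ C Cbs aC)); rewrite aB'.
- rewrite ltnNge leq_addr /= leqNgt index_mem aB' /=; symmetry; apply/hasPn => C Cbs; apply/negP => /and3P[aC _ _].
  by have := out a (introT flattenP (ex_intro2 _ _ C Cbs aC)); rewrite aB'.
- rewrite ltnNge leq_addr /= [(size B <= index b B)%N]leqNgt index_mem bB' /=; symmetry; apply/hasPn => C Cbs; apply/negP => /and3P[_ bC _].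
  by have := out b (introT flattenP (ex_intro2 _ _ C Cbs bC)); rewrite bB'.
- rewrite !addKn !leq_addr ltnNge leq_addr /= IH //; [by move: aB; rewrite aB'|by move: bB; rewrite bB'].
Qed.

Lemma paths_adj_flatten_perm (T : eqType) (bs bs' : seq (seq T)) a b : perm_eq bs bs' ->
  uniq (flatten bs) -> a \in flatten bs -> b \in flatten bs ->
  paths_adj (map size bs) (index a (flatten bs)) (index b (flatten bs)) =
  paths_adj (map size bs') (index a (flatten bs')) (index b (flatten bs')).
Proof.
move=> p ubs aB bB; have pf := perm_flatten p.
rewrite !paths_adj_flatten -?(perm_uniq pf) -?(perm_mem pf) //.
exact/eq_has_r/perm_mem.
Qed.

(** The test vector, 1 on the blocks and r at the heads, is the Perron vector of K_{2,n-2}, whose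
    radius is 2r with r^2 = (n - 2) / 2. *)
Lemma K2_join_spec_rad_ge n s : (2 < n)%N -> sumn s = (n - 2)%N ->
  0 < spec_rad (K2_join n s) /\ 2 * (n%:R - 2) <= spec_rad (K2_join n s) ^+ 2.
Proof.
move=> n3 sn; have n2 : (1 < n)%N by exact: ltnW.
have [sym irr] := K2_join_simple n s.
have [_ [_ _ _ bound]] := spec_rad_perron n (K2_join n s) sym (ltnW n2).
pose N : RR := n%:R - 2.
have N0 : 0 < N by rewrite subr_gt0 ltr_nat.
pose r := Num.sqrt (N / 2).
have r0 : 0 < r by rewrite sqrtr_gt0 divr_gt0.
have r2 : r ^+ 2 = N / 2 by rewrite sqr_sqrtr // ltW // divr_gt0.
pose zn x := if (x < n - 2)%N then 1 else r.
pose z (i : 'I_n) := zn i.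
have zn0 x : 0 <= zn x by rewrite /zn; case: ifP => // _; exact: ltW.
have NE : (n - 2)%:R = N by rewrite natrB //; exact: ltnW.
have hi : (n - 1 < n - 2)%N = false by clear - n3; lia.
have norm : sq_norm n z = 2 * N.
  rewrite /sq_norm (sum_low n s n2 sn (fun x => zn x ^+ 2)) /zn ltnn hi r2.
  rewrite (eq_bigr (fun=> 1)) => [|x _]; last by rewrite -sn ltn_ord expr1n.
  by rewrite sumr_const card_ord sn NE; field.
have low (i : 'I_n) : (i < n - 2)%N -> 2 * r <= adj_sum n (K2_join n s) z i.
  move=> il; rewrite (adj_sum_low n s n2 sn z zn) // /zn ltnn hi -/(zn _) -/(zn _) -addrA.
  rewrite [2 * r]mulr_natl mulr2n lerDl addr_ge0 //; case: ifP => // _; exact: zn0.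
have head (i : 'I_n) : (n - 2 <= i)%N -> N <= adj_sum n (K2_join n s) z i.
  move=> ih; pose F x : RR := if (x < n - 2)%N then 1 else 0.
  apply: (@le_trans _ _ (\sum_(j < n) F j)).
    rewrite (sum_low n s n2 sn F) /F ltnn hi !addr0.
    rewrite (eq_bigr (fun=> 1)) => [|x _]; last by rewrite -sn ltn_ord.
    by rewrite sumr_const card_ord sn NE.
  rewrite /adj_sum [leRHS]big_mkcond; apply: ler_sum => j _.
  rewrite /F; case: ifP => jl; last by case: ifP => // _; exact: zn0.
  rewrite /K2_join ih /= andbT; have -> : i != j.
    by rewrite -val_eqE /= gtn_eqF //; exact: leq_trans jl ih.
  by rewrite /z /zn jl.
have quad : 4 * r * N <= quad_form n (K2_join n s) z.
  pose F x : RR := if (x < n - 2)%N then 2 * r else r * N.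
  have -> : 4 * r * N = \sum_(i < n) F i.
    rewrite (sum_low n s n2 sn F) /F ltnn hi.
    rewrite (eq_bigr (fun=> 2 * r)) => [|x _]; last by rewrite -sn ltn_ord.
    by rewrite sumr_const card_ord sn -[_ *+ (n - 2)]mulr_natl NE; ring.
  apply: ler_sum => i _; rewrite /F /z /zn; case: (ltnP i (n - 2)) => [il|ih].
    by rewrite mul1r low.
  by rewrite ler_pM2l // head.
have := le_trans quad (bound z); rewrite norm => h.
have h2 : 2 * r <= spec_rad (K2_join n s).
  rewrite -(ler_pM2r N0) -(@ler_pM2l _ 2) //; apply: le_trans (le_trans _ h) _; first by rewrite le_eqVlt; apply/orP; left; apply/eqP; ring.
  by rewrite le_eqVlt; apply/orP; left; apply/eqP; ring.
split; first by apply: lt_le_trans h2; rewrite mulr_gt0.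
have -> : 2 * N = (2 * r) ^+ 2 by rewrite exprMn r2; field.
by rewrite ler_pXn2r // nnegrE ltW ?mulr_gt0 // (lt_le_trans _ h2) // mulr_gt0.
Qed.

Lemma head_join_blocks n (u v : 'I_n) (h : rel 'I_n) bs : u != v -> uniq (flatten bs) ->
  (forall a, (a \in flatten bs) = (a != u) && (a != v)) -> all (fun b => b != [::]) bs ->
  (forall a b, a \in flatten bs -> b \in flatten bs ->
     h a b = paths_adj (map size bs) (index a (flatten bs)) (index b (flatten bs))) ->
  exists s, [/\ sorted geq s, all (fun x => 0 < x)%N s, sumn s = (n - 2)%N &
    isomorphic (head_join u v h) (K2_join n s)].
Proof.
move=> uv ubs memb nz adj.
pose bs' := sort (fun a b : seq 'I_n => (size b <= size a)%N) bs.
have p : perm_eq bs bs' by rewrite perm_sym; exact/permPl/perm_sort.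
have pf := perm_flatten p.
have ubs' : uniq (flatten bs') by rewrite -(perm_uniq pf).
have memb' a : (a \in flatten bs') = (a != u) && (a != v) by rewrite -(perm_mem pf).
have adj' a b : a \in flatten bs' -> b \in flatten bs' ->
    h a b = paths_adj (map size bs') (index a (flatten bs')) (index b (flatten bs')).
  rewrite -!(perm_mem pf) => aB bB; rewrite adj //; exact: paths_adj_flatten_perm.
have [sn iso] := head_join_iso n u v h bs' uv ubs' memb' adj'.
exists (map size bs'); split => //.
  rewrite sorted_map; apply: sort_sorted => a b /=; exact: leq_total.
rewrite all_map -(perm_all _ p); apply: sub_all nz => b /=.
by rewrite lt0n size_eq0.
Qed.

(* [K] bounds the number of vertices of a path in the neighbourhood of a vertex
   of an [eF]-free graph. *)
Lemma spex_extremal_of_blocks n k (eF : rel 'I_k) E K s0 :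
  44 * 10 ^+ 15 <= n%:R :> RR -> (100 * ((E + 10) * (E + 10)) <= n - 2)%N -> (K <= E + 3)%N ->
  (forall e : rel 'I_n, simple_graph e -> Ffree eF e ->
     forall u x p, path e x p -> uniq (x :: p) -> (K <= size (x :: p))%N ->
       {in x :: p, forall z, e u z} -> False) ->
  (forall (e h : rel 'I_n) u v, simple_graph e -> symmetric h -> u != v ->
     (forall a b, h a b -> [/\ e a b, e u a & e v a]) -> (forall a, #|[set b | h a b]| <= 2)%N ->
     (2 * (E + 3).+1 < #|nbhd e u :&: nbhd e v|)%N -> Ffree eF e -> Ffree eF (head_join u v h)) ->
  sumn s0 = (n - 2)%N -> Ffree eF (K2_join n s0) ->
  (forall q s, 0 < q < 1 -> 13 * (E%:R + 10) * q < 1 -> sorted geq s -> all (fun x => 0 < x)%N s ->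
     sumn s = (n - 2)%N -> Ffree eF (K2_join n s) ->
     (forall s', sumn s' = (n - 2)%N -> Ffree eF (K2_join n s') -> deficit q s <= deficit q s') ->
     s = s0) ->
  spex_extremal eF (K2_join n s0).
Proof.
have sq (a b : RR) : 0 < a -> a <= b -> a ^+ 2 <= b ^+ 2 by move=> *; rewrite !expr2 ler_pM // ltW.
have sq' (a b : RR) : 0 < b -> a ^+ 2 <= b ^+ 2 -> a <= b by rewrite !expr2 => *; nra.
have E0 : (0 : RR) <= E%:R by exact: ler0n.
move=> nbig nE KE short transfer s0n s0F opt.
have n3 : (2 < n)%N by clear - nE; lia.
have n2 : (1 < n)%N by exact: ltnW.
have K2pl s : sumn s = (n - 2)%N -> planar (K2_join n s).
  move=> sn; apply: (isomorphic_planar n _ s n2); first by rewrite sn.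
  by exists id; split=> //; exists id.
split; first by split; [exact: K2_join_simple|split; [exact: K2pl|]].
move=> G sG plG FG maxG; have [symG irrG] := sG.
have [X0 X2] := K2_join_spec_rad_ge n s0 n3 s0n.
have XG := maxG _ (K2_join_simple n s0) (K2pl s0 s0n) s0F.
have G0 : 0 < spec_rad G by exact: lt_le_trans XG.
have G2 : 2 * (n%:R - 2) <= spec_rad G ^+ 2.
  exact: le_trans X2 (sq _ _ X0 XG).
have N100 : (100 * ((E + 10) * (E + 10)))%:R <= n%:R - 2 :> RR.
  by rewrite -natrB ?ler_nat // ltnW.
have KN : K%:R <= n%:R / 2 :> RR.
  have : K%:R <= (E + 3)%:R :> RR by rewrite ler_nat.
  move: N100; rewrite !natrM !natrD.
  move: (E%:R : RR) (K%:R : RR) (n%:R : RR) E0 => x y z; clear; nra.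
have [u [v [h [bs [[uv symh he deg2 R2] [ubs memb nz adj] alt]]]]] :=
  planar_dominating_pair n G K sG plG nbig G2 KN (short G sG FG).
have [s [sorted_s s0' sn iso]] := head_join_blocks n u v h bs uv ubs memb nz adj.
have RN : (2 * (E + 3).+1 < #|nbhd G u :&: nbhd G v|)%N.
  rewrite -(ltr_nat RR); apply: lt_le_trans R2.
  move: N100; rewrite -[(E + 3).+1]addn1 !natrM !natrD.
  move: (E%:R : RR) (n%:R : RR) E0 => x z; clear; nra.
have FH := transfer G h u v sG symh uv he deg2 RN FG.
have symH := head_join_sym _ u v h symh.
have FS : Ffree eF (K2_join n s) by exact: isomorphic_Ffree (isomorphic_sym _ _ _ iso) FH.
have [symS _] := K2_join_simple n s.
have radE : spec_rad (head_join u v h) = spec_rad (K2_join n s).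
  by apply: isomorphic_spec_rad iso => //; exact: ltnW.
have SG := maxG _ (K2_join_simple n s) (K2pl s sn) FS.
have GE : G =2 head_join u v h by case: alt => //; rewrite radE ltNge SG.
have GH : isomorphic G (K2_join n s).
  apply: isomorphic_trans iso; exists id; split; first by exists id.
  by move=> a b; rewrite GE.
have GS : spec_rad G = spec_rad (K2_join n s).
  by apply: isomorphic_spec_rad GH => //; exact: ltnW.
(* The square of the radius is at least 2 (n - 2) >= 200 (E + 10)^2. With q (rho - 1) < 1 this gives
   13 (E + 10) q < 1. *)
have lam14 : 14 * (E%:R + 10) <= spec_rad G.
  apply: sq' => //; apply: le_trans G2; move: N100; rewrite !natrM !natrD expr2.
  by move: (E%:R : RR) (n%:R : RR) E0 => x z; clear; nra.
have lam2 : 2 < spec_rad G by apply: lt_le_trans lam14; move: E0; clear; lra.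
have [q [q01 lamE qlam]] := add_inv_root _ lam2.
suff <- : s = s0 by [].
apply: (opt q) => //.
  apply: le_lt_trans qlam; rewrite mulrC; apply: ler_wpM2l; first by case/andP: q01 => /ltW.
  by move: lam14 E0; move: (spec_rad G) (E%:R : RR) => x y; clear; lra.
move=> s' sn' F'; apply: (deficit_le_of_spec_rad q q01 n s s' n2 sn sn'); first by rewrite -GS.
by rewrite -lamE; apply: maxG => //; [exact: K2_join_simple|exact: K2pl].
Qed.

Lemma sumn_tail n1 k c r : sumn (n1 :: nseq k c ++ (if r == 0%N then [::] else [:: r])) = (n1 + (k * c + r))%N.
Proof. by rewrite /= sumn_cat sumn_nseq mulnC; case: eqP => [->|_] /=; rewrite ?addn0. Qed.

Lemma all_tail c k r : (r < c)%N -> all (fun x => x <= c)%N (nseq k c ++ (if r == 0%N then [::] else [:: r])).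
Proof.
move=> rc; rewrite all_cat all_nseq leqnn orbT /=; case: eqP => //= _.
by rewrite andbT ltnW.
Qed.

Lemma HP_blocks_exists n n1 c : (0 < c)%N -> (n1 <= n - 2)%N -> exists k r,
  [/\ (r < c)%N, (n - 2 = n1 + (k * c + r))%N &
    HP_blocks n n1 c = n1 :: nseq k c ++ (if r == 0%N then [::] else [:: r])].
Proof.
move=> c0 n1n; exists ((n - 2 - n1) %/ c)%N, ((n - 2 - n1) %% c)%N.
have rc : ((n - 2 - n1) %% c < c)%N by rewrite ltn_mod.
have E : (n - 2 = n1 + ((n - 2 - n1) %/ c * c + (n - 2 - n1) %% c))%N.
  by rewrite -divn_eq subnKC.
by split=> //; exact: HP_blocksE.
Qed.

(** A join contains the path on M + 3 vertices exactly when its three longest blocks have more than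
    M vertices together; M is l - 3 for t = 1 and 2l - 4 for t = 2. *)
Lemma spex_extremal_path n k (eF : rel 'I_k) M : (2 < M)%N ->
  44 * 10 ^+ 15 <= n%:R :> RR -> (100 * ((M + 10) * (M + 10)) <= n - 2)%N ->
  (forall e : rel 'I_n, symmetric e -> contains_sub eF e <-> has_path (M + 3) e) ->
  spex_extremal eF (K2_join n (HP_blocks n (M - 2 * (M %/ 3)) (M %/ 3))).
Proof.
move=> M2 nbig nM FE; have n2 : (1 < n)%N by clear - nM; lia.
have M0 : (0 < M %/ 3)%N by rewrite divn_gt0.
have M3 : (M %/ 3 * 3 <= M)%N := leq_trunc_div M 3.
have FK s : Ffree eF (K2_join n s) <-> ~ has_path (M + 3) (K2_join n s).
  by have [sym _] := K2_join_simple n s; rewrite /Ffree FE.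
have MM : (M * M + 5 * M < n - 2)%N by clear - nM; nia.
have [k0 [r0 [rc0 nE HPE]]] := HP_blocks_exists n (M - 2 * (M %/ 3)) (M %/ 3) M0
   ltac:(clear - MM; lia).
have k00 : (0 < k0)%N.
  by rewrite lt0n; apply/negP => /eqP k00; move: nE; rewrite k00; clear - MM M3 rc0 M2; lia.
apply: (spex_extremal_of_blocks n k eF M (M + 3)) => //.
- move=> e [sym irr] Fe u x p pth up sz _; apply: Fe; apply/FE => //.
  exact: has_path_of_path pth up sz.
- move=> e h u v [sym irr] symh uv he deg2 R Fe /FE => H; apply: Fe; apply/FE => //.
  apply: (head_join_has_path n e h u v sym symh uv he irr); last by apply: H; exact: head_join_sym.
  by apply: leq_ltn_trans R; rewrite leq_mul2l ltnW.
- by rewrite HPE sumn_tail.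
- apply/FK; rewrite HPE; case: k0 k00 nE {HPE} => // k0 _ nE /=.
  apply: (K2_join_no_path n _ _ (M %/ 3)) => //.
  + by rewrite nE -sumn_tail.
  + exact: all_tail.
  + by clear - M3; lia.
  + by clear - M3; lia.
move=> q s q01 q13 sorted_s s0 sn Fs opt.
have Ps := (FK s).1 Fs.
have q0 : 0 < q by case/andP: q01.
have blk a s' : s = a :: s' -> (a <= M + 2)%N.
  move=> sE; rewrite leqNgt; apply/negP => aM; apply: Ps; rewrite sE.
  by apply: K2_join_block_path => //; [rewrite -sE|rewrite addnS].
case: s sorted_s s0 sn Fs opt Ps blk => [|a [|b [|c rest]]] sorted_s s0 sn Fs opt Ps blk.
- by move: sn MM => /= <-; clear; lia.
- by have := blk _ _ erefl; move: sn MM => /= <-; clear - M2; lia.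
- have := blk _ _ erefl; have : (b <= a)%N by case/andP: sorted_s.
  by move: sn MM => /= <-; clear - M2; lia.
have abc : (a + b + c <= M)%N.
  rewrite leqNgt; apply/negP => lt; apply: Ps; apply: K2_join_has_path => //.
  by clear - lt; lia.
have q4 : 4 * M.+2%:R * q < 1.
  apply: le_lt_trans q13; rewrite ler_pM2r // -[M.+2]addn2 natrD.
  by have := ler0n RR M; move: (M%:R : RR) => x; clear; lra.
have [|k1 [r [rc sE]]] := optimal_path_blocks q M (n - 2) a b c rest q01 q4 M2 MM sorted_s s0 sn abc.
  move=> a' b' c' rest' sn' rc' ca cb abc'; apply: opt => //; apply/FK.
  exact: K2_join_no_path rc' ca cb abc'.
by rewrite sE; symmetry; apply: HP_blocksE => //; rewrite -sumn_tail -sE sn.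
Qed.

(** Here m = l - 1 is the length of a leg. A sum of floors at most t - 2 suffices for freeness but
    is not necessary, so the optimal list is assumed only to satisfy the weaker consequences [stm]
    and [small] of freeness. *)
Lemma spex_extremal_star n k (eF : rel 'I_k) t m : (4 < t)%N -> (1 < m)%N ->
  44 * 10 ^+ 15 <= n%:R :> RR -> (100 * ((t * m - 2 + 10) * (t * m - 2 + 10)) <= n - 2)%N ->
  (forall e : rel 'I_n, symmetric e -> contains_sub eF e <-> has_star t m e) ->
  spex_extremal eF (K2_join n (HP_blocks n ((t - 1) * m - 1) (m - 1))).
Proof.
move=> t4 m1 nbig nM FE; have n2 : (1 < n)%N by clear - nM; lia.
have m0 : (0 < m)%N by exact: ltnW.
have tm10 : (10 <= t * m)%N by apply: (@leq_mul 5 2).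
have FK s : Ffree eF (K2_join n s) <-> ~ has_star t m (K2_join n s).
  by have [sym _] := K2_join_simple n s; rewrite /Ffree FE.
have tt : (t * t * m + m <= (t * m - 2 + 10) * (t * m - 2 + 10))%N.
  have h1 : (t * m * t <= t * m * (t * m))%N by rewrite leq_mul2l leq_pmulr // orbT.
  have h2 : (m <= t * m)%N by rewrite leq_pmull //; clear - t4; lia.
  have -> : (t * m - 2 + 10 = t * m + 8)%N by clear - tm10; lia.
  rewrite mulnAC; move: (t * m)%N h1 h2 => x; clear; nia.
have NT : (100 * (t * t * m + m) <= n - 2)%N by apply: leq_trans nM; rewrite leq_mul2l.
have n1E : ((t - 1) * m - 1 = (t - 2) * m + (m - 1))%N.
  have -> : (t - 1 = (t - 2).+1)%N by clear - t4; lia.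
  by rewrite mulSn; move: ((t - 2) * m)%N => A; clear - m0; lia.
have n1m : (((t - 1) * m - 1) %/ m = t - 2)%N.
  by rewrite n1E divnMDl // divn_small ?addn0 //; clear - m0; lia.
have n1n : ((t - 1) * m - 1 <= n - 2)%N.
  apply: leq_trans nM; have : ((t - 1) * m <= t * m)%N by rewrite leq_mul2r leq_subr orbT.
  move: ((t - 1) * m)%N (t * m)%N => A B; clear; nia.
have [k0 [r0 [rc0 nE HPE]]] := HP_blocks_exists n ((t - 1) * m - 1) (m - 1) ltac:(clear - m1; lia) n1n.
apply: (spex_extremal_of_blocks n k eF (t * m - 2) (t * m)) => //.
- by move: tm10; clear; lia.
- move=> e [sym irr] Fe u x p pth up sz eu; apply: Fe; apply/FE => //.
  exact: has_star_of_path pth up sz eu irr.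
- move=> e h u v [sym irr] symh uv he deg2 R Fe /FE => H; apply: Fe; apply/FE => //.
  apply: (head_join_has_star n e h u v sym symh uv he irr deg2) => //; last by apply: H; exact: head_join_sym.
  by apply: leq_ltn_trans R; rewrite leq_mul2l /= ltnS; move: tm10; clear; lia.
- by rewrite HPE sumn_tail.
- apply/FK; apply: K2_join_no_star => //; first by rewrite HPE sumn_tail.
  by rewrite HPE /= n1m sumn_divn0 ?addn0 //; exact: all_tail.
move=> q s q01 q13 sorted_s s0 sn Fs opt.
have Ps := (FK s).1 Fs.
have q0 : 0 < q by case/andP: q01.
have stm : all (fun x => x < t * m)%N s.
  case: s sorted_s s0 sn Fs opt Ps => // a s' sorted_s s0 sn Fs opt Ps.
  have atm : (a < t * m)%N.
    by rewrite ltnNge; apply/negP => tma; apply: Ps; exact: K2_join_block_star.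
  rewrite /= atm; apply: sub_all (sorted_geq_all a s' sorted_s) => x xa.
  exact: leq_ltn_trans xa atm.
have small s1 x y rest : s = s1 ++ [:: x, y & rest] ->
    (t - 1 <= sumn [seq (k %/ m)%N | k <- s1])%N -> (x + y + 1 < m)%N.
  move=> sE fl; rewrite ltnNge; apply/negP => mxy; apply: Ps; rewrite sE.
  by apply: K2_join_has_star => //; rewrite -sE.
have q20 : 20 * q < 1.
  apply: le_lt_trans q13; rewrite ler_pM2r //.
  by have := ler0n RR (t * m - 2); move: (_%:R : RR) => x; clear; lra.
have [|k1 [r [rc sE]]] := optimal_star_blocks q t m (n - 2) s q01 q20 t4 m1 NT sorted_s s0 sn stm small.
  by move=> s' sn' few; apply: opt => //; apply/FK; exact: K2_join_no_star.
by rewrite sE; symmetry; apply: HP_blocksE => //; rewrite -sumn_tail -sE sn.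
Qed.

Theorem theorem3 (t l n : nat) :
  ((t = 1)%N -> (6 <= l)%N ->
     Num.max (n0 t l) (625 / 32 * ((l - 3) %/ 3)%:R ^+ 2 + 2) <= n%:R ->
     spex_extremal (starlike t l)
       (K2_join_HP n (l - 3 - 2 * ((l - 3) %/ 3)) ((l - 3) %/ 3))) /\
  ((t = 2)%N -> (4 <= l)%N ->
     Num.max (n0 t l) (625 / 32 * ((2 * l - 4) %/ 3)%:R ^+ 2 + 2) <= n%:R ->
     spex_extremal (starlike t l)
       (K2_join_HP n (2 * l - 4 - 2 * ((2 * l - 4) %/ 3)) ((2 * l - 4) %/ 3))) /\
  ((5 <= t)%N -> (3 <= l)%N ->
     Num.max (n0 t l) (625 / 32 * ((l - 3) %/ 2)%:R ^+ 2 + 2) <= n%:R ->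
     spex_extremal (starlike t l) (K2_join_HP n (t * l - t - l) (l - 2))).
Proof.
split; [|split].
- move=> -> l6; rewrite ge_max => /andP[nn _].
  have [] := order_bounds 1 l n (l - 3) _ nn; first by rewrite subnn mul0n.
  move=> nbig nE; apply: (spex_extremal_path n _ _ (l - 3)) => //; first by clear - l6; lia.
  move=> e sym; have -> : (l - 3 + 3 = l)%N by clear - l6; lia.
  by apply: starlike1_path => //; clear - l6; lia.
- move=> -> l4; rewrite ge_max => /andP[nn _].
  have [] := order_bounds 2 l n (2 * l - 4) _ nn; first by rewrite mul1n; clear - l4; lia.
  move=> nbig nE; apply: (spex_extremal_path n _ _ (2 * l - 4)) => //; first by clear - l4; lia.
  move=> e sym; have -> : (2 * l - 4 + 3 = 2 * l - 1)%N by clear - l4; lia.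
  by apply: starlike2_path => //; clear - l4; lia.
move=> t5 l3; rewrite ge_max => /andP[nn _].
have tl : ((t - 1) * (l - 1) + l - 3 = t * (l - 1) - 2)%N.
  have -> : (t = (t - 1).+1)%N by clear - t5; lia.
  by rewrite subn1 /= mulSn; move: (_ * _)%N => A; clear - l3; lia.
have [nbig nE] := order_bounds t l n _ (esym tl) nn.
have -> : (t * l - t - l = (t - 1) * (l - 1) - 1)%N.
  have -> : (l = (l - 1).+1)%N by clear - l3; lia.
  have -> : (t = (t - 1).+1)%N by clear - t5; lia.
  by rewrite !subn1 /= mulSn mulnS; move: (_ * _)%N => A; clear; lia.
have -> : (l - 2 = l - 1 - 1)%N by clear; lia.
apply: (spex_extremal_star n _ _ t (l - 1)) => //; first by clear - l3; lia.
by move=> e sym; apply: contains_starlike => //; clear - l3; lia.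
Qed.
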